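(* There is a sequence of compact embedded minimal disks $0\in\Sigma_i\subset B_1\subset\mathbf{R}^3$ ($i=1,2,\dots$) with $\partial\Sigma_i\subset\partial B_1$ and containing the vertical segment $\{(0,0,t)\,|\,|t|<1\}\subset\Sigma_i$ such that: (1) $\lim_{i\to\infty}|A_{\Sigma_i}|^2(0)=\infty$. (2) $\sup_i\,\sup_{\Sigma_i\setminus B_\delta}|A_{\Sigma_i}|^2<\infty$ for all $\delta>0$. (3) For each $i$, $\Sigma_i\setminus\{x_3\text{-axis}\}=\Sigma_{1,i}\cup\Sigma_{2,i}$ for multi-valued graphs $\Sigma_{1,i}$ and $\Sigma_{2,i}$. (4) $\Sigma_i\setminus\{x_3=0\}$ converges, as $i\to\infty$, to two embedded minimal disks $\Sigma^{+}\subset\{x_3>0\}$ and $\Sigma^{-}\subset\{x_3<0\}$ with $\overline{\Sigma^{\pm}}\setminus\Sigma^{\pm}=B_1\cap\{x_3=0\}$. Moreover, $\Sigma^{\pm}\setminus\{x_3\text{-axis}\}=\Sigma_1^{\pm}\cup\Sigma_2^{\pm}$ for multi-valued graphs $\Sigma_1^{\pm}$ and $\Sigma_2^{\pm}$, each of which spirals into $\{x_3=0\}$.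
   Context: Standard coordinates $(x_1,x_2,x_3)$ are used on $\mathbf{R}^3$. $B_s(p)$ is the (closed) ball of radius $s$ centered at $p\in\mathbf{R}^3$, and $B_s=B_s(0)$. For a surface $\Sigma$ immersed in $\mathbf{R}^3$, $A_\Sigma$ denotes its second fundamental form (for $\Sigma$ minimal, $|A_\Sigma|^2=-2K_\Sigma$, with $K_\Sigma$ the Gauss curvature). Multi-valued graphs: let $D_r\subset\mathbf{C}$ be the disk of radius $r$ centered at the origin and let $\mathcal{P}$ be the universal cover of the punctured plane $\mathbf{C}\setminus\{0\}$, with global polar coordinates $(\rho,\theta)$, $\rho>0$, $\theta\in\mathbf{R}$. The graph of a single-valued function $u$ on a domain in $\mathcal{P}$ is the set of points $(\rho\cos\theta,\rho\sin\theta,u(\rho,\theta))\in\mathbf{R}^3$. An $N$-valued graph on the annulus $D_s\setminus D_r$ is the graph of a single-valued function $u$ over $\{(\rho,\theta)\,|\,r<\rho\le s,\ |\theta|\le N\pi\}$ (up to a shift of $\theta$). More generally, a multi-valued graph is the graph of a single-valued function over a domain in $\mathcal{P}$ (the number of sheets is not specified). A multi-valued graph $\Sigma\subset\{x_3>0\}$ (or $\subset\{x_3<0\}$) spirals into $\{x_3=0\}$ if it is $\infty$-valued with its sheets accumulating on the plane: for every $\varepsilon>0$ and every $N$, $\Sigma\cap\{0<|x_3|<\varepsilon\}$ contains an embedded $N$-valued graph over some annulus. Convergence in (4) is $C^2$ (equivalently, by minimality, smooth) convergence of surfaces on compact subsets of the complement of $\{x_3=0\}$. Closures are taken in $B_1$.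 *)

(* Defs.v *)
From Stdlib Require Import Reals List.
From Coquelicot Require Import Coquelicot.
Open Scope R_scope.

(* Points of R^3 carry Coquelicot's product uniform structure, whose topology
   is the Euclidean one. *)
Notation R3 := (R * R * R)%type.

Definition x1 (p : R3) : R := fst (fst p).
Definition x2 (p : R3) : R := snd (fst p).
Definition x3 (p : R3) : R := snd p.

Definition dot (p q : R3) : R := x1 p * x1 q + x2 p * x2 q + x3 p * x3 q.
Definition enorm (p : R3) : R := sqrt (dot p p).
Definition cross (p q : R3) : R3 :=
  (x2 p * x3 q - x3 p * x2 q,
   x3 p * x1 q - x1 p * x3 q,
   x1 p * x2 q - x2 p * x1 q).

Definition in_ball (s : R) (p : R3) : Prop := enorm p <= s.
Definition on_axis (p : R3) : Prop := x1 p = 0 /\ x2 p = 0.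

Definition closure {T : UniformSpace} (S : T -> Prop) (p : T) : Prop :=
  forall eps : posreal, exists q : T, S q /\ ball p eps q.

Definition compact_set {T : UniformSpace} (K : T -> Prop) : Prop :=
  forall cover : (T -> Prop) -> Prop,
    (forall U, cover U -> open U) ->
    (forall p, K p -> exists U, cover U /\ U p) ->
    exists l : list (T -> Prop),
      (forall U, In U l -> cover U) /\
      (forall p, K p -> exists U, In U l /\ U p).

Definition connected_open {T : UniformSpace} (O : T -> Prop) : Prop :=
  open O /\ (exists p, O p) /\
  forall U V : T -> Prop, open U -> open V ->
    (forall p, O p -> U p \/ V p) ->
    (exists p, O p /\ U p) -> (exists p, O p /\ V p) ->
    exists p, O p /\ U p /\ V p.

(* [ex_diff_n f n] at every point of an open set says that f is C^n there.
   As usual, a function is C^n (smooth) on a set that need not be open when it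
   is so on an open neighbourhood of that set. *)
Definition Cn_on (n : nat) (D : R * R -> Prop) (f : R -> R -> R) : Prop :=
  exists U : R * R -> Prop,
    open U /\ (forall z, D z -> U z) /\
    forall x y, U (x, y) -> ex_diff_n f n x y.

Definition smooth_on (D : R * R -> Prop) (f : R -> R -> R) : Prop :=
  exists U : R * R -> Prop,
    open U /\ (forall z, D z -> U z) /\
    forall n x y, U (x, y) -> ex_diff_n f n x y.

Definition coord1 (F : R -> R -> R3) (x y : R) : R := x1 (F x y).
Definition coord2 (F : R -> R -> R3) (x y : R) : R := x2 (F x y).
Definition coord3 (F : R -> R -> R3) (x y : R) : R := x3 (F x y).

Definition Cn_map_on (n : nat) (D : R * R -> Prop) (F : R -> R -> R3) : Prop :=
  Cn_on n D (coord1 F) /\ Cn_on n D (coord2 F) /\ Cn_on n D (coord3 F).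

Definition smooth_map_on (D : R * R -> Prop) (F : R -> R -> R3) : Prop :=
  smooth_on D (coord1 F) /\ smooth_on D (coord2 F) /\ smooth_on D (coord3 F).

(* The vector of partial derivatives d^(m+k) F / dx^m dy^k. *)
Definition pd (m k : nat) (F : R -> R -> R3) (x y : R) : R3 :=
  (partial_derive m k (coord1 F) x y,
   partial_derive m k (coord2 F) x y,
   partial_derive m k (coord3 F) x y).

Section Curvature.
Variables (F : R -> R -> R3) (x y : R).

Definition fffE : R := dot (pd 1 0 F x y) (pd 1 0 F x y).
Definition fffF : R := dot (pd 1 0 F x y) (pd 0 1 F x y).
Definition fffG : R := dot (pd 0 1 F x y) (pd 0 1 F x y).

Definition normal_vec : R3 := cross (pd 1 0 F x y) (pd 0 1 F x y).

Definition sffL : R := dot (pd 2 0 F x y) normal_vec / enorm normal_vec.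
Definition sffM : R := dot (pd 1 1 F x y) normal_vec / enorm normal_vec.
Definition sffN : R := dot (pd 0 2 F x y) normal_vec / enorm normal_vec.

(* Entries of the shape operator, the matrix product I^(-1) II. *)
Definition shape11 : R := (fffG * sffL - fffF * sffM) / (fffE * fffG - fffF ^ 2).
Definition shape12 : R := (fffG * sffM - fffF * sffN) / (fffE * fffG - fffF ^ 2).
Definition shape21 : R := (fffE * sffM - fffF * sffL) / (fffE * fffG - fffF ^ 2).
Definition shape22 : R := (fffE * sffN - fffF * sffM) / (fffE * fffG - fffF ^ 2).

Definition mean_curvature : R := (shape11 + shape22) / 2.

(* The squared norm g^{ik} g^{jl} A_{ij} A_{kl} of the second fundamental
   form A is the trace of the square of the shape operator. *)
Definition normA2 : R := shape11 ^ 2 + 2 * (shape12 * shape21) + shape22 ^ 2.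

End Curvature.

Definition closed_disk (z : R * R) : Prop := fst z ^ 2 + snd z ^ 2 <= 1.
Definition unit_circle (z : R * R) : Prop := fst z ^ 2 + snd z ^ 2 = 1.

(* Parameter domains of disks: the open unit disk together with a relatively
   open part of the unit circle.  A compact disk has domain [closed_disk];
   other domains give disks from which part of the boundary is missing. *)
Definition disk_domain (D : R * R -> Prop) : Prop :=
  (forall z, fst z ^ 2 + snd z ^ 2 < 1 -> D z) /\
  exists O : R * R -> Prop, open O /\ forall z, D z <-> O z /\ closed_disk z.

Definition image (D : R * R -> Prop) (F : R -> R -> R3) (p : R3) : Prop :=
  exists x y, D (x, y) /\ F x y = p.

(* The last clause is continuity of the inverse, so that F is a homeomorphism
   onto its image. *)
Definition embedding (D : R * R -> Prop) (F : R -> R -> R3) : Prop :=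
  smooth_map_on D F /\
  (forall x y, D (x, y) -> normal_vec F x y <> (0, 0, 0)) /\
  (forall x y x' y', D (x, y) -> D (x', y') -> F x y = F x' y' ->
     x = x' /\ y = y') /\
  (forall x y, D (x, y) -> forall eps : posreal, exists delta : posreal,
     forall x' y', D (x', y') -> ball (F x y) delta (F x' y') ->
       ball (x, y) eps (x', y')).

Definition embedded_minimal_disk (D : R * R -> Prop) (F : R -> R -> R3) : Prop :=
  disk_domain D /\ embedding D F /\
  forall x y, D (x, y) -> mean_curvature F x y = 0.

(* C^2 convergence, on compact subsets of the open set W, of the sets S i to
   the embedded surface F(D): over each compact K in W the limit surface is
   parametrized by a compact piece C of D, and for large i the sets S i contain
   surfaces G i (C) that exhaust the part of S i in K and whose
   parametrizations tend to F uniformly on C with derivatives up to order 2. *)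
Definition C2_converges (W : R3 -> Prop) (S : nat -> R3 -> Prop)
    (D : R * R -> Prop) (F : R -> R -> R3) : Prop :=
  forall K : R3 -> Prop, compact_set K -> (forall p, K p -> W p) ->
  exists (C : R * R -> Prop) (G : nat -> R -> R -> R3) (i0 : nat),
    compact_set C /\ (forall z, C z -> D z) /\
    (forall p, K p -> image D F p -> image C F p) /\
    (forall i, (i0 <= i)%nat ->
       Cn_map_on 2 C (G i) /\
       (forall p, image C (G i) p -> S i p) /\
       (forall p, K p -> S i p -> image C (G i) p)) /\
    (forall eps : posreal, exists i1 : nat,
       forall i, (i1 <= i)%nat -> forall m k, (m + k <= 2)%nat ->
       forall x y, C (x, y) -> ball (pd m k F x y) eps (pd m k (G i) x y)).

(* The universal cover of the punctured plane is {(rho, theta) | 0 < rho}.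
   Domains in it may contain part of their boundary. *)
Definition polar_domain (Om : R * R -> Prop) : Prop :=
  (forall z, Om z -> 0 < fst z) /\
  exists O : R * R -> Prop, connected_open O /\
    (forall z, O z -> Om z) /\ (forall z, Om z -> closure O z).

Definition graph_pt (u : R -> R -> R) (rho theta : R) : R3 :=
  (rho * cos theta, rho * sin theta, u rho theta).

Definition multivalued_graph (S : R3 -> Prop) : Prop :=
  exists (Om : R * R -> Prop) (u : R -> R -> R),
    polar_domain Om /\ smooth_on Om u /\
    forall p, S p <-> image Om (graph_pt u) p.

Definition polar_annulus (r s : R) (N : nat) (theta0 : R) (z : R * R) : Prop :=
  r < fst z <= s /\ Rabs (snd z - theta0) <= INR N * PI.

Definition contains_embedded_N_graph (N : nat) (S : R3 -> Prop) : Prop :=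
  exists (r s theta0 : R) (u : R -> R -> R),
    0 < r < s /\
    smooth_on (polar_annulus r s N theta0) u /\
    embedding (polar_annulus r s N theta0) (graph_pt u) /\
    forall p, image (polar_annulus r s N theta0) (graph_pt u) p -> S p.

Definition spirals_into_plane (S : R3 -> Prop) : Prop :=
  forall (eps : R) (N : nat), 0 < eps -> (0 < N)%nat ->
    contains_embedded_N_graph N (fun p => S p /\ 0 < Rabs (x3 p) < eps).

(* Main.v *)
Require Import Defs.
From Stdlib Require Import Reals Lra Psatz List ClassicalEpsilon.
From Coquelicot Require Import Coquelicot.
Open Scope R_scope.

(** The disks are pieces of explicit minimal surfaces.  Fix a large constant lam
and, for a > 0, let h be the holomorphic function with h' = lam / (z^2 + a^2),
h(0) = 0, where z = x + i y.  The Weierstrass data with Gauss map exp (i h) and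
height differential dz give, after a quarter turn about the vertical axis, a
conformal minimal immersion X of height x whose slice at height x is the curve
y -> X with velocity cosh (Im h) (cos (Re h), sin (Re h)), starting from the
vertical axis at y = 0.

Embeddedness comes from two competing estimates on the strip
16 kappa^2 y^2 < (x^2 + a^2)^(3/2).  Along a slice of the strip Re h departs
from its value on the axis by at most 1 ([h_re_bounds]), so the slice never turns
back and the signed distance s to the axis increases along it ([rho_y]).
But Im h is of the order of lam y / (x^2 + a^2), so the speed cosh (Im h) is
huge at the edge of the strip and s passes 2 and -2 inside the strip
([rho_reaches]).  Hence (x, s) are coordinates on the part of the surface at
distance less than 2 from the axis, and there the surface reads
F (x, s) = (s cos theta, s sin theta, x) with theta = theta (a, x, s).  It has
|F (x, s)|^2 = x^2 + s^2: the part in the unit ball is parametrized by the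
closed unit disk, its boundary lies on the unit sphere, the axis is s = 0, and
F is injective ([surface_pt_inj], [chart_embedding]).  Minimality and
|A|^2 = 2 |h'|^2 / cosh^4 (Im h) are computed in the isothermal coordinates
(x, y) and transported to any other chart ([curvature_algebra],
[chart_curvature]).

Blow-up at 0 is |A|^2 (0) = 2 lam^2 / a^4.  Away from 0 the curvature stays
bounded as a -> 0 ([curvature_bound]): either x is bounded away from 0, and so
is z^2 + a^2, or a definite distance s has been covered by a tiny y, which
forces cosh (Im h) to be large enough to absorb |h'|.

For fixed s <> 0 the angle theta increases with the height x ([theta_x]), so
height is a smooth function of distance and angle ([smooth3_inverse]), and the
two halves s > 0, s < 0 are multi-valued graphs ([turning_graph]).

On the axis Re h is (lam / a) atan (x / a).  With a = a_i chosen so that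
(lam / a) (pi / 2) is a multiple of 2 pi, at x <> 0 this may be replaced by
- (lam / a) atan (a / x) without changing the surface, and this second angle
extends smoothly through a = 0 ([Ulim], [Umain_Ulim]).  All the functions
involved have derivatives that are jointly continuous in (a, x, s), so the
convergence on compact sets of x <> 0 is just their continuity at a = 0
([limit_convergence]).  In the limit the angle is - lam / x + O(1), so that
arbitrarily close to the plane it takes every value beyond some threshold
([limit_angle_attained]).  This gives both the spiralling and the fact that the
closure of each limit disk contains the whole flat disk. *)

Notation R3U := (prod_UniformSpace (prod_UniformSpace R_UniformSpace R_UniformSpace) R_UniformSpace).

(** * Continuity and openness *)

Lemma continuous_pair {S T V : UniformSpace} (f : S -> T) (g : S -> V) p :
  continuous f p -> continuous g p -> continuous (fun q => (f q, g q)) p.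
Proof.
  intros Hf Hg P [e He].
  generalize (filter_and (F := locally p) _ _ (Hf _ (locally_ball _ e)) (Hg _ (locally_ball _ e))).
  unfold filtermap. apply filter_imp. intros q [K1 K2]. now apply He.
Qed.

Lemma cont_fst (u : R * R) : continuous (fun v : R * R => fst v) u.
Proof. destruct u; apply continuous_fst. Qed.
Lemma cont_snd (u : R * R) : continuous (fun v : R * R => snd v) u.
Proof. destruct u; apply continuous_snd. Qed.
Lemma cont_x3 (p : R3) : continuous (x3 : R3 -> R) p.
Proof. destruct p; apply continuous_snd. Qed.
Lemma cont_x1 (p : R3) : continuous (x1 : R3 -> R) p.
Proof. destruct p as [u]. apply (continuous_comp fst fst); [apply continuous_fst|apply cont_fst]. Qed.
Lemma cont_x2 (p : R3) : continuous (x2 : R3 -> R) p.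
Proof. destruct p as [u]. apply (continuous_comp fst snd); [apply continuous_fst|apply cont_snd]. Qed.

Ltac cont_auto := repeat match goal with
  | |- filterlim ?f (locally ?p) _ => change (continuous f p)
  | H : continuous ?f ?p |- continuous ?f ?p => exact H
  | |- continuous (fun _ => ?c) _ => apply continuous_const
  | |- continuous (fun t => t) _ => apply continuous_id
  | |- continuous (fun v => fst v) _ => apply cont_fst
  | |- continuous fst _ => apply cont_fst
  | |- continuous snd _ => apply cont_snd
  | |- continuous (fun v => snd v) _ => apply cont_snd
  | |- continuous (fun p => x1 p) _ => apply cont_x1
  | |- continuous (fun p => x2 p) _ => apply cont_x2
  | |- continuous (fun p => x3 p) _ => apply cont_x3
  | |- continuous x1 _ => apply cont_x1
  | |- continuous x2 _ => apply cont_x2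
  | |- continuous x3 _ => apply cont_x3
  | |- continuous (fun t => @?f t + @?g t) _ => apply (continuous_plus (V := R_NormedModule) f g)
  | |- continuous (fun t => @?f t - @?g t) _ => apply (continuous_minus (V := R_NormedModule) f g)
  | |- continuous (fun t => - @?f t) _ => apply (continuous_opp (V := R_NormedModule) f)
  | |- continuous (fun t => @?f t * @?g t) _ => apply (continuous_mult (K := R_AbsRing) f g)
  | |- continuous (fun t => (@?f t, @?g t)) _ => apply (continuous_pair f g)
  | |- continuous (fun t => sqrt (@?f t)) _ => apply (continuous_comp f sqrt); [|apply continuous_sqrt]
  | |- continuous (fun t => Rabs (@?f t)) _ => apply (continuous_comp f Rabs); [|apply continuous_Rabs]
  | |- continuous (fun t => cos (@?f t)) _ => apply (continuous_comp f cos); [|apply continuous_cos]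
  | |- continuous (fun t => sin (@?f t)) _ => apply (continuous_comp f sin); [|apply continuous_sin]
  end.

Lemma open_lt_cont {T : UniformSpace} (f g : T -> R) :
  (forall p, continuous f p) -> (forall p, continuous g p) -> open (fun p => f p < g p).
Proof.
  intros Hf Hg. apply open_ext with (fun p => 0 < g p - f p); [intros p; split; lra|].
  apply (open_comp (fun p => g p - f p) (fun u => 0 < u)); [|apply open_gt].
  intros p _. apply (continuous_minus (V := R_NormedModule) g f); auto.
Qed.

Ltac open_auto := repeat match goal with
  | |- open (fun p => @?f p < @?g p) => apply (open_lt_cont f g); intros; cont_auto
  | |- open (fun p => _ /\ _) => apply open_and
  | |- open (fun p => _ \/ _) => apply open_or
  end.

Lemma cont_eps {T : UniformSpace} (f : T -> R) p (eps : R) : 0 < eps -> continuous f p ->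
  locally p (fun q => Rabs (f q - f p) < eps).
Proof. intros H C. exact (C _ (locally_ball _ (mkposreal _ H))). Qed.

(** * Functions of two variables smooth up to a parameter *)

Definition cont3 (f : R -> R -> R -> R) (a x y : R) : Prop :=
  continuous (fun p : R3 => f (x1 p) (x2 p) (x3 p)) (a, x, y).

Definition partials (U : R3 -> Prop) (f fx fy : R -> R -> R -> R) : Prop :=
  forall a x y, U (a, x, y) ->
    is_derive (fun t => f a t y) x (fx a x y) /\ is_derive (fun t => f a x t) y (fy a x y).

(** C^n in (x, y) for each a, with all these derivatives jointly continuous in
    (a, x, y). Nothing is differentiated in the parameter a: joint continuity is
    exactly what turns the limit a -> 0 into uniform convergence of derivatives
    on compact sets. *)
Fixpoint Ck (n : nat) (U : R3 -> Prop) (f : R -> R -> R -> R) : Prop :=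
  (forall a x y, U (a, x, y) -> cont3 f a x y) /\
  match n with
  | O => True
  | S n' => exists fx fy : R -> R -> R -> R,
      partials U f fx fy /\
      Ck n' U fx /\ Ck n' U fy
  end.

Definition smooth3 (U : R3 -> Prop) (f : R -> R -> R -> R) : Prop :=
  forall n, Ck n U f.

Lemma cont3_loc_ext (f g : R -> R -> R -> R) (U : R3 -> Prop) a x y :
  open U -> U (a, x, y) -> (forall a x y, U (a, x, y) -> f a x y = g a x y) ->
  cont3 f a x y -> cont3 g a x y.
Proof.
  intros HU Hp Hfg Hf.
  unfold cont3 in *.
  apply (continuous_ext_loc (T := R3U) _ (fun p : R3 => f (x1 p) (x2 p) (x3 p))); [|exact Hf].
  specialize (HU _ Hp). revert HU. apply filter_imp.
  intros [[a' x'] y'] H. apply Hfg, H.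
Qed.

Lemma open_slice_x (U : R3 -> Prop) a x y :
  open U -> U (a, x, y) -> locally x (fun t => U (a, t, y)).
Proof.
  intros HU Hp. destruct (HU _ Hp) as [d Hd]. exists d. intros t Ht.
  apply Hd. split; [split|]; simpl; try apply ball_center. exact Ht.
Qed.

Lemma open_slice_y (U : R3 -> Prop) a x y :
  open U -> U (a, x, y) -> locally y (fun t => U (a, x, t)).
Proof.
  intros HU Hp. destruct (HU _ Hp) as [d Hd]. exists d. intros t Ht.
  apply Hd. split; [split|]; simpl; try apply ball_center. exact Ht.
Qed.

Lemma Ck_ext n (U : R3 -> Prop) f g :
  open U -> (forall a x y, U (a, x, y) -> f a x y = g a x y) ->
  Ck n U f -> Ck n U g.
Proof.
  intros HU Hfg H. destruct n as [|n]; simpl in *.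
  - split; [|easy]. intros a x y Hp. apply cont3_loc_ext with f U; try easy. now apply H.
  - destruct H as [Hc [fx [fy [Hd [Hx Hy]]]]]. split.
    + intros a x y Hp. apply cont3_loc_ext with f U; try easy. now apply Hc.
    + exists fx, fy. split; [|now split]. intros a x y Hp. destruct (Hd _ _ _ Hp) as [H1 H2]. split.
      * apply is_derive_ext_loc with (2 := H1).
        generalize (open_slice_x U a x y HU Hp). apply filter_imp. intros t Ht. now apply Hfg.
      * apply is_derive_ext_loc with (2 := H2).
        generalize (open_slice_y U a x y HU Hp). apply filter_imp. intros t Ht. now apply Hfg.
Qed.

Lemma Ck_cont n U f a x y : Ck n U f -> U (a, x, y) -> cont3 f a x y.
Proof. destruct n; intros [H _]; apply H. Qed.

Lemma Ck_pred n U f : Ck (S n) U f -> Ck n U f.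
Proof.
  revert f. induction n as [|n IH]; intros f [Hc [fx [fy [Hd [Hx Hy]]]]].
  - now split.
  - split; [easy|]. exists fx, fy. split; [easy|]. split; now apply IH.
Qed.

Lemma Ck_sub n (U V : R3 -> Prop) f :
  (forall p, V p -> U p) -> Ck n U f -> Ck n V f.
Proof.
  intros HVU. revert f. induction n as [|n IH]; intros f [Hc H].
  - split; [|easy]. intros; now apply Hc, HVU.
  - destruct H as [fx [fy [Hd [Hx Hy]]]]. split; [intros; now apply Hc, HVU|].
    exists fx, fy. split; [intros a x y Hp; now apply Hd, HVU|]. split; now apply IH.
Qed.

(** The derivatives in [Ck] are only asserted to exist; uniqueness of the
    derivative lets an explicit formula g inherit their regularity. *)
Lemma Ck_deriv_x n (U : R3 -> Prop) f g :
  open U -> Ck (S n) U f ->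
  (forall a x y, U (a, x, y) -> is_derive (fun t => f a t y) x (g a x y)) -> Ck n U g.
Proof.
  intros HU [_ [fx [fy [Hd [Hx _]]]]] Hg. apply Ck_ext with fx; try easy.
  intros a x y Hp. rewrite <- (is_derive_unique _ _ _ (Hg _ _ _ Hp)). symmetry.
  apply is_derive_unique. now apply Hd.
Qed.

Lemma Ck_deriv_y n (U : R3 -> Prop) f g :
  open U -> Ck (S n) U f ->
  (forall a x y, U (a, x, y) -> is_derive (fun t => f a x t) y (g a x y)) -> Ck n U g.
Proof.
  intros HU [_ [fx [fy [Hd [_ Hx]]]]] Hg. apply Ck_ext with fy; try easy.
  intros a x y Hp. rewrite <- (is_derive_unique _ _ _ (Hg _ _ _ Hp)). symmetry.
  apply is_derive_unique. now apply Hd.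
Qed.

Lemma cont3_plus f g a x y : cont3 f a x y -> cont3 g a x y ->
  cont3 (fun a x y => f a x y + g a x y) a x y.
Proof. intros Hf Hg. apply (continuous_plus (V := R_NormedModule) _ _ _ Hf Hg). Qed.

Lemma cont3_mult f g a x y : cont3 f a x y -> cont3 g a x y ->
  cont3 (fun a x y => f a x y * g a x y) a x y.
Proof. intros Hf Hg. apply (continuous_mult _ _ _ Hf Hg). Qed.

Lemma cont3_comp g f1 f2 f3 a x y :
  cont3 f1 a x y -> cont3 f2 a x y -> cont3 f3 a x y ->
  cont3 g (f1 a x y) (f2 a x y) (f3 a x y) ->
  cont3 (fun a x y => g (f1 a x y) (f2 a x y) (f3 a x y)) a x y.
Proof.
  intros H1 H2 H3 Hg. unfold cont3 in *.
  apply (continuous_comp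
    (fun p : R3 => (f1 (x1 p) (x2 p) (x3 p), f2 (x1 p) (x2 p) (x3 p), f3 (x1 p) (x2 p) (x3 p)))
    (fun p : R3 => g (x1 p) (x2 p) (x3 p))); [|exact Hg].
  now repeat apply continuous_pair.
Qed.

Lemma cont3_comp1 (g : R -> R) f a x y :
  cont3 f a x y -> continuous g (f a x y) -> cont3 (fun a x y => g (f a x y)) a x y.
Proof.
  intros Hf Hg. apply (continuous_comp (fun p : R3 => f (x1 p) (x2 p) (x3 p)) g); assumption.
Qed.

Lemma Ck_const n U c : Ck n U (fun _ _ _ => c).
Proof.
  revert c. induction n as [|n IH]; intros c.
  - split; [|easy]. intros; unfold cont3; cont_auto.
  - split; [intros; unfold cont3; cont_auto|]. exists (fun _ _ _ => 0), (fun _ _ _ => 0).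
    split; [|split; apply IH]. intros; split; apply @is_derive_const.
Qed.

Lemma Ck_a n U : Ck n U (fun a _ _ => a).
Proof.
  destruct n as [|n]; (split; [intros; unfold cont3; cont_auto|]); [easy|].
  exists (fun _ _ _ => 0), (fun _ _ _ => 0).
  split; [|split; apply Ck_const]. intros; split; apply @is_derive_const.
Qed.

Lemma Ck_x n U : Ck n U (fun _ x _ => x).
Proof.
  destruct n as [|n]; (split; [intros; unfold cont3; cont_auto|]); [easy|].
  exists (fun _ _ _ => 1), (fun _ _ _ => 0).
  split; [|split; apply Ck_const]. intros; split; [apply @is_derive_id|apply @is_derive_const].
Qed.

Lemma Ck_y n U : Ck n U (fun _ _ y => y).
Proof.
  destruct n as [|n]; (split; [intros; unfold cont3; cont_auto|]); [easy|].
  exists (fun _ _ _ => 0), (fun _ _ _ => 1).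
  split; [|split; apply Ck_const]. intros; split; [apply @is_derive_const|apply @is_derive_id].
Qed.

Lemma Ck_plus n U f g : Ck n U f -> Ck n U g -> Ck n U (fun a x y => f a x y + g a x y).
Proof.
  revert f g. induction n as [|n IH]; intros f g [Hf Hf'] [Hg Hg'].
  - split; [|easy]. intros; apply cont3_plus; auto.
  - split; [intros; apply cont3_plus; auto|].
    destruct Hf' as [fx [fy [Df [Hfx Hfy]]]]. destruct Hg' as [gx [gy [Dg [Hgx Hgy]]]].
    exists (fun a x y => fx a x y + gx a x y), (fun a x y => fy a x y + gy a x y).
    split; [|split; now apply IH].
    intros a x y Hp. destruct (Df _ _ _ Hp), (Dg _ _ _ Hp).
    split; now apply @is_derive_plus.
Qed.

Lemma Ck_mult n U f g : Ck n U f -> Ck n U g -> Ck n U (fun a x y => f a x y * g a x y).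
Proof.
  revert f g. induction n as [|n IH]; intros f g Hf0 Hg0.
  - destruct Hf0 as [Hf _], Hg0 as [Hg _]. split; [|easy]. intros; apply cont3_mult; auto.
  - assert (Hf1 := Ck_pred _ _ _ Hf0). assert (Hg1 := Ck_pred _ _ _ Hg0).
    destruct Hf0 as [Hf Hf'], Hg0 as [Hg Hg'].
    split; [intros; apply cont3_mult; auto|].
    destruct Hf' as [fx [fy [Df [Hfx Hfy]]]]. destruct Hg' as [gx [gy [Dg [Hgx Hgy]]]].
    exists (fun a x y => fx a x y * g a x y + f a x y * gx a x y),
           (fun a x y => fy a x y * g a x y + f a x y * gy a x y).
    split; [|split; apply Ck_plus; now apply IH].
    intros a x y Hp. destruct (Df _ _ _ Hp), (Dg _ _ _ Hp).
    split.
    + apply (is_derive_mult (fun t => f a t y) (fun t => g a t y)); auto. intros; apply Rmult_comm.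
    + apply (is_derive_mult (fun t => f a x t) (fun t => g a x t)); auto. intros; apply Rmult_comm.
Qed.

Lemma Ck_opp n U f : open U -> Ck n U f -> Ck n U (fun a x y => - f a x y).
Proof.
  intros HU Hf. apply Ck_ext with (fun a x y => -1 * f a x y); [easy|intros; ring|].
  apply Ck_mult; [apply Ck_const|easy].
Qed.

Lemma Ck_minus n U f g : open U -> Ck n U f -> Ck n U g -> Ck n U (fun a x y => f a x y - g a x y).
Proof. intros HU Hf Hg. apply Ck_plus; [easy|]. now apply Ck_opp. Qed.

Lemma chain2 (g : R -> R -> R) (al be : R -> R) t l1 l2 d1 d2 :
  differentiable_pt_lim g (al t) (be t) l1 l2 ->
  is_derive al t d1 -> is_derive be t d2 ->
  is_derive (fun s => g (al s) (be s)) t (l1 * d1 + l2 * d2).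
Proof.
  intros Hg Ha Hb.
  assert (Ha' := differentiable_pt_lim_proj1_0 al t 0 d1 (proj1 (is_derive_Reals _ _ _) Ha)).
  assert (Hb' := differentiable_pt_lim_proj1_0 be t 0 d2 (proj1 (is_derive_Reals _ _ _) Hb)).
  assert (H := differentiable_pt_lim_comp g (fun u _ => al u) (fun u _ => be u) t 0 _ _ _ _ _ _ Hg Ha' Hb').
  rewrite !Rmult_0_r, Rplus_0_r in H.
  apply is_derive_Reals. exact (differentiable_pt_lim_proj1_1 (fun s => g (al s) (be s)) t 0 _ H).
Qed.

Lemma cont3_slice f a x y : cont3 f a x y ->
  continuous (fun u : R * R => f a (fst u) (snd u)) (x, y).
Proof.
  intros H.
  apply (continuous_comp (fun u : R * R => (a, fst u, snd u) : R3) (fun p : R3 => f (x1 p) (x2 p) (x3 p))); [|exact H].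
  repeat apply continuous_pair; cont_auto.
Qed.

(** Continuity of one partial derivative near the point, with existence of the
    other, suffices for total differentiability. *)
Lemma Ck_differentiable n (U : R3 -> Prop) f fx fy a x y :
  open U -> U (a, x, y) ->
  partials U f fx fy ->
  Ck n U fx -> differentiable_pt_lim (f a) x y (fx a x y) (fy a x y).
Proof.
  intros HU Hp Hd Hx.
  apply filterdiff_differentiable_pt_lim.
  apply (is_derive_filterdiff (f a) x y (fx a) (fy a x y)).
  - destruct (HU _ Hp) as [d Hd']. exists d. intros [u v] [B1 B2]. apply Hd. apply Hd'.
    split; [split|]; simpl; try assumption. apply ball_center.
  - now apply Hd.
  - apply cont3_slice. now apply (Ck_cont n U).
Qed.

(** Only the variables x and y are substituted: substituting for a would require
    regularity in the parameter, which [Ck] does not provide. *)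
Lemma Ck_comp n (U V : R3 -> Prop) g f1 f2 :
  open V -> Ck n V g -> Ck n U f1 -> Ck n U f2 ->
  (forall a x y, U (a, x, y) -> V (a, f1 a x y, f2 a x y)) ->
  Ck n U (fun a x y => g a (f1 a x y) (f2 a x y)).
Proof.
  intros HV. revert g f1 f2. induction n as [|n IH]; intros g f1 f2 Hg H1 H2 HUV;
    assert (C : forall a x y, U (a, x, y) -> cont3 (fun a x y => g a (f1 a x y) (f2 a x y)) a x y)
      by (intros; apply (cont3_comp g (fun a _ _ => a) f1 f2); [apply cont_x1|now apply H1|now apply H2|now apply Hg, HUV]);
    (split; [exact C|]); [easy|].
  assert (H1' := Ck_pred _ _ _ H1). assert (H2' := Ck_pred _ _ _ H2).
  destruct Hg as [_ [gx [gy [Dg [Hgx Hgy]]]]].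
  destruct H1 as [_ [f1x [f1y [D1 [H1x H1y]]]]].
  destruct H2 as [_ [f2x [f2y [D2 [H2x H2y]]]]].
  exists (fun a x y => gx a (f1 a x y) (f2 a x y) * f1x a x y + gy a (f1 a x y) (f2 a x y) * f2x a x y),
         (fun a x y => gx a (f1 a x y) (f2 a x y) * f1y a x y + gy a (f1 a x y) (f2 a x y) * f2y a x y).
  split.
  - intros a x y Hp. assert (DD := Ck_differentiable n V g gx gy _ _ _ HV (HUV _ _ _ Hp) Dg Hgx).
    destruct (D1 _ _ _ Hp), (D2 _ _ _ Hp). split.
    + now apply (chain2 (g a) (fun t => f1 a t y) (fun t => f2 a t y)).
    + now apply (chain2 (g a) (fun t => f1 a x t) (fun t => f2 a x t)).
  - split; apply Ck_plus; apply Ck_mult; first [assumption | now apply (IH gx f1 f2) | now apply (IH gy f1 f2)].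
Qed.

Lemma is_derive_comp_R (f g : R -> R) x df dg : is_derive f (g x) df -> is_derive g x dg ->
  is_derive (fun t => f (g t)) x (df * dg).
Proof. intros Hf Hg. rewrite Rmult_comm. apply (is_derive_comp f g); easy. Qed.

(** Reduces composition with an elementary g to the same statement for g', one
    order lower. The derivatives of exp, sin, cos, 1 / t, sqrt and atan are
    built from these functions and rational operations, so each of them follows
    by a short induction on n. *)
Lemma Ck_comp1 n (U : R3 -> Prop) (g dg : R -> R) f :
  (forall a x y, U (a, x, y) -> is_derive g (f a x y) (dg (f a x y))) -> Ck n U f ->
  (forall m, n = S m -> Ck m U (fun a x y => dg (f a x y))) -> Ck n U (fun a x y => g (f a x y)).
Proof.
  intros Hg Hf Hdg.
  (* continuity is part of every order, so it is settled before n is split *)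
  assert (C : forall a x y, U (a, x, y) -> cont3 (fun a x y => g (f a x y)) a x y).
  { intros a x y Hp. apply cont3_comp1; [now apply (Ck_cont n U)|].
    apply (ex_derive_continuous g). eexists. now apply Hg. }
  destruct n as [|n]; (split; [exact C|]); [easy|].
  destruct Hf as [_ [fx [fy [D [Hx Hy]]]]]. specialize (Hdg n eq_refl).
  exists (fun a x y => dg (f a x y) * fx a x y), (fun a x y => dg (f a x y) * fy a x y).
  split; [|split; now apply Ck_mult].
  intros a x y Hp. destruct (D _ _ _ Hp). specialize (Hg _ _ _ Hp). split.
  - now apply (is_derive_comp_R g (fun t => f a t y)).
  - now apply (is_derive_comp_R g (fun t => f a x t)).
Qed.

Lemma Ck_exp n (U : R3 -> Prop) f : Ck n U f -> Ck n U (fun a x y => exp (f a x y)).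
Proof.
  revert f. induction n as [|n IH]; intros f Hf; apply Ck_comp1 with exp; intros; try apply is_derive_exp; try easy.
  injection H as <-. now apply IH, Ck_pred.
Qed.

Lemma Ck_trig n (U : R3 -> Prop) f : open U -> Ck n U f ->
  Ck n U (fun a x y => sin (f a x y)) /\ Ck n U (fun a x y => cos (f a x y)).
Proof.
  intros HU. revert f. induction n as [|n IH]; intros f Hf;
    (split; [apply (Ck_comp1 _ U sin cos)|apply (Ck_comp1 _ U cos (fun t => - sin t))]);
    intros; try apply is_derive_sin; try apply is_derive_cos; try easy; injection H as <-.
  - now apply IH, Ck_pred.
  - apply (Ck_opp _ _ (fun a x y => sin (f a x y)) HU). now apply IH, Ck_pred.
Qed.

Lemma Ck_inv n (U : R3 -> Prop) f : open U -> Ck n U f -> (forall a x y, U (a, x, y) -> f a x y <> 0) ->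
  Ck n U (fun a x y => / f a x y).
Proof.
  intros HU. revert f. induction n as [|n IH]; intros f Hf HN;
    apply (Ck_comp1 _ U Rinv (fun t => - (/ t * / t))); try easy.
  1, 2: intros a x y Hp; specialize (HN _ _ _ Hp);
    replace (- (/ f a x y * / f a x y)) with (- 1 / f a x y ^ 2) by (field; easy);
    apply (is_derive_inv (fun t => t)); [apply @is_derive_id|easy].
  intros m E; injection E as <-. apply (Ck_opp _ _ (fun a x y => / f a x y * / f a x y) HU).
  apply Ck_mult; now apply IH; [apply Ck_pred|].
Qed.

Lemma Ck_div n (U : R3 -> Prop) f g : open U -> Ck n U f -> Ck n U g ->
  (forall a x y, U (a, x, y) -> g a x y <> 0) -> Ck n U (fun a x y => f a x y / g a x y).
Proof. intros HU Hf Hg H. apply Ck_mult; [easy|]. now apply Ck_inv. Qed.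

Lemma Ck_sqrt n (U : R3 -> Prop) f : open U -> Ck n U f -> (forall a x y, U (a, x, y) -> 0 < f a x y) ->
  Ck n U (fun a x y => sqrt (f a x y)).
Proof.
  intros HU. revert f. induction n as [|n IH]; intros f Hf HN;
    apply (Ck_comp1 _ U sqrt (fun t => / (2 * sqrt t))); try easy.
  1, 2: intros a x y Hp; apply is_derive_Reals, derivable_pt_lim_sqrt; auto.
  intros m E; injection E as <-. apply (Ck_inv n U (fun a x y => 2 * sqrt (f a x y)) HU).
  - apply Ck_mult; [apply Ck_const|]. now apply IH; [apply Ck_pred|].
  - intros a x y Hp. assert (0 < sqrt (f a x y)) by (apply sqrt_lt_R0; auto). lra.
Qed.

Lemma Ck_atan n (U : R3 -> Prop) f : open U -> Ck n U f -> Ck n U (fun a x y => atan (f a x y)).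
Proof.
  intros HU Hf. apply (Ck_comp1 _ U atan (fun t => / (1 + t ^ 2))); [|easy|].
  - intros a x y _. apply is_derive_Reals, derivable_pt_lim_atan.
  - intros m ->. apply Ck_pred in Hf. apply (Ck_inv m U (fun a x y => 1 + f a x y * (f a x y * 1)) HU).
    + repeat first [apply Ck_plus|apply Ck_mult|apply Ck_const|easy].
    + intros; nra.
Qed.

Ltac Ck_auto := repeat match goal with
  | |- Ck _ _ (fun _ _ _ => ?c) => apply Ck_const
  | |- Ck _ _ (fun a _ _ => a) => apply Ck_a
  | |- Ck _ _ (fun _ x _ => x) => apply Ck_x
  | |- Ck _ _ (fun _ _ y => y) => apply Ck_y
  | |- Ck _ _ (fun a x y => @?f a x y + @?g a x y) => apply (Ck_plus _ _ f g)
  | |- Ck _ _ (fun a x y => @?f a x y * @?g a x y) => apply (Ck_mult _ _ f g)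
  | HO : open ?U |- Ck _ ?U (fun a x y => @?f a x y - @?g a x y) => apply (Ck_minus _ _ f g HO)
  | HO : open ?U |- Ck _ ?U (fun a x y => @?f a x y / @?g a x y) => apply (Ck_div _ _ f g HO)
  | HO : open ?U |- Ck _ ?U (fun a x y => - @?f a x y) => apply (Ck_opp _ _ f HO)
  | HO : open ?U |- Ck _ ?U (fun a x y => sin (@?f a x y)) => apply (Ck_trig _ _ f HO)
  | HO : open ?U |- Ck _ ?U (fun a x y => cos (@?f a x y)) => apply (Ck_trig _ _ f HO)
  | HO : open ?U |- Ck _ ?U (fun a x y => sqrt (@?f a x y)) => apply (Ck_sqrt _ _ f HO)
  | HO : open ?U |- Ck _ ?U (fun a x y => atan (@?f a x y)) => apply (Ck_atan _ _ f HO)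
  | |- Ck _ _ (fun a x y => exp (@?f a x y)) => apply (Ck_exp _ _ f)
  | H : smooth3 ?U ?f |- Ck _ ?U _ => apply H
  end.

(** * Integrals depending on parameters *)

(** The tube lemma for [a, b]: a property that holds near each point of p0 x [a,
    b] holds uniformly in the second variable. Cousin's lemma plays the role of
    a finite subcover. *)
Lemma tube {T : UniformSpace} (P : T -> R -> Prop) (p0 : T) a b :
  (forall t, a <= t <= b -> exists d : posreal, forall p t', ball p0 d p -> Rabs (t' - t) < d -> P p t') ->
  exists d : posreal, forall p t, ball p0 d p -> a <= t <= b -> P p t.
Proof.
  intros H.
  assert (H' : forall t, exists d : posreal, a <= t <= b -> forall p t', ball p0 d p -> Rabs (t' - t) < d -> P p t').
  { intros t. destruct (excluded_middle_informative (a <= t <= b)) as [I|I].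
    - destruct (H t I) as [d Hd]. now exists d.
    - exists (mkposreal 1 Rlt_0_1). tauto. }
  set (del := fun t => proj1_sig (constructive_indefinite_description _ (H' t))).
  assert (Hdel : forall t, a <= t <= b -> forall p t', ball p0 (del t) p -> Rabs (t' - t) < del t -> P p t').
  { intros t. apply (proj2_sig (constructive_indefinite_description _ (H' t))). }
  destruct (compactness_value_1d a b del) as [d Hd].
  exists d. intros p t Hp Ht. apply NNPP. intros HN. apply (Hd t Ht). intros [t' [It' [H1 H2]]].
  apply HN. apply (Hdel t'); try easy. now apply ball_le with d.
Qed.

Lemma deriv_RInt (W : R * R -> Prop) (g dg : R -> R -> R) z0 :
  open W -> (forall t, 0 <= t <= 1 -> W (z0, t)) ->
  (forall z t, W (z, t) -> is_derive (fun z => g z t) z (dg z t) /\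
      continuous (fun u : R * R => g (fst u) (snd u)) (z, t) /\
      continuous (fun u : R * R => dg (fst u) (snd u)) (z, t)) ->
  is_derive (fun z => RInt (g z) 0 1) z0 (RInt (dg z0) 0 1).
Proof.
  intros HW H0 H.
  destruct (tube (fun z t => W (z, t)) z0 0 1) as [d Hd].
  { intros t Ht. destruct (HW _ (H0 t Ht)) as [d Hd]. exists d. intros p t' B1 B2. apply Hd. now split. }
  replace (RInt (dg z0) 0 1) with (RInt (fun t => Derive (fun u => g u t) z0) 0 1).
  2:{ apply RInt_ext. intros t Ht. rewrite Rmin_left, Rmax_right in Ht by lra.
      apply is_derive_unique. apply H. apply H0. lra. }
  apply is_derive_RInt_param with (f := g).
  - exists d. intros z Hz t Ht. rewrite Rmin_left, Rmax_right in Ht by lra.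
    exists (dg z t). now apply H, Hd.
  - intros t Ht. rewrite Rmin_left, Rmax_right in Ht by lra.
    apply continuity_2d_pt_ext_loc with dg.
    + apply locally_2d_locally. generalize (HW _ (H0 t Ht)). apply filter_imp. intros [u v] K. symmetry.
      apply is_derive_unique. now apply H.
    + apply continuity_2d_pt_filterlim. apply H. now apply H0.
  - exists d. intros z Hz. apply (ex_RInt_continuous (V := R_CompleteNormedModule)).
    intros t Ht. rewrite Rmin_left, Rmax_right in Ht by lra.
    apply (continuous_comp (fun t => (z, t)) (fun u : R * R => g (fst u) (snd u)) t).
    + apply (continuous_comp_2 (fun _ => z) (fun t => t) (fun a b => (a, b)));
      [apply continuous_const|apply continuous_id|].
      apply continuous_ext with (fun u => u); [now intros []|apply continuous_id].
    + apply H. now apply Hd.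
Qed.

(** Integrals along the segment from y = 0. Differentiating in y brings down a
    factor t, so the whole family indexed by k is needed for it to be closed
    under differentiation. *)
Definition moment (k : nat) (f : R -> R -> R -> R) (a x y : R) : R :=
  RInt (fun t => t ^ k * f a x (t * y)) 0 1.

Definition star (U : R3 -> Prop) : Prop :=
  forall a x y t, U (a, x, y) -> 0 <= t <= 1 -> U (a, x, t * y).

Lemma cont_pow {T : UniformSpace} (f : T -> R) k p : continuous f p -> continuous (fun q => f q ^ k) p.
Proof. intros H. induction k as [|k IH]; simpl; cont_auto. Qed.

Lemma cont_pow_scal k f a x y t : cont3 f a x (t * y) ->
  continuous (fun q : R3 * R => snd q ^ k * f (x1 (fst q)) (x2 (fst q)) (snd q * x3 (fst q))) ((a, x, y), t).
Proof.
  intros H.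
  assert (Cs : continuous (fun q : R3 * R => snd q) ((a, x, y), t)) by apply continuous_snd.
  assert (C3 : continuous (fun q : R3 * R => x3 (fst q)) ((a, x, y), t))
    by (apply (continuous_comp fst (fun p : R3 => x3 p)); [apply continuous_fst|apply continuous_snd]).
  assert (C12 : continuous (fun q : R3 * R => fst (fst q)) ((a, x, y), t))
    by (apply (continuous_comp fst (fun p : R3 => fst p)); apply continuous_fst).
  apply (continuous_mult (K := R_AbsRing)); [now apply cont_pow|].
  apply (continuous_comp (fun q : R3 * R => ((fst (fst q)), snd q * x3 (fst q)) : R3) (fun p : R3 => f (x1 p) (x2 p) (x3 p))); [|exact H].
  apply continuous_pair; cont_auto.
Qed.

Lemma cont_prod {S T : UniformSpace} (h : S * T -> R) (p : S) (t : T) (eps : posreal) :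
  continuous h (p, t) ->
  exists d : posreal, forall p' t', ball p d p' -> ball t d t' -> Rabs (h (p', t') - h (p, t)) < eps.
Proof.
  intros H. destruct (H _ (locally_ball _ eps)) as [d Hd]. exists d. intros p' t' B1 B2.
  apply (Hd (p', t')). now split.
Qed.

Lemma ex_RInt_moment k (U : R3 -> Prop) f a x y :
  star U -> U (a, x, y) -> (forall a x y, U (a, x, y) -> cont3 f a x y) ->
  ex_RInt (fun t => t ^ k * f a x (t * y)) 0 1.
Proof.
  intros HS Hp Hf. apply (ex_RInt_continuous (V := R_CompleteNormedModule)).
  intros t Ht. rewrite Rmin_left, Rmax_right in Ht by lra.
  assert (C := cont_pow_scal k f a x y t (Hf _ _ _ (HS _ _ _ _ Hp Ht))).
  intros P [e He]. destruct (cont_prod _ _ _ e C) as [d Hd]. exists d. intros t' Ht'.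
  apply He. apply (Hd (a, x, y) t'); [apply ball_center|exact Ht'].
Qed.

(** Near a given point the integrands are uniformly close to each other, by
    [tube]; the tube also keeps the nearby segments inside U. *)
Lemma moment_cont k (U : R3 -> Prop) f a x y :
  open U -> star U -> (forall a x y, U (a, x, y) -> cont3 f a x y) -> U (a, x, y) ->
  cont3 (moment k f) a x y.
Proof.
  intros HU HS Hf Hp P [e He].
  set (h := fun q : R3 * R => snd q ^ k * f (x1 (fst q)) (x2 (fst q)) (snd q * x3 (fst q))).
  assert (e2 : 0 < e / 2) by (destruct e; simpl; lra).
  destruct (tube (T := R3U)
     (fun p t => U p /\ Rabs (h (p, t) - h ((a, x, y), t)) < e / 2) (a, x, y) 0 1) as [d2 Hd2].
  { intros t Ht.
    assert (e4 : 0 < e / 2 / 2) by lra.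
    assert (C := cont_pow_scal k f a x y t (Hf _ _ _ (HS _ _ _ _ Hp Ht))).
    destruct (cont_prod _ _ _ (mkposreal _ e4) C) as [d Hd].
    destruct (HU _ Hp) as [d' Hd'].
    assert (Hm : 0 < Rmin d d') by (apply Rmin_pos; apply cond_pos).
    exists (mkposreal _ Hm). simpl. intros p t' B1 B2. split.
    - apply Hd'. apply ball_le with (2 := B1). apply Rmin_r.
    - assert (B1' : ball (a, x, y) d p) by (apply ball_le with (2 := B1); apply Rmin_l).
      assert (B2' : ball t d t') by (apply Rlt_le_trans with (1 := B2); apply Rmin_l).
      assert (K1 := Hd p t' B1' B2').
      assert (K2 := Hd (a, x, y) t' (ball_center _ _) B2'). simpl in K1, K2.
      fold (h (p, t')) in K1. replace (h (p, t') - h ((a, x, y), t')) with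
        ((h (p, t') - t ^ k * f a x (t * y)) - (h ((a, x, y), t') - t ^ k * f a x (t * y))) by ring.
      apply Rle_lt_trans with (1 := Rabs_triang _ _). rewrite Rabs_Ropp. unfold h, x1, x2, x3 in *. simpl in *. lra. }
  exists d2. intros [[a' x'] y'] B. apply He.
  assert (Up : U (a', x', y')) by (apply (Hd2 (a', x', y') 0 B); lra).
  unfold ball; simpl; unfold AbsRing_ball, abs, minus, plus, opp; simpl.
  unfold moment, x1, x2, x3; simpl.
  assert (I1 := ex_RInt_moment k U f _ _ _ HS Up Hf).
  assert (I2 := ex_RInt_moment k U f _ _ _ HS Hp Hf).
  assert (Hle : Rabs (RInt (fun t => t ^ k * f a' x' (t * y') - t ^ k * f a x (t * y)) 0 1) <= (1 - 0) * (e / 2)).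
  { apply abs_RInt_le_const; [lra| |].
    - apply (ex_RInt_minus (V := R_NormedModule)); assumption.
    - intros t Ht. apply Rlt_le. apply (Hd2 (a', x', y') t B Ht). }
  rewrite (RInt_minus (V := R_CompleteNormedModule)) in Hle by assumption.
  unfold minus, plus, opp in Hle; simpl in Hle. lra.
Qed.

Lemma cont3_comp_2d f (A B C : R * R -> R) u :
  continuous A u -> continuous B u -> continuous C u -> cont3 f (A u) (B u) (C u) ->
  continuous (fun u => f (A u) (B u) (C u)) u.
Proof.
  intros HA HB HC H.
  apply (continuous_comp (fun u => (A u, B u, C u) : R3) (fun p : R3 => f (x1 p) (x2 p) (x3 p))); [|exact H].
  now repeat apply continuous_pair.
Qed.

Lemma open_pre (U : R3 -> Prop) (A B C : R * R -> R) :
  open U -> (forall u, continuous A u) -> (forall u, continuous B u) -> (forall u, continuous C u) ->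
  open (fun u => U (A u, B u, C u)).
Proof.
  intros HU HA HB HC. apply (open_comp (fun u => (A u, B u, C u) : R3) U); [|exact HU].
  intros u _. apply (continuous_pair (fun u => (A u, B u)) C); [apply (continuous_pair A B)|]; auto.
Qed.

Lemma moment_deriv k (U : R3 -> Prop) f fx fy :
  open U -> star U -> (forall a x y, U (a, x, y) -> cont3 f a x y) ->
  (forall a x y, U (a, x, y) -> cont3 fx a x y) -> (forall a x y, U (a, x, y) -> cont3 fy a x y) ->
  partials U f fx fy ->
  partials U (moment k f) (moment k fx) (moment (S k) fy).
Proof.
  intros HU HS Hf Hfx Hfy Hd a x y Hp. split.
  - apply (deriv_RInt (fun u => U (a, fst u, snd u * y)) (fun x t => t ^ k * f a x (t * y))
       (fun x t => t ^ k * fx a x (t * y))).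
    + apply (open_pre U (fun _ => a) fst (fun u => snd u * y)); [easy|..]; intros; cont_auto.
    + intros t Ht. simpl. now apply HS.
    + simpl. intros z t K. split; [apply (is_derive_scal (fun z => f a z (t * y))); now apply Hd|].
      split; apply (continuous_mult (K := R_AbsRing)); try (apply cont_pow, cont_snd).
      * apply (cont3_comp_2d f (fun _ => a) fst (fun u => snd u * y)); cont_auto. now apply Hf.
      * apply (cont3_comp_2d fx (fun _ => a) fst (fun u => snd u * y)); cont_auto. now apply Hfx.
  - apply (deriv_RInt (fun u => U (a, x, snd u * fst u)) (fun y t => t ^ k * f a x (t * y))
       (fun y t => t ^ (S k) * fy a x (t * y))).
    + apply (open_pre U (fun _ => a) (fun _ => x) (fun u => snd u * fst u)); [easy|..]; intros; cont_auto.
    + intros t Ht. simpl. now apply HS.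
    + simpl. intros z t K. split; [|split].
      * replace (t * t ^ k * fy a x (t * z)) with (t ^ k * (t * fy a x (t * z))) by ring.
        apply (is_derive_scal (fun z => f a x (t * z))).
        apply (is_derive_comp (f a x) (fun z => t * z)); [now apply Hd|].
        auto_derive; [easy|ring].
      * apply (continuous_mult (K := R_AbsRing)); [apply cont_pow, cont_snd|].
        apply (cont3_comp_2d f (fun _ => a) (fun _ => x) (fun u => snd u * fst u)); cont_auto. now apply Hf.
      * apply (continuous_mult (K := R_AbsRing)); [apply (cont_pow snd (S k)), cont_snd|].
        apply (cont3_comp_2d fy (fun _ => a) (fun _ => x) (fun u => snd u * fst u)); cont_auto. now apply Hfy.
Qed.

(** Induction on n for all k at once: [moment_deriv] expresses the partial
    derivatives of a moment as moments of the partial derivatives. *)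
Lemma Ck_moment n k (U : R3 -> Prop) f : open U -> star U -> Ck n U f -> Ck n U (moment k f).
Proof.
  intros HU HS. revert k f. induction n as [|n IH]; intros k f [Hf H].
  - split; [|easy]. intros a x y Hp. now apply moment_cont with U.
  - split; [intros a x y Hp; now apply moment_cont with U|].
    destruct H as [fx [fy [Hd [Hx Hy]]]].
    exists (moment k fx), (moment (S k) fy). split; [|split; now apply IH].
    apply moment_deriv; try easy; intros; now apply (Ck_cont n U).
Qed.

(** * Partial derivatives and compactness *)

Lemma Ck_derive_x n (U : R3 -> Prop) f : open U -> Ck (S n) U f ->
  Ck n U (fun a x y => Derive (fun t => f a t y) x).
Proof.
  intros HU H. apply Ck_deriv_x with f; try easy.
  destruct H as [_ [fx [fy [Hd _]]]]. intros a x y Hp. apply Derive_correct. exists (fx a x y). now apply Hd.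
Qed.

Lemma Ck_derive_y n (U : R3 -> Prop) f : open U -> Ck (S n) U f ->
  Ck n U (fun a x y => Derive (fun t => f a x t) y).
Proof.
  intros HU H. apply Ck_deriv_y with f; try easy.
  destruct H as [_ [fx [fy [Hd _]]]]. intros a x y Hp. apply Derive_correct. exists (fy a x y). now apply Hd.
Qed.

Lemma Ck_ex_diff_n n (U : R3 -> Prop) f a x y : open U -> Ck n U f -> U (a, x, y) -> ex_diff_n (f a) n x y.
Proof.
  intros HU. revert f. induction n as [|n IH]; intros f H Hp.
  - split; [|easy]. apply continuity_2d_pt_filterlim. apply cont3_slice. now apply H.
  - split; [|split; [|split; [|split]]].
    + apply continuity_2d_pt_filterlim. apply cont3_slice. now apply H.
    + destruct H as [_ [fx [fy [Hd _]]]]. exists (fx a x y). now apply Hd.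
    + destruct H as [_ [fx [fy [Hd _]]]]. exists (fy a x y). now apply Hd.
    + apply (IH (fun a x y => Derive (fun t => f a t y) x)); [|easy]. now apply Ck_derive_x.
    + apply (IH (fun a x y => Derive (fun t => f a x t) y)); [|easy]. now apply Ck_derive_y.
Qed.

(** The derivatives required by C^2 convergence are iterated [Derive]s; they
    stay continuous in the parameter. *)
Lemma smooth3_partial (U : R3 -> Prop) f m k : open U -> smooth3 U f ->
  smooth3 U (fun a x y => partial_derive m k (f a) x y).
Proof.
  intros HU Hf. unfold partial_derive.
  assert (Hk : smooth3 U (fun a x y => Derive_n (fun t => f a x t) k y)).
  { induction k as [|k IH]; [exact Hf|]. intros n. simpl.
    apply (Ck_derive_y n U (fun a x y => Derive_n (fun t => f a x t) k y)); [easy|apply IH]. }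
  set (g := fun a x y => Derive_n (fun t => f a x t) k y) in Hk.
  change (smooth3 U (fun a x y => Derive_n (fun t => g a t y) m x)). clearbody g.
  induction m as [|m IH]; [exact Hk|]. intros n. simpl.
  apply (Ck_derive_x n U (fun a x y => Derive_n (fun t => g a t y) m x)); [easy|apply IH].
Qed.

(** Heine-Borel through Cousin's lemma: the gauge at a point of C is adapted to
    a member of the cover, and at a point outside C it avoids C. Of the finitely
    many tags those outside C are then useless, and the others give the
    subcover. *)
Lemma compact_closed_bounded (C : R * R -> Prop) M :
  (forall z, C z -> - M <= fst z <= M /\ - M <= snd z <= M) ->
  open (fun z => ~ C z) -> compact_set C.
Proof.
  intros HB HC cover Hop Hcov.
  assert (H : forall z : R * R, exists (d : posreal) (V : R * R -> Prop),
     (C z -> cover V /\ forall z', ball z d z' -> V z') /\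
     (~ C z -> forall z', ball z d z' -> ~ C z')).
  { intros z. destruct (excluded_middle_informative (C z)) as [I|I].
    - destruct (Hcov z I) as [V [HV Vz]]. destruct (Hop V HV z Vz) as [d Hd]. exists d, V. split; [|tauto]. now split.
    - destruct (HC z I) as [d Hd]. exists d, (fun _ => True). split; [tauto|]. intros _. exact Hd. }
  set (del := fun z => proj1_sig (constructive_indefinite_description _ (H z))).
  assert (H1 : forall z, exists V : R * R -> Prop,
     (C z -> cover V /\ forall z', ball z (del z) z' -> V z') /\
     (~ C z -> forall z', ball z (del z) z' -> ~ C z')).
  { intros z. apply (proj2_sig (constructive_indefinite_description _ (H z))). }
  set (VV := fun z => proj1_sig (constructive_indefinite_description _ (H1 z))).
  assert (H2 : forall z,
     (C z -> cover (VV z) /\ forall z', ball z (del z) z' -> VV z z') /\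
     (~ C z -> forall z', ball z (del z) z' -> ~ C z')).
  { intros z. apply (proj2_sig (constructive_indefinite_description _ (H1 z))). }
  clearbody VV del. clear H H1.
  apply NNPP. intros HN.
  apply (compactness_list 2 (-M, (-M, tt)) (M, (M, tt)) (fun t => del (fst t, fst (snd t)))).
  intros [l Hl]. apply HN.
  set (pr := fun t : Compactness.Tn 2 R => (fst t, fst (snd t))).
  set (inC := fun t => if excluded_middle_informative (C (pr t)) then true else false).
  exists (map (fun t => VV (pr t)) (filter inC l)). split.
  - intros V HV. apply in_map_iff in HV. destruct HV as [t [<- Ht]]. apply filter_In in Ht.
    destruct Ht as [_ Ht]. unfold inC in Ht. destruct (excluded_middle_informative (C (pr t))); [|easy].
    now apply H2.
  - intros [x y] Hp. destruct (HB _ Hp) as [B1 B2]. simpl in B1, B2.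
    destruct (Hl (x, (y, tt))) as [[t1 [t2 []]] [Hin [_ [K1 [K2 _]]]]]; [now simpl|].
    simpl in K1, K2.
    assert (Bt : ball (t1, t2) (del (t1, t2)) (x, y)).
    { split; simpl; unfold ball; simpl; unfold AbsRing_ball, abs, minus, plus, opp; simpl; assumption. }
    assert (Ct : C (t1, t2)).
    { apply NNPP. intros NC. apply (proj2 (H2 _) NC _ Bt Hp). }
    exists (VV (t1, t2)). split; [|now apply H2].
    apply in_map_iff. exists (t1, (t2, tt)). split; [easy|]. apply filter_In. split; [easy|].
    unfold inC. destruct (excluded_middle_informative (C (pr (t1, (t2, tt))))); [easy|]. now elim n.
Qed.

Lemma cont3_eps f a x y : cont3 f a x y -> forall eps : posreal, exists d : posreal,
  forall a' x' y', Rabs (a' - a) < d -> Rabs (x' - x) < d -> Rabs (y' - y) < d -> Rabs (f a' x' y' - f a x y) < eps.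
Proof.
  intros H eps. destruct (H _ (locally_ball _ eps)) as [d Hd]. exists d. intros a' x' y' Ha Hx Hy.
  apply (Hd (a', x', y')). split; [split|]; assumption.
Qed.

(** Continuity at the points of {0} x C is uniform by compactness of C. *)
Lemma uniform_limit_on_compact (U : R3 -> Prop) g (C : R * R -> Prop) :
  compact_set C -> (forall a x y, U (a, x, y) -> cont3 g a x y) ->
  (forall x y, C (x, y) -> U (0, x, y)) ->
  forall eps : posreal, exists d : posreal, forall a x y, Rabs a < d -> C (x, y) ->
    Rabs (g a x y - g 0 x y) < eps.
Proof.
  intros HC Hg HU eps.
  set (good := fun (V : R * R -> Prop) (d : posreal) => forall a x y, Rabs a < d -> V (x, y) -> Rabs (g a x y - g 0 x y) < eps).
  destruct (HC (fun V => open V /\ exists d : posreal, good V d)) as [l [Hl Hcov]].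
  - tauto.
  - intros [x y] Hp. assert (e2 : 0 < eps / 2) by (destruct eps; simpl; lra).
    destruct (cont3_eps g 0 x y (Hg _ _ _ (HU _ _ Hp)) (mkposreal _ e2)) as [d Hd]. simpl in Hd.
    exists (fun z => Rabs (fst z - x) < d /\ Rabs (snd z - y) < d). split; [split|].
    + open_auto.
    + exists d. intros a u v Ha [Hu Hv]. simpl in Hu, Hv.
      replace (g a u v - g 0 u v) with ((g a u v - g 0 x y) - (g 0 u v - g 0 x y)) by ring.
      apply Rle_lt_trans with (1 := Rabs_triang _ _). rewrite Rabs_Ropp.
      assert (K1 := Hd a u v). assert (K2 := Hd 0 u v). rewrite Rminus_0_r in K1. rewrite Rminus_diag, Rabs_R0 in K2.
      assert (0 < d) by apply cond_pos.
      specialize (K1 Ha Hu Hv). specialize (K2 H Hu Hv). lra.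
    + simpl. rewrite !Rminus_diag, Rabs_R0. split; apply cond_pos.
  - assert (exists d : posreal, forall V, In V l -> good V d) as [d Hd].
    { clear Hcov. induction l as [|V l IH].
      - exists (mkposreal 1 Rlt_0_1). easy.
      - destruct IH as [d Hd]; [intros; apply Hl; now right|].
        destruct (Hl V (or_introl eq_refl)) as [_ [d' Hd']].
        assert (Hm : 0 < Rmin d d') by (apply Rmin_pos; apply cond_pos).
        exists (mkposreal _ Hm). simpl. intros W [<-|HW].
        + intros a x y Ha. apply Hd'. apply Rlt_le_trans with (1 := Ha). apply Rmin_r.
        + intros a x y Ha. apply (Hd W HW). apply Rlt_le_trans with (1 := Ha). apply Rmin_l. }
    exists d. intros a x y Ha Hp. destruct (Hcov _ Hp) as [V [HV Vp]]. now apply (Hd V HV).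
Qed.

(** * Inverse functions along fibres *)

Lemma is_derive_eps (f : R -> R) x l :
  is_derive f x l <-> forall eps : posreal, locally x (fun y => Rabs (f y - f x - l * (y - x)) <= eps * Rabs (y - x)).
Proof.
  split.
  - intros [_ H] eps. specialize (H x (fun P HP => HP) eps). revert H. apply filter_imp. intros y.
    unfold minus, plus, opp, scal, norm; simpl; unfold mult, abs; simpl.
    intros H. replace (f y - f x - l * (y - x)) with (f y + - f x + - ((y + - x) * l)) by ring. exact H.
  - intros H. split; [apply is_linear_scal_l|]. intros x0 Hx0 eps.
    assert (x = x0) as <- by exact (is_filter_lim_locally_unique _ _ Hx0).
    generalize (H eps). apply filter_imp. intros y.
    unfold minus, plus, opp, scal, norm; simpl; unfold mult, abs; simpl.
    intros K. replace (f y + - f x + - ((y + - x) * l)) with (f y - f x - l * (y - x)) by ring. exact K.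
Qed.

(** The derivative of an implicitly defined function along a curve: if g (al s,
    et s) = be s near t, then et is differentiable at t. The parameters al and
    be serve to obtain both partial derivatives of an inverse function from one
    statement, with (al, be) = (s, const) and (const, s). *)
Lemma implicit_curve (g : R -> R -> R) (al be et : R -> R) t l1 l2 da db :
  differentiable_pt_lim g (al t) (et t) l1 l2 -> 0 < l2 ->
  is_derive al t da -> is_derive be t db -> continuous et t ->
  locally t (fun s => g (al s) (et s) = be s) ->
  is_derive et t ((db - l1 * da) / l2).
Proof.
  intros Hg Hl Ha Hb He Hloc. apply is_derive_eps. intros eta.
  set (D := (db - l1 * da) / l2). set (M := Rabs da + 2 + Rabs D + Rabs l1).
  assert (HM : 0 < M) by (unfold M; generalize (Rabs_pos da) (Rabs_pos D) (Rabs_pos l1); lra).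
  (* the error ep absorbs its own contribution (ep <= l2 / 2) and leaves at most
     eta *)
  set (ep := Rmin (l2 / 2) (Rmin 1 (eta * l2 / (2 * M)))).
  assert (Hep : 0 < ep).
  { apply Rmin_pos; [lra|]. apply Rmin_pos; [lra|]. apply Rdiv_lt_0_compat; [|lra].
    apply Rmult_lt_0_compat; [apply cond_pos|easy]. }
  assert (Hep1 : ep <= l2 / 2) by apply Rmin_l.
  assert (Hep2 : ep <= 1) by (eapply Rle_trans; [apply Rmin_r|apply Rmin_l]).
  assert (Hep3 : ep * (2 * M) <= eta * l2).
  { replace (eta * l2) with (eta * l2 / (2 * M) * (2 * M)) by (field; lra).
    apply Rmult_le_compat_r; [lra|]. eapply Rle_trans; [apply Rmin_r|apply Rmin_r]. }
  destruct (Hg (mkposreal _ Hep)) as [d Hd]. simpl in Hd.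
  assert (Ca : continuous al t) by (apply @ex_derive_continuous; now exists da).
  assert (Na := Ca _ (locally_ball _ d)). assert (Ne := He _ (locally_ball _ d)).
  assert (La := proj1 (is_derive_eps _ _ _) Ha (mkposreal _ Hep)).
  assert (Lb := proj1 (is_derive_eps _ _ _) Hb (mkposreal _ Hep)).
  assert (E0 := locally_singleton _ _ Hloc). simpl in E0.
  unfold filtermap in *.
  generalize (filter_and (F := locally t) _ _ Na (filter_and (F := locally t) _ _ Ne (filter_and (F := locally t) _ _ La (filter_and (F := locally t) _ _ Lb Hloc)))).
  apply filter_imp. intros s [K1 [K2 [K3 [K4 K5]]]]. simpl in K3, K4.
  specialize (Hd _ _ K1 K2). rewrite K5, E0 in Hd.
  set (h := s - t) in *. set (k := et s - et t) in *. set (A := al s - al t) in *. set (Bb := be s - be t) in *.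
  assert (Hmax : Rmax (Rabs A) (Rabs k) <= Rabs A + Rabs k).
  { apply Rmax_lub; generalize (Rabs_pos A) (Rabs_pos k); lra. }
  assert (HA : Rabs A <= (Rabs da + ep) * Rabs h).
  { replace A with ((A - da * h) + da * h) by ring. eapply Rle_trans; [apply Rabs_triang|]. rewrite Rabs_mult. lra. }
  assert (Hk : Rabs k <= Rabs (k - D * h) + Rabs D * Rabs h).
  { rewrite <- Rabs_mult. replace k with ((k - D * h) + D * h) at 1 by ring. apply Rabs_triang. }
  assert (HDh : l2 * (k - D * h) = - (Bb - (l1 * A + l2 * k)) + (Bb - db * h) - l1 * (A - da * h)).
  { unfold D. field. lra. }
  assert (Hfin : l2 * Rabs (k - D * h) <= ep * (Rabs A + Rabs k) + ep * Rabs h + Rabs l1 * (ep * Rabs h)).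
  { replace (l2 * Rabs (k - D * h)) with (Rabs (l2 * (k - D * h))) by (rewrite Rabs_mult, (Rabs_pos_eq l2); lra).
    rewrite HDh. unfold Rminus at 1. eapply Rle_trans; [apply Rabs_triang|]. rewrite Rabs_Ropp, Rabs_mult.
    apply Rplus_le_compat.
    - eapply Rle_trans; [apply Rabs_triang|]. rewrite Rabs_Ropp. apply Rplus_le_compat; [|exact K4].
      apply Rle_trans with (1 := Hd). apply Rmult_le_compat_l; lra.
    - apply Rmult_le_compat_l; [apply Rabs_pos|exact K3]. }
  assert (Hh := Rabs_pos h). assert (Hz := Rabs_pos (k - D * h)).
  assert (F1 : (l2 / 2) * Rabs (k - D * h) <= ep * M * Rabs h).
  { assert (ep * Rabs (k - D * h) <= l2 / 2 * Rabs (k - D * h)) by (apply Rmult_le_compat_r; lra).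
    assert (ep * Rabs A <= ep * ((Rabs da + ep) * Rabs h)) by (apply Rmult_le_compat_l; lra).
    assert (ep * Rabs k <= ep * (Rabs (k - D * h) + Rabs D * Rabs h)) by (apply Rmult_le_compat_l; lra).
    assert (ep * (ep * Rabs h) <= ep * (1 * Rabs h)) by (apply Rmult_le_compat_l; [lra|apply Rmult_le_compat_r; lra]).
    unfold M. lra. }
  assert (F2 : ep * (2 * M) * Rabs h <= eta * l2 * Rabs h) by (apply Rmult_le_compat_r; lra).
  apply Rmult_le_reg_l with l2; lra.
Qed.

Definition fibre_convex (U : R3 -> Prop) : Prop :=
  forall a x y y1 y2, U (a, x, y1) -> U (a, x, y2) -> y1 <= y <= y2 -> U (a, x, y).

(** S is strictly increasing on each fibre, with positive derivative: the
    situation in which the equation S (a, x, y) = s can be solved globally for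
    y. *)
Definition fibre_slope (U : R3 -> Prop) (S Sy : R -> R -> R -> R) : Prop :=
  forall a x y, U (a, x, y) -> is_derive (fun t => S a x t) y (Sy a x y) /\ 0 < Sy a x y.

Lemma fibre_increasing (U : R3 -> Prop) (S Sy : R -> R -> R -> R) a x y1 y2 :
  fibre_convex U ->
  fibre_slope U S Sy ->
  U (a, x, y1) -> U (a, x, y2) -> y1 < y2 -> S a x y1 < S a x y2.
Proof.
  intros HF HS H1 H2 Hlt.
  destruct (MVT_gen (S a x) y1 y2 (Sy a x)) as [c [Hc E]].
  - intros c Hc. rewrite Rmin_left, Rmax_right in Hc by lra. apply HS. apply HF with y1 y2; try easy; lra.
  - intros c Hc. rewrite Rmin_left, Rmax_right in Hc by lra.
    apply continuity_pt_filterlim. apply @ex_derive_continuous. exists (Sy a x c). apply HS. now apply HF with y1 y2.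
  - rewrite Rmin_left, Rmax_right in Hc by lra.
    assert (0 < Sy a x c) by (apply HS; now apply HF with y1 y2). nra.
Qed.

Lemma fibre_injective (U : R3 -> Prop) (S Sy : R -> R -> R -> R) a x y1 y2 :
  fibre_convex U ->
  fibre_slope U S Sy ->
  U (a, x, y1) -> U (a, x, y2) -> S a x y1 = S a x y2 -> y1 = y2.
Proof.
  intros HF HS H1 H2 E. destruct (Rtotal_order y1 y2) as [H|[H|H]]; [|easy|].
  - generalize (fibre_increasing U S Sy a x y1 y2 HF HS H1 H2 H). lra.
  - generalize (fibre_increasing U S Sy a x y2 y1 HF HS H2 H1 H). lra.
Qed.

Definition fibre_range (U : R3 -> Prop) (S : R -> R -> R -> R) : R3 -> Prop :=
  fun p => exists y, U (x1 p, x2 p, y) /\ S (x1 p) (x2 p) y = x3 p.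

Lemma IVT_derive (f df : R -> R) a b y :
  (forall t, a <= t <= b -> is_derive f t (df t)) -> a < b -> f a < y < f b ->
  exists t, a < t < b /\ f t = y.
Proof.
  intros Hd Hab Hy.
  destruct (Ranalysis5.IVT_interv (fun t => f t - y) a b) as [z [Hz E]]; try lra.
  - intros t Ht. apply continuity_pt_filterlim.
    apply (continuous_minus (V := R_NormedModule) f (fun _ => y)); [|apply continuous_const].
    apply (ex_derive_continuous f). exists (df t). now apply Hd.
  - exists z. split; [|lra].
    assert (z <> a) by (intros ->; lra). assert (z <> b) by (intros ->; lra). lra.
Qed.

(** Openness of the range and continuity of the inverse at once: by monotonicity
    S (a, x, .) takes values on both sides of s near y, this persists for nearby
    (a, x, s), and the intermediate value theorem applies on the fibre. *)
Lemma fibre_solve_near (U : R3 -> Prop) (S Sy : R -> R -> R -> R) a x y (eps : posreal) :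
  open U -> fibre_convex U -> (forall a x y, U (a, x, y) -> cont3 S a x y) ->
  fibre_slope U S Sy ->
  U (a, x, y) ->
  locally ((a, x, S a x y) : R3) (fun p => exists y', U (x1 p, x2 p, y') /\ S (x1 p) (x2 p) y' = x3 p /\ Rabs (y' - y) < eps).
Proof.
  intros HU HF Hc HS Hp.
  destruct (HU _ Hp) as [d0 Hd0].
  set (e := Rmin (d0 / 2) (eps / 2)).
  assert (P0 := cond_pos d0). assert (P1 := cond_pos eps).
  assert (He : 0 < e) by (apply Rmin_pos; lra).
  assert (He1 : e <= d0 / 2) by apply Rmin_l. assert (He2 : e <= eps / 2) by apply Rmin_r.
  assert (Ulow : U (a, x, y - e)).
  { apply Hd0. split; [split; apply ball_center|]. change (Rabs (y - e - y) < d0). rewrite Rabs_left; lra. }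
  assert (Up : U (a, x, y + e)).
  { apply Hd0. split; [split; apply ball_center|]. change (Rabs (y + e - y) < d0). rewrite Rabs_right; lra. }
  assert (L1 : S a x (y - e) < S a x y) by (apply (fibre_increasing U S Sy); try easy; lra).
  assert (L2 : S a x y < S a x (y + e)) by (apply (fibre_increasing U S Sy); try easy; lra).
  assert (Q1 : 0 < (S a x y - S a x (y - e)) / 2) by lra.
  assert (Q2 : 0 < (S a x (y + e) - S a x y) / 2) by lra.
  destruct (cont3_eps S a x (y - e) (Hc _ _ _ Ulow) (mkposreal _ Q1)) as [d1 Hd1].
  destruct (cont3_eps S a x (y + e) (Hc _ _ _ Up) (mkposreal _ Q2)) as [d2 Hd2]. simpl in Hd1, Hd2.
  (* within d the fibre stays in U, and the values at y - e and y + e stay on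
     their sides of s' *)
  set (d := Rmin (Rmin (d0 / 2) (Rmin d1 d2)) (Rmin ((S a x y - S a x (y - e)) / 2) ((S a x (y + e) - S a x y) / 2))).
  assert (Hd : 0 < d).
  { repeat apply Rmin_pos; try lra; apply cond_pos. }
  assert (M0 : d <= d0 / 2) by (eapply Rle_trans; [apply Rmin_l|apply Rmin_l]).
  assert (M12 : d <= Rmin d1 d2) by (eapply Rle_trans; [apply Rmin_l|apply Rmin_r]).
  assert (M1 : d <= d1) by (eapply Rle_trans; [exact M12|apply Rmin_l]).
  assert (M2 : d <= d2) by (eapply Rle_trans; [exact M12|apply Rmin_r]).
  assert (M34 : d <= Rmin ((S a x y - S a x (y - e)) / 2) ((S a x (y + e) - S a x y) / 2)) by apply Rmin_r.
  assert (M3 : d <= (S a x y - S a x (y - e)) / 2) by (eapply Rle_trans; [exact M34|apply Rmin_l]).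
  assert (M4 : d <= (S a x (y + e) - S a x y) / 2) by (eapply Rle_trans; [exact M34|apply Rmin_r]).
  exists (mkposreal _ Hd). intros [[a' x'] s'] [[Ba Bx] Bs].
  change (Rabs (a' - a) < d) in Ba. change (Rabs (x' - x) < d) in Bx. change (Rabs (s' - S a x y) < d) in Bs.
  unfold x1, x2, x3; simpl.
  assert (V : forall t, y - e <= t <= y + e -> U (a', x', t)).
  { intros t Ht. apply Hd0. split; [split|].
    - change (Rabs (a' - a) < d0). lra. - change (Rabs (x' - x) < d0). lra.
    - change (Rabs (t - y) < d0). apply Rle_lt_trans with e; [apply Rabs_le; lra|lra]. }
  assert (G1 : Rabs (S a' x' (y - e) - S a x (y - e)) < (S a x y - S a x (y - e)) / 2).
  { apply Hd1; try lra. rewrite Rminus_diag, Rabs_R0; apply cond_pos. }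
  assert (G2 : Rabs (S a' x' (y + e) - S a x (y + e)) < (S a x (y + e) - S a x y) / 2).
  { apply Hd2; try lra. rewrite Rminus_diag, Rabs_R0; apply cond_pos. }
  apply Rabs_def2 in G1. apply Rabs_def2 in G2. apply Rabs_def2 in Bs.
  destruct (IVT_derive (S a' x') (Sy a' x') (y - e) (y + e) s') as [z [Hz E]]; [|lra|lra|].
  - intros t Ht. apply HS, V, Ht.
  - exists z. split; [apply V; lra|]. split; [easy|]. apply Rle_lt_trans with e; [apply Rabs_le; lra|lra].
Qed.

Lemma open_fibre_range (U : R3 -> Prop) (S Sy : R -> R -> R -> R) :
  open U -> fibre_convex U -> (forall a x y, U (a, x, y) -> cont3 S a x y) ->
  fibre_slope U S Sy ->
  open (fibre_range U S).
Proof.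
  intros HU HF Hc HS [[a x] s] [y [Hy E]]. unfold x1, x2, x3 in *; simpl in *. subst s.
  generalize (fibre_solve_near U S Sy a x y (mkposreal 1 Rlt_0_1) HU HF Hc HS Hy). apply filter_imp.
  intros p [y' [H1 [H2 _]]]. now exists y'.
Qed.

(** The inverse Y of an increasing S is smooth by bootstrapping: its derivatives
    are - S_x / S_y and 1 / S_y at (a, x, Y), so they are C^n as soon as Y is. *)
Lemma smooth3_inverse (U : R3 -> Prop) (S Sy Y : R -> R -> R -> R) :
  open U -> fibre_convex U -> smooth3 U S ->
  fibre_slope U S Sy ->
  (forall a x s, fibre_range U S (a, x, s) -> U (a, x, Y a x s) /\ S a x (Y a x s) = s) ->
  smooth3 (fibre_range U S) Y.
Proof.
  intros HU HF Hsm HS HY.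
  assert (Hc : forall a x y, U (a, x, y) -> cont3 S a x y) by (intros; now apply (Ck_cont 0 U)).
  assert (HB := open_fibre_range U S Sy HU HF Hc HS).
  assert (Hcont : forall a x s, fibre_range U S (a, x, s) -> cont3 Y a x s).
  { intros a x s Hs P [eps Heps]. destruct (HY _ _ _ Hs) as [H1 H2].
    generalize (fibre_solve_near U S Sy a x (Y a x s) eps HU HF Hc HS H1). rewrite H2. unfold filtermap. apply filter_imp.
    intros [[a' x'] s'] [y' [K1 [K2 K3]]]. unfold x1, x2, x3 in *; simpl in *. apply Heps.
    destruct (HY a' x' s') as [J1 J2]; [now exists y'|].
    replace (Y a' x' s') with y'; [exact K3|]. apply (fibre_injective U S Sy a' x'); try easy. congruence. }
  assert (Hsm1 := Hsm 1%nat). destruct Hsm1 as [_ [Sx [Sy' [HSd [HSx _]]]]].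
  assert (Hd : partials U S Sx Sy).
  { intros a x y Hp. split; [now apply HSd|now apply HS]. }
  assert (Sx_n : forall n, Ck n U Sx). { intros n. apply Ck_deriv_x with S; try easy. intros; now apply Hd. }
  assert (Sy_n : forall n, Ck n U Sy). { intros n. apply Ck_deriv_y with S; try easy. intros; now apply Hd. }
  intros n. induction n as [|n IH]; (split; [exact Hcont|]); [easy|].
  exists (fun a x s => (0 - Sx a x (Y a x s) * 1) / Sy a x (Y a x s)), (fun a x s => (1 - Sx a x (Y a x s) * 0) / Sy a x (Y a x s)).
  split.
  - intros a x s Hs. destruct (HY _ _ _ Hs) as [H1 H2].
    assert (Hdiff := Ck_differentiable 0 U S Sx Sy a x (Y a x s) HU H1 Hd HSx).
    assert (Cs := cont3_slice Y a x s (Hcont _ _ _ Hs)).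
    split.
    + apply (implicit_curve (S a) (fun t => t) (fun _ => s) (fun t => Y a t s)); try easy.
      * now apply HS. * apply @is_derive_id. * apply @is_derive_const.
      * apply (continuous_comp (fun t => (t, s)) (fun u : R * R => Y a (fst u) (snd u))); [cont_auto|exact Cs].
      * generalize (open_slice_x _ a x s HB Hs). apply filter_imp. intros t Ht. now apply HY.
    + apply (implicit_curve (S a) (fun _ => x) (fun t => t) (fun t => Y a x t)); try easy.
      * now apply HS. * apply @is_derive_const. * apply @is_derive_id.
      * apply (continuous_comp (fun t => (x, t)) (fun u : R * R => Y a (fst u) (snd u))); [cont_auto|exact Cs].
      * generalize (open_slice_y _ a x s HB Hs). apply filter_imp. intros t Ht. now apply HY.
  - assert (CSx : Ck n (fibre_range U S) (fun a x s => Sx a x (Y a x s))).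
    { apply (Ck_comp n _ U Sx (fun _ x _ => x) Y); try easy; [apply Ck_x|intros; now apply HY]. }
    assert (CSy : Ck n (fibre_range U S) (fun a x s => Sy a x (Y a x s))).
    { apply (Ck_comp n _ U Sy (fun _ x _ => x) Y); try easy; [apply Ck_x|intros; now apply HY]. }
    assert (NZ : forall a x s, fibre_range U S (a, x, s) -> Sy a x (Y a x s) <> 0).
    { intros a x s Hs. destruct (HY _ _ _ Hs) as [H1 _]. generalize (proj2 (HS _ _ _ H1)). lra. }
    split; (Ck_auto; easy).
Qed.

(** * Primitives along the slices *)

Lemma cont_of_smooth U f a x y : smooth3 U f -> U (a, x, y) -> cont3 f a x y.
Proof. intros H Hp. now apply (Ck_cont 0 U). Qed.

(** The primitive from 0 to y, written as y times a mean over [0, 1]: smoothness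
    follows from that of moments, and dividing by y loses nothing at y = 0. *)
Definition prim (f : R -> R -> R -> R) (a x y : R) : R := y * moment 0 f a x y.

Lemma Ck_prim n U f : open U -> star U -> Ck n U f -> Ck n U (prim f).
Proof. intros HU HS Hf. apply Ck_mult; [apply Ck_y|now apply Ck_moment]. Qed.

Lemma cont3_slice_y f a x y : cont3 f a x y -> continuous (fun t => f a x t) y.
Proof.
  intros H. apply (continuous_comp (fun t => ((a, x), t) : R3) (fun p : R3 => f (x1 p) (x2 p) (x3 p))); [|exact H].
  apply continuous_pair; cont_auto.
Qed.

Lemma star_segment (U : R3 -> Prop) a x y t : star U -> U (a, x, y) ->
  Rmin 0 y <= t <= Rmax 0 y -> U (a, x, t).
Proof.
  intros HS Hp Ht. destruct (Req_dec y 0) as [->|Hy].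
  - rewrite Rmin_left, Rmax_left in Ht by lra. replace t with 0 by lra. exact Hp.
  - replace t with ((t / y) * y) by (field; easy). apply HS; [easy|].
    destruct (Rle_lt_dec 0 y).
    + rewrite Rmin_left, Rmax_right in Ht by lra. split.
      * apply Rdiv_le_0_compat; lra.
      * apply Rle_div_l; lra.
    + rewrite Rmin_right, Rmax_left in Ht by lra.
      replace (t / y) with ((- t) / (- y)) by (field; easy). split.
      * apply Rdiv_le_0_compat; lra.
      * apply Rle_div_l; lra.
Qed.

Lemma ex_RInt_segment (U : R3 -> Prop) f a x y : star U -> U (a, x, y) ->
  (forall a x y, U (a, x, y) -> cont3 f a x y) -> ex_RInt (f a x) 0 y.
Proof.
  intros HS Hp Hf. apply (ex_RInt_continuous (V := R_CompleteNormedModule)). intros t Ht.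
  apply cont3_slice_y, Hf. now apply star_segment with y.
Qed.

Lemma prim_RInt (U : R3 -> Prop) f a x y : star U -> U (a, x, y) ->
  (forall a x y, U (a, x, y) -> cont3 f a x y) -> prim f a x y = RInt (f a x) 0 y.
Proof.
  intros HS Hp Hf. unfold prim, moment.
  assert (E := RInt_comp_lin (f a x) y 0 0 1). rewrite Rmult_0_r, Rmult_1_r, Rplus_0_l, Rplus_0_r in E.
  rewrite <- E.
  - rewrite <- (RInt_scal (V := R_CompleteNormedModule)).
    + apply RInt_ext. intros t _. unfold scal; simpl; unfold mult; simpl. rewrite Rplus_0_r, (Rmult_comm t y). ring.
    + now apply (ex_RInt_moment 0 U).
  - now apply (ex_RInt_segment U).
Qed.

Lemma prim_deriv_y (U : R3 -> Prop) f a x y : open U -> star U -> U (a, x, y) ->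
  (forall a x y, U (a, x, y) -> cont3 f a x y) -> is_derive (fun t => prim f a x t) y (f a x y).
Proof.
  intros HU HS Hp Hf.
  apply is_derive_ext_loc with (fun t => RInt (f a x) 0 t).
  - generalize (open_slice_y U a x y HU Hp). apply filter_imp. intros t Ht. symmetry. now apply (prim_RInt U).
  - apply (is_derive_RInt (V := R_NormedModule) (f a x) _ 0).
    + generalize (open_slice_y U a x y HU Hp). apply filter_imp. intros t Ht.
      apply (RInt_correct (V := R_CompleteNormedModule)). now apply (ex_RInt_segment U).
    + apply cont3_slice_y. now apply Hf.
Qed.

Lemma prim_deriv_x (U : R3 -> Prop) f fx a x y : open U -> star U -> smooth3 U f -> U (a, x, y) ->
  (forall a x y, U (a, x, y) -> is_derive (fun t => f a t y) x (fx a x y)) ->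
  is_derive (fun t => prim f a t y) x (prim fx a x y).
Proof.
  intros HU HS Hf Hp Hd.
  assert (Hfx : Ck 0 U fx) by (apply Ck_deriv_x with f; easy).
  destruct (Hf 1%nat) as [Hc [gx [fy [Hd' [_ Hy]]]]].
  apply (is_derive_scal (fun t => moment 0 f a t y)).
  refine (proj1 (moment_deriv 0 U f fx fy HU HS Hc _ _ _ a x y Hp)).
  - intros; now apply (Ck_cont 0 U).
  - intros; now apply (Ck_cont 0 U).
  - intros; split; [now apply Hd|now apply Hd'].
Qed.

Lemma prim_primitive (U : R3 -> Prop) F f a x y : star U -> U (a, x, y) ->
  (forall a x y, U (a, x, y) -> cont3 f a x y) ->
  (forall a x y, U (a, x, y) -> is_derive (fun t => F a x t) y (f a x y)) ->
  prim f a x y = F a x y - F a x 0.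
Proof.
  intros HS Hp Hf HF. rewrite (prim_RInt U) by easy.
  assert (S : forall t, Rmin 0 y <= t <= Rmax 0 y -> U (a, x, t)).
  { intros t Ht. now apply star_segment with y. }
  apply (is_RInt_unique (V := R_CompleteNormedModule)).
  apply (is_RInt_derive (V := R_CompleteNormedModule) (F a x) (f a x)).
  - intros t Ht. now apply HF, S.
  - intros t Ht. now apply cont3_slice_y, Hf, S.
Qed.

(** * The Weierstrass data *)

(** Large enough for the strip around the axis to reach distance 2 from it; the
    value is far from optimal. *)
Definition kappa : R := 10000.
Definition lam : R := 2 * kappa ^ 2.
Definition msq (a x : R) : R := x * x + a * a.
Definition zden (a x y : R) : R := (msq a x - y * y) * (msq a x - y * y) + (2 * x * y) * (2 * x * y).
(** With [msq] = x^2 + a^2, the complex number z^2 + a^2 is ([msq] - y^2) + 2 i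
    x y, of squared modulus [zden]; so [dh_re] and [dh_im] are the real and
    imaginary parts of h' = lam / (z^2 + a^2). *)
Definition dh_re (a x y : R) : R := lam * (msq a x - y * y) / zden a x y.
Definition dh_im (a x y : R) : R := - (lam * (2 * x * y)) / zden a x y.
(** Together with [ddh_im], the second derivative h'' = - 2 lam z / (z^2 +
    a^2)^2. *)
Definition ddh_re (a x y : R) : R :=
  let P := msq a x - y * y in let T := 2 * x * y in
  - (2 * lam) * (x * (P * P - T * T) + 2 * y * P * T) / (zden a x y * zden a x y).
Definition ddh_im (a x y : R) : R :=
  let P := msq a x - y * y in let T := 2 * x * y in
  - (2 * lam) * (y * (P * P - T * T) - 2 * x * P * T) / (zden a x y * zden a x y).

(** Here Re (z^2 + a^2) > 0, so h' has no pole; the set is star-shaped in y, and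
    it stays open and nonempty for a = 0, x <> 0. *)
Definition sector (p : R3) : Prop := x3 p * x3 p < msq (x1 p) (x2 p).

Lemma lam_pos : 0 < lam.
Proof. unfold lam, kappa. lra. Qed.

Lemma zden_pos a x y : sector (a, x, y) -> 0 < zden a x y.
Proof. unfold sector, zden, x1, x2, x3; simpl. intros H. nra. Qed.

Lemma zden_neq a x y : sector (a, x, y) -> zden a x y <> 0.
Proof. intros H. generalize (zden_pos _ _ _ H). lra. Qed.

Lemma star_sector : star sector.
Proof.
  intros a x y t. unfold sector, x1, x2, x3; simpl. intros H Ht.
  assert (t * y * (t * y) <= y * y).
  { assert (0 <= y * y) by nra. assert (0 <= 1 - t * t) by nra. nra. }
  lra.
Qed.

Lemma open_sector : open sector.
Proof. unfold sector, msq. open_auto. Qed.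

Lemma smooth_dh_re : smooth3 sector dh_re.
Proof. assert (O := open_sector). intros n. unfold dh_re, zden, msq. Ck_auto. apply zden_neq. Qed.
Lemma smooth_dh_im : smooth3 sector dh_im.
Proof. assert (O := open_sector). intros n. unfold dh_im, zden, msq. Ck_auto. apply zden_neq. Qed.

Lemma dh_re_x a x y : sector (a, x, y) -> is_derive (fun t => dh_re a t y) x (ddh_re a x y).
Proof.
  intros H. apply zden_neq in H. unfold dh_re, ddh_re, zden, msq in *. auto_derive; [easy|]. field. easy.
Qed.
Lemma dh_re_y a x y : sector (a, x, y) -> is_derive (fun t => dh_re a x t) y (- ddh_im a x y).
Proof.
  intros H. apply zden_neq in H. unfold dh_re, ddh_im, zden, msq in *. auto_derive; [easy|]. field. easy.
Qed.
Lemma dh_im_x a x y : sector (a, x, y) -> is_derive (fun t => dh_im a t y) x (ddh_im a x y).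
Proof.
  intros H. apply zden_neq in H. unfold dh_im, ddh_im, zden, msq in *. auto_derive; [easy|]. field. easy.
Qed.
Lemma dh_im_y a x y : sector (a, x, y) -> is_derive (fun t => dh_im a x t) y (ddh_re a x y).
Proof.
  intros H. apply zden_neq in H. unfold dh_im, ddh_re, zden, msq in *. auto_derive; [easy|]. field. easy.
Qed.

(** On the axis h is real, so Im h is the primitive of its y-derivative Re h'. *)
Definition h_im := prim dh_re.
(** Only the departure of Re h from its value on the axis, which converges as a
    -> 0. The value on the axis does not when h(0) = 0; it is added separately,
    in a suitable normalization, through [axis_angle]. *)
Definition h_re (a x y : R) : R := - prim dh_im a x y.

Lemma smooth_h_im : smooth3 sector h_im.
Proof. intros n. apply Ck_prim; [apply open_sector|apply star_sector|apply smooth_dh_re]. Qed.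
Lemma smooth_h_re : smooth3 sector h_re.
Proof. intros n. apply Ck_opp; [apply open_sector|]. apply Ck_prim; [apply open_sector|apply star_sector|apply smooth_dh_im]. Qed.

Lemma h_im_y a x y : sector (a, x, y) -> is_derive (fun t => h_im a x t) y (dh_re a x y).
Proof.
  intros H. apply (prim_deriv_y sector); [apply open_sector|apply star_sector|easy|].
  intros; apply (cont_of_smooth sector); [apply smooth_dh_re|easy].
Qed.
Lemma h_re_y a x y : sector (a, x, y) -> is_derive (fun t => h_re a x t) y (- dh_im a x y).
Proof.
  intros H. apply (is_derive_opp (fun t => prim dh_im a x t)).
  apply (prim_deriv_y sector); [apply open_sector|apply star_sector|easy|].
  intros; apply (cont_of_smooth sector); [apply smooth_dh_im|easy].
Qed.
Lemma smooth_ddh_re : smooth3 sector ddh_re.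
Proof. intros n. apply (Ck_deriv_x n sector dh_re); [apply open_sector|apply smooth_dh_re|apply dh_re_x]. Qed.
Lemma smooth_ddh_im : smooth3 sector ddh_im.
Proof. intros n. apply (Ck_deriv_x n sector dh_im); [apply open_sector|apply smooth_dh_im|apply dh_im_x]. Qed.

Lemma dh_im_0 a x : dh_im a x 0 = 0.
Proof. unfold dh_im, Rdiv. ring. Qed.
Lemma dh_re_0 a x : 0 < msq a x -> dh_re a x 0 = lam / msq a x.
Proof. intros H. unfold dh_re, zden. field. nra. Qed.

(** A Cauchy-Riemann equation: differentiating under the integral gives the
    primitive of d/dx (Re h') = d/dy (Im h'). *)
Lemma h_im_x a x y : sector (a, x, y) -> is_derive (fun t => h_im a t y) x (dh_im a x y).
Proof.
  intros H. replace (dh_im a x y) with (prim ddh_re a x y).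
  - apply (prim_deriv_x sector dh_re ddh_re); [apply open_sector|apply star_sector|apply smooth_dh_re|easy|apply dh_re_x].
  - rewrite (prim_primitive sector dh_im ddh_re); [rewrite dh_im_0; ring|apply star_sector|easy| |apply dh_im_y].
    intros; apply (cont_of_smooth sector); [apply smooth_ddh_re|easy].
Qed.

(** As for [h_im_x]; the term lam / [msq] is the derivative of Re h on the axis,
    which [h_re] leaves out. *)
Lemma h_re_x a x y : sector (a, x, y) -> is_derive (fun t => h_re a t y) x (dh_re a x y - lam / msq a x).
Proof.
  intros H. replace (dh_re a x y - lam / msq a x) with (- prim ddh_im a x y).
  - apply (is_derive_opp (fun t => prim dh_im a t y)).
    apply (prim_deriv_x sector dh_im ddh_im); [apply open_sector|apply star_sector|apply smooth_dh_im|easy|apply dh_im_x].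
  - rewrite (prim_primitive sector (fun a x y => - dh_re a x y) ddh_im); [|apply star_sector|easy| |].
    + rewrite dh_re_0; [ring|]. unfold sector, x1, x2, x3 in H; simpl in H. nra.
    + intros; apply (cont_of_smooth sector); [apply smooth_ddh_im|easy].
    + intros. replace (ddh_im a0 x0 y0) with (- - ddh_im a0 x0 y0) by ring. apply (is_derive_opp (fun t => dh_re a0 x0 t)). now apply dh_re_y.
Qed.

Lemma is_derive_cosh x : is_derive cosh x (sinh x).
Proof. apply is_derive_Reals, derivable_pt_lim_cosh. Qed.
Lemma is_derive_sinh x : is_derive sinh x (cosh x).
Proof. apply is_derive_Reals, derivable_pt_lim_sinh. Qed.
(** The velocity of the slice at height x, in the frame rotated by the value of
    Re h on the axis. *)
Definition vel_cos (a x y : R) : R := cosh (h_im a x y) * cos (h_re a x y).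
Definition vel_sin (a x y : R) : R := cosh (h_im a x y) * sin (h_re a x y).
Lemma smooth_vel_cos : smooth3 sector vel_cos.
Proof. assert (O := open_sector). assert (S1 := smooth_h_im). assert (S2 := smooth_h_re). intros n. unfold vel_cos, cosh. Ck_auto. intros; lra. Qed.
Lemma smooth_vel_sin : smooth3 sector vel_sin.
Proof. assert (O := open_sector). assert (S1 := smooth_h_im). assert (S2 := smooth_h_re). intros n. unfold vel_sin, cosh. Ck_auto. intros; lra. Qed.

(** The slice itself in the rotated frame: [xi] along the direction in which it
    leaves the axis, [eta] across. *)
Definition xi := prim vel_cos.
Definition eta := prim vel_sin.
Lemma smooth_xi : smooth3 sector xi.
Proof. intros n. apply Ck_prim; [apply open_sector|apply star_sector|apply smooth_vel_cos]. Qed.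
Lemma smooth_eta : smooth3 sector eta.
Proof. intros n. apply Ck_prim; [apply open_sector|apply star_sector|apply smooth_vel_sin]. Qed.

Lemma xi_y a x y : sector (a, x, y) -> is_derive (fun t => xi a x t) y (cosh (h_im a x y) * cos (h_re a x y)).
Proof.
  intros H. apply (prim_deriv_y sector); [apply open_sector|apply star_sector|easy|].
  intros; apply (cont_of_smooth sector); [apply smooth_vel_cos|easy].
Qed.
Lemma eta_y a x y : sector (a, x, y) -> is_derive (fun t => eta a x t) y (cosh (h_im a x y) * sin (h_re a x y)).
Proof.
  intros H. apply (prim_deriv_y sector); [apply open_sector|apply star_sector|easy|].
  intros; apply (cont_of_smooth sector); [apply smooth_vel_sin|easy].
Qed.

Lemma h_im_0 a x : h_im a x 0 = 0.
Proof. unfold h_im, prim. ring. Qed.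

Lemma is_derive_mult_R (f g : R -> R) x df dg : is_derive f x df -> is_derive g x dg ->
  is_derive (fun t => f t * g t) x (df * g x + f x * dg).
Proof. intros Hf Hg. apply (is_derive_mult f g); [easy|easy|]. intros; apply Rmult_comm. Qed.

Lemma is_derive_ext_val (f : R -> R) x l l' : is_derive f x l -> l = l' -> is_derive f x l'.
Proof. now intros H <-. Qed.

Ltac to_R := unfold scal, plus, opp, one, zero; simpl; unfold mult, plus; simpl; match goal with |- @eq _ ?a ?b => change (@eq R a b) end.

Lemma prim_plus (U : R3 -> Prop) f g a x y : star U -> smooth3 U f -> smooth3 U g -> U (a, x, y) ->
  prim (fun a x y => f a x y + g a x y) a x y = prim f a x y + prim g a x y.
Proof.
  intros HS Hf Hg Hp.
  assert (Cf : forall a x y, U (a, x, y) -> cont3 f a x y) by (intros; now apply (cont_of_smooth U)).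
  assert (Cg : forall a x y, U (a, x, y) -> cont3 g a x y) by (intros; now apply (cont_of_smooth U)).
  rewrite (prim_RInt U f), (prim_RInt U g), (prim_RInt U); try easy; [|intros; apply cont3_plus; auto].
  apply (RInt_plus (V := R_CompleteNormedModule)); now apply (ex_RInt_segment U).
Qed.

Lemma prim_scal (U : R3 -> Prop) (c : R -> R -> R) f a x y : star U -> smooth3 U f -> U (a, x, y) ->
  prim (fun a x y => c a x * f a x y) a x y = c a x * prim f a x y.
Proof.
  intros HS Hf Hp.
  assert (E : ex_RInt (fun t => t ^ 0 * f a x (t * y)) 0 1).
  { apply (ex_RInt_moment 0 U); try easy. intros; now apply (cont_of_smooth U). }
  unfold prim, moment.
  replace (RInt (fun t => t ^ 0 * (c a x * f a x (t * y))) 0 1) with (RInt (fun t => scal (c a x) (t ^ 0 * f a x (t * y))) 0 1).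
  - rewrite (RInt_scal (V := R_CompleteNormedModule)) by easy. unfold scal; simpl; unfold mult; simpl. ring.
  - apply RInt_ext. intros. unfold scal; simpl; unfold mult; simpl. ring.
Qed.

(** The Cauchy-Riemann equations make the x-derivative of cosh (Im h) (cos (Re
    h), sin (Re h)) the y-derivative of sinh (Im h) (- sin (Re h), cos (Re h)).
    This is that identity with the rotation of the frame left out; it allows
    [xi] and [eta] to be differentiated in x in closed form. *)
Lemma shear_primitive a x y : sector (a, x, y) ->
  is_derive (fun t => - (sinh (h_im a x t) * sin (h_re a x t))) y
    (sinh (h_im a x y) * dh_im a x y * cos (h_re a x y) - cosh (h_im a x y) * dh_re a x y * sin (h_re a x y)) /\
  is_derive (fun t => sinh (h_im a x t) * cos (h_re a x t)) y
    (sinh (h_im a x y) * dh_im a x y * sin (h_re a x y) + cosh (h_im a x y) * dh_re a x y * cos (h_re a x y)).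
Proof.
  intros H.
  assert (D1 := is_derive_comp_R sinh (fun t => h_im a x t) y _ _ (is_derive_sinh _) (h_im_y _ _ _ H)).
  assert (D2 := is_derive_comp_R sin (fun t => h_re a x t) y _ _ (is_derive_sin _) (h_re_y _ _ _ H)).
  assert (D3 := is_derive_comp_R cos (fun t => h_re a x t) y _ _ (is_derive_cos _) (h_re_y _ _ _ H)).
  split.
  - assert (D := is_derive_opp _ _ _ (is_derive_mult_R _ _ _ _ _ D1 D2)).
    eapply is_derive_ext_val; [exact D|]. to_R. ring.
  - assert (D := is_derive_mult_R _ _ _ _ _ D1 D3).
    eapply is_derive_ext_val; [exact D|]. to_R. ring.
Qed.

Lemma msq_neq a x y : sector (a, x, y) -> msq a x <> 0.
Proof. unfold sector, x1, x2, x3; simpl. intros H. nra. Qed.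

(** The first term is the x-derivative of the immersion, the second one comes
    from the rotation of the frame at rate lam / [msq]. *)
Lemma xi_x a x y : sector (a, x, y) ->
  is_derive (fun t => xi a t y) x (- (sinh (h_im a x y) * sin (h_re a x y)) + lam / msq a x * eta a x y).
Proof.
  intros H.
  set (h := fun a x y => sinh (h_im a x y) * dh_im a x y * cos (h_re a x y) - cosh (h_im a x y) * dh_re a x y * sin (h_re a x y)).
  assert (Hh : smooth3 sector h).
  { intros n. unfold h, sinh, cosh. assert (O := open_sector). assert (S1 := smooth_h_im). assert (S2 := smooth_h_re).
    assert (S3 := smooth_dh_re). assert (S4 := smooth_dh_im). Ck_auto; intros; lra. }
  replace (- (sinh (h_im a x y) * sin (h_re a x y)) + lam / msq a x * eta a x y)
    with (prim (fun a x y => h a x y + (fun a x y => lam / msq a x * vel_sin a x y) a x y) a x y).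
  - apply (prim_deriv_x sector vel_cos); [apply open_sector|apply star_sector|apply smooth_vel_cos|easy|].
    clear. intros a x y H. unfold vel_cos, h, vel_sin.
    eapply is_derive_ext_val.
    + apply is_derive_mult_R.
      * apply (is_derive_comp_R cosh (fun t => h_im a t y)); [apply is_derive_cosh|now apply h_im_x].
      * apply (is_derive_comp_R cos (fun t => h_re a t y)); [apply is_derive_cos|now apply h_re_x].
    + to_R. ring.
  - assert (Hs : smooth3 sector (fun a x y => lam / msq a x * vel_sin a x y)).
    { assert (O := open_sector). assert (S1 := smooth_vel_sin). intros n. unfold msq. Ck_auto. exact msq_neq. }
    rewrite (prim_plus sector); [|apply star_sector|easy|easy|easy].
    rewrite (prim_scal sector (fun a x => lam / msq a x)); [|apply star_sector|apply smooth_vel_sin|easy].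
    rewrite (prim_primitive sector (fun a x y => - (sinh (h_im a x y) * sin (h_re a x y))) h); [|apply star_sector|easy| |].
    + rewrite h_im_0, sinh_0. unfold eta. ring.
    + intros; now apply (cont_of_smooth sector).
    + intros. now apply shear_primitive.
Qed.

Lemma eta_x a x y : sector (a, x, y) ->
  is_derive (fun t => eta a t y) x (sinh (h_im a x y) * cos (h_re a x y) - lam / msq a x * xi a x y).
Proof.
  intros H.
  set (h := fun a x y => sinh (h_im a x y) * dh_im a x y * sin (h_re a x y) + cosh (h_im a x y) * dh_re a x y * cos (h_re a x y)).
  assert (Hh : smooth3 sector h).
  { intros n. unfold h, sinh, cosh. assert (O := open_sector). assert (S1 := smooth_h_im). assert (S2 := smooth_h_re).
    assert (S3 := smooth_dh_re). assert (S4 := smooth_dh_im). Ck_auto; intros; lra. }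
  replace (sinh (h_im a x y) * cos (h_re a x y) - lam / msq a x * xi a x y)
    with (prim (fun a x y => h a x y + (fun a x y => - (lam / msq a x) * vel_cos a x y) a x y) a x y).
  - apply (prim_deriv_x sector vel_sin); [apply open_sector|apply star_sector|apply smooth_vel_sin|easy|].
    clear. intros a x y H. unfold vel_sin, h, vel_cos.
    eapply is_derive_ext_val.
    + apply is_derive_mult_R.
      * apply (is_derive_comp_R cosh (fun t => h_im a t y)); [apply is_derive_cosh|now apply h_im_x].
      * apply (is_derive_comp_R sin (fun t => h_re a t y)); [apply is_derive_sin|now apply h_re_x].
    + to_R. ring.
  - assert (Hs : smooth3 sector (fun a x y => - (lam / msq a x) * vel_cos a x y)).
    { assert (O := open_sector). assert (S1 := smooth_vel_cos). intros n. unfold msq. Ck_auto. exact msq_neq. }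
    rewrite (prim_plus sector); [|apply star_sector|easy|easy|easy].
    rewrite (prim_scal sector (fun a x => - (lam / msq a x))); [|apply star_sector|apply smooth_vel_cos|easy].
    rewrite (prim_primitive sector (fun a x y => sinh (h_im a x y) * cos (h_re a x y)) h); [|apply star_sector|easy| |].
    + rewrite h_im_0, sinh_0. unfold xi. ring.
    + intros; now apply (cont_of_smooth sector).
    + intros. now apply shear_primitive.
Qed.

(** * The strip around the axis *)

(** A neighbourhood of the heights and parameters in use, without the singular
    point a = x = 0. *)
Definition base (a x : R) : Prop := -2 < x < 2 /\ -1 < a < 1 /\ 0 < msq a x.
(** The exponent is chosen between two requirements. With m = x^2 + a^2, Re h
    departs from its axis value by O(lam x y^2 / m^2), which stays bounded for y
    = O(m^(3/4)); and at y of order m^(3/4) the argument lam y / m of cosh is of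
    order m^(-1/4), large enough for the distance y cosh (Im h) to exceed 2. *)
Definition strip (p : R3) : Prop :=
  base (x1 p) (x2 p) /\ 16 * kappa ^ 2 * (x3 p * x3 p) < msq (x1 p) (x2 p) * sqrt (msq (x1 p) (x2 p)).

Lemma base_sqrt a x : base a x -> msq a x < 5 /\ 0 < sqrt (msq a x) < 3 /\ sqrt (msq a x) * sqrt (msq a x) = msq a x.
Proof.
  intros [Hx [Ha Hm]]. assert (M5 : msq a x < 5) by (unfold msq; nra).
  assert (P := sqrt_lt_R0 _ Hm). assert (E := sqrt_sqrt _ (Rlt_le _ _ Hm)).
  split; [easy|split; [|easy]]. split; [easy|]. nra.
Qed.

Lemma strip_base a x y : strip (a, x, y) -> base a x.
Proof. intros H. apply H. Qed.

Lemma strip_small a x y : strip (a, x, y) -> 1000 * (y * y) <= msq a x.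
Proof.
  intros [Hb H]. unfold x1, x2, x3 in *; simpl in *. destruct (base_sqrt a x Hb) as [M5 [P E]].
  destruct Hb as [_ [_ Hm]]. unfold kappa in H.
  assert (msq a x * sqrt (msq a x) <= msq a x * 3) by (apply Rmult_le_compat_l; lra). nra.
Qed.

Lemma strip_sector a x y : strip (a, x, y) -> sector (a, x, y).
Proof.
  intros H. assert (K := strip_small _ _ _ H). destruct H as [[_ [_ Hm]] _]. unfold sector, x1, x2, x3 in *; simpl in *. nra.
Qed.

Lemma star_strip : star strip.
Proof.
  intros a x y t [Hb H] Ht. split; [exact Hb|]. unfold x1, x2, x3 in *; simpl in *.
  apply Rle_lt_trans with (2 := H). apply Rmult_le_compat_l; [unfold kappa; lra|].
  assert (0 <= y * y) by nra. assert (0 <= 1 - t * t) by nra. nra.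
Qed.

Lemma fibre_convex_strip : fibre_convex strip.
Proof.
  intros a x y y1 y2 [Hb H1] [_ H2] Hy. split; [exact Hb|]. unfold x1, x2, x3 in *; simpl in *.
  assert (K : y * y <= y1 * y1 \/ y * y <= y2 * y2).
  { destruct (Rle_lt_dec 0 y); [right|left]; nra. }
  unfold kappa in *. destruct K; nra.
Qed.

Lemma open_base : open (fun p : R3 => base (x1 p) (x2 p)).
Proof. unfold base, msq. open_auto. Qed.

Lemma open_strip : open strip.
Proof. unfold strip, msq. apply open_and; [apply open_base|open_auto]. Qed.

Lemma zden_bounds a x y : strip (a, x, y) -> msq a x * msq a x <= 2 * zden a x y /\ zden a x y <= 2 * (msq a x * msq a x).
Proof.
  intros H. assert (K := strip_small _ _ _ H). destruct H as [[_ [_ Hm]] _]. unfold x1, x2, x3 in *; simpl in *.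
  assert (x * x <= msq a x) by (unfold msq; nra).
  unfold zden. set (m := msq a x) in *. set (t := y * y) in *.
  assert (0 <= t) by (unfold t; nra).
  replace (2 * x * y * (2 * x * y)) with (4 * (x * x) * t) by (unfold t; ring).
  assert (0 <= x * x) by nra. generalize dependent (x * x). intros X HX1 HX2.
  assert (1000 * t * m <= m * m) by (apply Rmult_le_compat_r; lra).
  assert (1000 * t * t <= m * t) by (apply Rmult_le_compat_r; lra).
  assert (0 <= m * t) by (apply Rmult_le_pos; lra).
  assert (0 <= X * t) by (apply Rmult_le_pos; lra).
  assert (X * t <= m * t) by (apply Rmult_le_compat_r; lra).
  assert (0 <= t * t) by nra. assert (0 <= m * m) by nra.
  split; lra.
Qed.

Lemma RInt_bounds f lo hi : (forall t, 0 < t < 1 -> lo <= f t <= hi) -> ex_RInt f 0 1 -> lo <= RInt f 0 1 <= hi.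
Proof.
  intros H E. split.
  - replace lo with (RInt (fun _ => lo) 0 1) by (rewrite RInt_const; to_R; ring).
    apply RInt_le; [lra|apply ex_RInt_const|easy|]. intros; now apply H.
  - replace hi with (RInt (fun _ => hi) 0 1) by (rewrite RInt_const; to_R; ring).
    apply RInt_le; [lra|easy|apply ex_RInt_const|]. intros; now apply H.
Qed.

(** Separating the factor x y^2 shows both the size of [h_re] and its sign,
    which is that of x. *)
Lemma h_re_form a x y : strip (a, x, y) -> exists I, 0 <= I <= 2 / (msq a x * msq a x) /\ h_re a x y = 2 * lam * x * (y * y) * I.
Proof.
  intros H.
  exists (RInt (fun t => t / zden a x (t * y)) 0 1).
  assert (Ht' : forall t, 0 <= t <= 1 -> strip (a, x, t * y)) by (intros; now apply star_strip).
  assert (E : ex_RInt (fun t => t / zden a x (t * y)) 0 1).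
  { apply (ex_RInt_continuous (V := R_CompleteNormedModule)). intros t Ht. rewrite Rmin_left, Rmax_right in Ht by lra.
    apply @ex_derive_continuous. assert (P := zden_neq _ _ _ (strip_sector _ _ _ (Ht' t Ht))).
    unfold zden, msq in *. auto_derive. easy. }
  split.
  - apply RInt_bounds; [|exact E]. intros t Ht. specialize (Ht' t ltac:(lra)).
    assert (P := zden_pos _ _ _ (strip_sector _ _ _ Ht')). destruct (zden_bounds _ _ _ Ht') as [Q1 Q2].
    assert (Hm := proj2 (proj2 (strip_base _ _ _ H))). assert (0 < msq a x * msq a x) by nra. split.
    + apply Rlt_le, Rdiv_lt_0_compat; lra.
    + apply Rle_div_l; [easy|]. unfold Rdiv. rewrite Rmult_assoc.
      assert (1 <= / (msq a x * msq a x) * zden a x (t * y) * 2); [|lra].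
      apply Rmult_le_reg_l with (msq a x * msq a x); [easy|]. field_simplify; [|nra]. nra.
  - unfold h_re, prim, moment.
    replace (RInt (fun t => t ^ 0 * dh_im a x (t * y)) 0 1) with (- (2 * lam * x * y) * RInt (fun t => t / zden a x (t * y)) 0 1); [ring|].
    rewrite <- (RInt_scal (V := R_CompleteNormedModule)) by exact E.
    apply RInt_ext. intros; unfold dh_im, Rdiv; to_R. ring.
Qed.

(** The bound 1 is less than pi / 3, so the slice keeps advancing; the sign
    makes it bend to one side only. *)
Lemma h_re_bounds a x y : strip (a, x, y) -> -1 <= h_re a x y <= 1 /\ 0 <= x * h_re a x y.
Proof.
  intros H. destruct (h_re_form _ _ _ H) as [I [HI E]]. rewrite E.
  destruct H as [Hb H]. unfold x1, x2, x3 in *; simpl in *. destruct (base_sqrt a x Hb) as [M5 [P ES]].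
  destruct Hb as [_ [_ Hm]].
  assert (Hy : 0 <= y * y) by nra. generalize dependent (y * y). intros Y E H HY.
  assert (Lp := lam_pos).
  split.
  - set (r := sqrt (msq a x)) in *.
    assert (Hx : - r <= x <= r) by (assert (x * x <= msq a x) by (unfold msq; nra); nra).
    assert (HI2 : msq a x * msq a x * I <= 2).
    { destruct HI as [_ HI]. apply Rmult_le_compat_l with (r := msq a x * msq a x) in HI; [|nra].
      replace (msq a x * msq a x * (2 / (msq a x * msq a x))) with 2 in HI by (field; lra). exact HI. }
    assert (K : 2 * lam * r * Y * I <= 1).
    (* 2 lam = 4 kappa^2, and the strip gives 16 kappa^2 Y < m r *)
    { assert (4 * (2 * lam * Y) <= msq a x * r) by (unfold lam in *; nra).
      assert (0 <= I * r) by nra.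
      assert (4 * (2 * lam * Y) * (I * r) <= msq a x * r * (I * r)) by (apply Rmult_le_compat_r; lra).
      replace (msq a x * r * (I * r)) with (msq a x * msq a x * I) in H2 by (rewrite <- ES; ring). lra. }
    assert (0 <= 2 * lam * Y * I) by (apply Rmult_le_pos; [|easy]; apply Rmult_le_pos; lra).
    replace (2 * lam * x * Y * I) with (2 * lam * Y * I * x) by ring.
    replace (2 * lam * r * Y * I) with (2 * lam * Y * I * r) in K by ring.
    generalize dependent (2 * lam * Y * I). intros. nra.
  - replace (x * (2 * lam * x * Y * I)) with (2 * lam * Y * I * (x * x)) by ring.
    apply Rmult_le_pos; [|nra]. apply Rmult_le_pos; [|easy]; apply Rmult_le_pos; lra.
Qed.

(** From cos w = 1 - 2 sin^2 (w / 2) and |sin t| <= |t|. *)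
Lemma cos_lower w : -1 <= w <= 1 -> 1 / 2 <= cos w.
Proof.
  intros H. assert (E : cos w = 1 - 2 * (sin (w / 2) * sin (w / 2))).
  { replace w with (2 * (w / 2)) at 1 by field. rewrite cos_2a_sin. ring. }
  assert (K : Rabs (sin (w / 2)) <= Rabs (w / 2)).
  { destruct (Rle_lt_dec 0 (w / 2)).
    - assert (sin (w / 2) <= w / 2).
      { destruct (Req_dec (w / 2) 0) as [->|]; [rewrite sin_0; lra|]. apply Rlt_le, sin_lt_x. lra. }
      assert (0 <= sin (w / 2)) by (apply sin_ge_0; generalize PI2_1; lra).
      rewrite !Rabs_pos_eq; lra.
    - assert (sin (- (w / 2)) <= - (w / 2)) by (apply Rlt_le, sin_lt_x; lra).
      assert (0 <= sin (- (w / 2))) by (apply sin_ge_0; generalize PI2_1; lra).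
      rewrite sin_neg in *. rewrite !Rabs_left1; lra. }
  assert (sin (w / 2) * sin (w / 2) <= (w / 2) * (w / 2)).
  { apply Rsqr_le_abs_1 in K. exact K. }
  rewrite E. nra.
Qed.

Lemma sin_sign x w : -1 <= w <= 1 -> 0 <= x * w -> 0 <= x * sin w.
Proof.
  intros Hw H. assert (P1 := PI2_1).
  destruct (Rtotal_order w 0) as [K|[->|K]].
  - assert (x <= 0) by nra. assert (0 <= sin (- w)) by (apply sin_ge_0; lra). rewrite sin_neg in *. nra.
  - rewrite sin_0. lra.
  - assert (0 <= x) by nra. assert (0 <= sin w) by (apply sin_ge_0; lra). nra.
Qed.

Lemma cosh_ge_1 v : 1 <= cosh v.
Proof.
  unfold cosh. assert (P := exp_pos v). assert (E : exp v * exp (- v) = 1) by (rewrite <- exp_plus; replace (v + - v) with 0 by ring; apply exp_0).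
  assert (P' := exp_pos (- v)). generalize dependent (exp v). generalize dependent (exp (- v)). intros q Q p P E.
  assert (0 <= (p - q) * (p - q)) by apply Rle_0_sqr. assert (4 <= (p + q) * (p + q)) by lra. nra.
Qed.

(** Means of the velocity over the slice from the axis, so that [xi] = y
    [xi_mean] and [eta] = y [eta_mean]. *)
Definition xi_mean := moment 0 vel_cos.
Definition eta_mean := moment 0 vel_sin.
Definition rho_mean (a x y : R) : R := sqrt (xi_mean a x y * xi_mean a x y + eta_mean a x y * eta_mean a x y).
(** The signed distance to the axis. Writing it as y times the length of the
    mean velocity, which does not vanish, makes it smooth across the axis. *)
Definition rho (a x y : R) : R := y * rho_mean a x y.

Lemma ex_RInt_moment_strip f a x y : smooth3 sector f -> strip (a, x, y) -> ex_RInt (fun t => t ^ 0 * f a x (t * y)) 0 1.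
Proof.
  intros Hf H. apply (ex_RInt_moment 0 sector); [apply star_sector|now apply strip_sector|]. intros; now apply (cont_of_smooth sector).
Qed.

Lemma vel_cos_lower a x y : strip (a, x, y) -> 1 / 2 * cosh (h_im a x y) <= vel_cos a x y.
Proof.
  intros H. unfold vel_cos. destruct (h_re_bounds _ _ _ H) as [Hw _]. generalize (cos_lower _ Hw) (cosh_ge_1 (h_im a x y)). nra.
Qed.

Lemma xi_mean_pos a x y : strip (a, x, y) -> 1 / 2 <= xi_mean a x y.
Proof.
  intros H. unfold xi_mean, moment.
  replace (1 / 2) with (RInt (fun _ => 1 / 2) 0 1) by (rewrite RInt_const; to_R; field).
  apply RInt_le; [lra|apply ex_RInt_const|now apply ex_RInt_moment_strip, H; apply smooth_vel_cos|].
  intros t Ht. assert (Ht' : strip (a, x, t * y)) by (apply star_strip; [easy|lra]).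
  generalize (vel_cos_lower _ _ _ Ht') (cosh_ge_1 (h_im a x (t * y))). simpl. lra.
Qed.

Lemma vel_sin_sign a x y : strip (a, x, y) -> 0 <= x * vel_sin a x y.
Proof.
  intros H. destruct (h_re_bounds _ _ _ H) as [Hw Hx]. unfold vel_sin.
  replace (x * (cosh (h_im a x y) * sin (h_re a x y))) with (cosh (h_im a x y) * (x * sin (h_re a x y))) by ring.
  apply Rmult_le_pos; [generalize (cosh_ge_1 (h_im a x y)); lra|]. now apply sin_sign.
Qed.

Lemma eta_mean_sign a x y : strip (a, x, y) -> 0 <= x * eta_mean a x y.
Proof.
  intros H. unfold eta_mean, moment.
  assert (E := ex_RInt_moment_strip vel_sin a x y smooth_vel_sin H).
  replace (x * RInt (fun t => t ^ 0 * vel_sin a x (t * y)) 0 1) with (RInt (fun t => scal x (t ^ 0 * vel_sin a x (t * y))) 0 1).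
  - apply RInt_ge_0; [lra|now apply (ex_RInt_scal (V := R_NormedModule))|].
    intros t Ht. assert (Ht' : strip (a, x, t * y)) by (apply star_strip; [easy|lra]).
    unfold scal; simpl; unfold mult; simpl. rewrite Rmult_1_l. now apply vel_sin_sign.
  - rewrite (RInt_scal (V := R_CompleteNormedModule)) by easy. reflexivity.
Qed.

(** The transverse velocity has the sign of x along the whole slice, hence so
    has its mean. *)
Lemma eta_mean_vel_sin a x y : strip (a, x, y) -> 0 <= eta_mean a x y * vel_sin a x y.
Proof.
  intros H. assert (K1 := eta_mean_sign _ _ _ H). assert (K2 := vel_sin_sign _ _ _ H).
  destruct (Req_dec x 0) as [->|Hx].
  - assert (h_re a 0 y = 0) as E. { destruct (h_re_form _ _ _ H) as [I [_ ->]]. ring. }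
    unfold vel_sin. rewrite E, sin_0. lra.
  - assert (0 < x * x) by nra.
    assert (0 <= x * x * (eta_mean a x y * vel_sin a x y)) by (replace (x * x * (eta_mean a x y * vel_sin a x y)) with ((x * eta_mean a x y) * (x * vel_sin a x y)) by ring; nra).
    nra.
Qed.

Lemma mean_sq_pos a x y : strip (a, x, y) -> 0 < xi_mean a x y * xi_mean a x y + eta_mean a x y * eta_mean a x y.
Proof. intros H. generalize (xi_mean_pos _ _ _ H). nra. Qed.

Lemma rho_mean_pos a x y : strip (a, x, y) -> 0 < rho_mean a x y.
Proof. intros H. apply sqrt_lt_R0. now apply mean_sq_pos. Qed.

Lemma rho_mean_sq a x y : strip (a, x, y) -> rho_mean a x y * rho_mean a x y = xi_mean a x y * xi_mean a x y + eta_mean a x y * eta_mean a x y.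
Proof. intros H. apply sqrt_sqrt. generalize (mean_sq_pos _ _ _ H). lra. Qed.

Lemma smooth_xi_mean : smooth3 sector xi_mean.
Proof. intros n. apply Ck_moment; [apply open_sector|apply star_sector|apply smooth_vel_cos]. Qed.
Lemma smooth_eta_mean : smooth3 sector eta_mean.
Proof. intros n. apply Ck_moment; [apply open_sector|apply star_sector|apply smooth_vel_sin]. Qed.

Lemma strip_sector' p : strip p -> sector p.
Proof. destruct p as [[a x] y]. apply strip_sector. Qed.

Lemma smooth_sector_strip f : smooth3 sector f -> smooth3 strip f.
Proof. intros H n. apply (Ck_sub n sector); [apply strip_sector'|apply H]. Qed.

Lemma smooth_rho_mean : smooth3 strip rho_mean.
Proof.
  assert (O := open_strip). assert (S1 := smooth_sector_strip _ smooth_xi_mean). assert (S2 := smooth_sector_strip _ smooth_eta_mean).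
  intros n. unfold rho_mean. Ck_auto. apply mean_sq_pos.
Qed.

Lemma smooth_rho : smooth3 strip rho.
Proof. intros n. apply Ck_mult; [apply Ck_y|apply smooth_rho_mean]. Qed.

Definition rho_dy (a x y : R) : R := (xi_mean a x y * vel_cos a x y + eta_mean a x y * vel_sin a x y) / rho_mean a x y.

(** The derivative of the distance is the component of the velocity along the
    position vector. In [rho_dy] both products are nonnegative and the first is
    positive, because the slice advances and bends to one side. *)
Lemma rho_y : fibre_slope strip rho rho_dy.
Proof.
  intros a x y H. assert (H0 := strip_sector _ _ _ H). assert (NP := rho_mean_pos _ _ _ H). assert (WP := mean_sq_pos _ _ _ H).
  split.
  - destruct (smooth_xi_mean 1%nat) as [_ [xm_x [xm_y [D1 _]]]]. destruct (smooth_eta_mean 1%nat) as [_ [em_x [em_y [D2 _]]]].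
    destruct (D1 _ _ _ H0) as [_ E1]. destruct (D2 _ _ _ H0) as [_ E2].
    assert (S1 : xi_mean a x y + y * xm_y a x y = vel_cos a x y).
    { assert (K := is_derive_mult_R (fun t => t) (fun t => xi_mean a x t) y _ _ (is_derive_id y) E1).
      assert (K2 := is_derive_unique _ _ _ (xi_y _ _ _ H0)).
      change (Derive (fun t => t * xi_mean a x t) y = vel_cos a x y) in K2.
      apply is_derive_unique in K. rewrite <- K2. symmetry. etransitivity; [exact K|]. to_R. ring. }
    assert (S2 : eta_mean a x y + y * em_y a x y = vel_sin a x y).
    { assert (K := is_derive_mult_R (fun t => t) (fun t => eta_mean a x t) y _ _ (is_derive_id y) E2).
      assert (K2 := is_derive_unique _ _ _ (eta_y _ _ _ H0)).
      change (Derive (fun t => t * eta_mean a x t) y = vel_sin a x y) in K2.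
      apply is_derive_unique in K. rewrite <- K2. symmetry. etransitivity; [exact K|]. to_R. ring. }
    eapply is_derive_ext_val.
    + apply (is_derive_mult_R (fun t => t) (fun t => rho_mean a x t)); [apply @is_derive_id|].
      apply (is_derive_comp_R sqrt (fun t => xi_mean a x t * xi_mean a x t + eta_mean a x t * eta_mean a x t)).
      * apply is_derive_Reals, derivable_pt_lim_sqrt, WP.
      * apply (is_derive_plus (fun t => xi_mean a x t * xi_mean a x t) (fun t => eta_mean a x t * eta_mean a x t)); apply is_derive_mult_R; eassumption.
    + unfold plus, one; simpl. fold (rho_mean a x y). unfold rho_dy. rewrite <- S1, <- S2.
      assert (Q := rho_mean_sq _ _ _ H).
      replace (xi_mean a x y * (xi_mean a x y + y * xm_y a x y) + eta_mean a x y * (eta_mean a x y + y * em_y a x y))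
        with (rho_mean a x y * rho_mean a x y + y * (xi_mean a x y * xm_y a x y + eta_mean a x y * em_y a x y)) by (rewrite Q; ring).
      field. lra.
  - apply Rdiv_lt_0_compat; [|easy].
    generalize (xi_mean_pos _ _ _ H) (eta_mean_vel_sin _ _ _ H) (vel_cos_lower _ _ _ H) (cosh_ge_1 (h_im a x y)). nra.
Qed.

(** * Distance to the axis as a coordinate *)

(** A polynomial lower bound is enough for [rho_reaches], and the fourth power
    is the first even one that beats the width of the strip. *)
Lemma cosh_quartic v : v ^ 4 / 512 <= cosh v.
Proof.
  assert (K : forall w, 0 <= w -> w ^ 4 / 512 <= exp w / 2).
  { intros w Hw. replace w with (w / 4 + w / 4 + (w / 4 + w / 4)) at 2 by field. rewrite !exp_plus.
    assert (w / 4 <= exp (w / 4)) by (generalize (exp_ineq1_le (w / 4)); lra).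
    generalize dependent (exp (w / 4)). intros q Hq.
    assert (w / 4 * (w / 4) <= q * q) by nra.
    assert (w / 4 * (w / 4) * (w / 4 * (w / 4)) <= q * q * (q * q)) by (apply Rmult_le_compat; nra). nra. }
  unfold cosh. destruct (Rle_lt_dec 0 v) as [H|H].
  - generalize (K v H) (exp_pos (- v)). lra.
  - assert (K1 := K (- v)). replace ((- v) ^ 4) with (v ^ 4) in K1 by ring. generalize (exp_pos v). lra.
Qed.

Lemma cosh_mono a b : 0 <= a <= b -> cosh a <= cosh b.
Proof.
  intros H. unfold cosh.
  assert (E1 : exp a * exp (- a) = 1) by (rewrite <- exp_plus; replace (a + - a) with 0 by ring; apply exp_0).
  assert (E2 : exp b * exp (- b) = 1) by (rewrite <- exp_plus; replace (b + - b) with 0 by ring; apply exp_0).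
  assert (1 <= exp a) by (rewrite <- exp_0; destruct (Req_dec a 0) as [->|]; [lra|apply Rlt_le, exp_increasing; lra]).
  assert (exp a <= exp b) by (destruct (Req_dec a b) as [->|]; [lra|apply Rlt_le, exp_increasing; lra]).
  generalize (exp_pos (- a)) (exp_pos (- b)).
  generalize dependent (exp a). generalize dependent (exp b). generalize dependent (exp (- a)). generalize dependent (exp (- b)).
  intros b' a' b0 E2 a0 E1 H1 H2 P1 P2.
  assert (b' <= a') by nra.
  assert (a' - b' <= b0 - a0).
  { replace (a' - b') with ((b0 - a0) * (a' * b')).
    - assert (a' * b' <= 1) by nra. assert (0 <= a' * b') by nra. nra.
    - replace ((b0 - a0) * (a' * b')) with ((b0 * b') * a' - (a0 * a') * b') by ring. rewrite E1, E2. ring. }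
  lra.
Qed.

Lemma cosh_even v : cosh (- v) = cosh v.
Proof. unfold cosh. rewrite Ropp_involutive. lra. Qed.

Lemma cosh_abs_mono a b : Rabs a <= Rabs b -> cosh a <= cosh b.
Proof.
  intros H.
  assert (E : forall c, cosh c = cosh (Rabs c)).
  { intros c. unfold Rabs. destruct (Rcase_abs c); [symmetry; apply cosh_even|easy]. }
  rewrite (E a), (E b). apply cosh_mono. split; [apply Rabs_pos|easy].
Qed.

Lemma dh_re_lower a x y : strip (a, x, y) -> kappa ^ 2 / (2 * msq a x) <= dh_re a x y.
Proof.
  intros H. assert (K := strip_small _ _ _ H). destruct (zden_bounds _ _ _ H) as [Q1 Q2].
  assert (QP := zden_pos _ _ _ (strip_sector _ _ _ H)). assert (Hm := proj2 (proj2 (strip_base _ _ _ H))).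
  unfold dh_re, lam. set (m := msq a x) in *. set (t := y * y) in *. assert (0 <= t) by (unfold t; nra).
  apply (proj1 (Rle_div_r _ _ (zden a x y) QP)). unfold Rdiv.
  apply Rle_trans with (kappa ^ 2 * / (2 * m) * (2 * (m * m))).
  - apply Rmult_le_compat_l; [|easy]. apply Rmult_le_pos; [unfold kappa; lra|]. apply Rlt_le, Rinv_0_lt_compat. lra.
  - field_simplify; [|lra]. assert (0 < kappa ^ 2) by (unfold kappa; lra). nra.
Qed.

Lemma dh_re_pos a x y : strip (a, x, y) -> 0 < dh_re a x y.
Proof.
  intros H. assert (K := dh_re_lower _ _ _ H). assert (Hm := proj2 (proj2 (strip_base _ _ _ H))).
  apply Rlt_le_trans with (2 := K). apply Rdiv_lt_0_compat; [unfold kappa|]; lra.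
Qed.

Lemma h_im_lower a x y : strip (a, x, y) -> (y * (kappa ^ 2 / (2 * msq a x))) ^ 4 <= h_im a x y ^ 4.
Proof.
  intros H. unfold h_im, prim. set (c := kappa ^ 2 / (2 * msq a x)).
  assert (Hm := proj2 (proj2 (strip_base _ _ _ H))).
  assert (Hc : 0 < c) by (apply Rdiv_lt_0_compat; [unfold kappa|]; lra).
  assert (HM : c <= moment 0 dh_re a x y).
  { unfold moment. replace c with (RInt (fun _ => c) 0 1) by (rewrite RInt_const; to_R; ring).
    apply RInt_le; [lra|apply ex_RInt_const|now apply ex_RInt_moment_strip, H; apply smooth_dh_re|].
    intros t Ht. simpl. rewrite Rmult_1_l. apply dh_re_lower. apply star_strip; [easy|lra]. }
  rewrite !Rpow_mult_distr. apply Rmult_le_compat_l.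
  - replace (y ^ 4) with ((y * y) * (y * y)) by ring. assert (0 <= y * y) by nra. nra.
  - apply pow_incr. lra.
Qed.

(** Integrates the quartic bound for cosh, using |Im h| >= |y| kappa^2 / (2 m)
    and cos (Re h) >= 1/2. *)
Lemma xi_mean_lower a x y : strip (a, x, y) -> (y * (kappa ^ 2 / (2 * msq a x))) ^ 4 / 5120 <= xi_mean a x y.
Proof.
  intros H. set (c := kappa ^ 2 / (2 * msq a x)). unfold xi_mean, moment.
  replace ((y * c) ^ 4 / 5120) with (RInt (fun t => (y * c) ^ 4 / 1024 * t ^ 4) 0 1).
  - apply RInt_le; [lra| |now apply ex_RInt_moment_strip, H; apply smooth_vel_cos|].
    + apply (ex_RInt_continuous (V := R_CompleteNormedModule)). intros. apply @ex_derive_continuous. auto_derive. easy.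
    + intros t Ht. assert (Ht' : strip (a, x, t * y)) by (apply star_strip; [easy|lra]).
      assert (K1 := vel_cos_lower _ _ _ Ht'). assert (K2 := cosh_quartic (h_im a x (t * y))). assert (K3 := h_im_lower _ _ _ Ht').
      fold c in K3. replace ((t * y * c) ^ 4) with ((y * c) ^ 4 * t ^ 4) in K3 by ring. simpl (t ^ 0). lra.
  - apply (is_RInt_unique (V := R_CompleteNormedModule)).
    replace ((y * c) ^ 4 / 5120) with ((y * c) ^ 4 / 1024 * (1 ^ 5 / 5) - (y * c) ^ 4 / 1024 * (0 ^ 5 / 5)) by field.
    apply (is_RInt_derive (V := R_CompleteNormedModule) (fun t => (y * c) ^ 4 / 1024 * (t ^ 5 / 5))).
    + intros t _. auto_derive; [easy|]. to_R. field.
    + intros t _. apply @ex_derive_continuous. auto_derive. easy.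
Qed.

(** At y^2 = m^(3/2) / (32 kappa^2), half of what the strip allows, y times the
    bound of [xi_mean_lower] is a multiple of kappa^3 m^(-1/4), large because m
    is bounded and kappa is large. *)
Lemma rho_reaches a x : base a x -> exists y, 0 < y /\ strip (a, x, y) /\ strip (a, x, - y) /\ 2 <= rho a x y /\ rho a x (- y) <= -2.
Proof.
  intros Hb. destruct (base_sqrt _ _ Hb) as [M5 [P ES]]. assert (Hm := proj2 (proj2 Hb)).
  set (m := msq a x) in *. set (r := sqrt m) in *.
  set (y2 := m * r / (32 * kappa ^ 2)).
  assert (Hy2 : 0 < y2) by (apply Rdiv_lt_0_compat; [nra|unfold kappa; lra]).
  set (y := sqrt y2). assert (Hy : 0 < y) by now apply sqrt_lt_R0.
  assert (Ey : y * y = y2) by (apply sqrt_sqrt; lra).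
  assert (Hin : forall z, z * z = y2 -> strip (a, x, z)).
  { intros z Hz. split; [exact Hb|]. unfold x1, x2, x3; simpl. fold m r. rewrite Hz. unfold y2.
    replace (16 * (kappa * (kappa * 1)) * (m * r / (32 * kappa ^ 2))) with (m * r / 2) by (field; unfold kappa; lra). nra. }
  assert (V : strip (a, x, y)) by now apply Hin.
  assert (V' : strip (a, x, - y)) by (apply Hin; rewrite <- Ey; ring).
  (* the constants combine to kappa^4 / (83886080 * 10^6), about 119 *)
  assert (Hbig : forall z, z * z = y2 -> 2 <= y * rho_mean a x z).
  { intros z Hz. assert (Vz := Hin z Hz). assert (L := xi_mean_lower _ _ _ Vz).
    assert (N1 : xi_mean a x z <= rho_mean a x z).
    { unfold rho_mean. rewrite <- (sqrt_square (xi_mean a x z)) at 1 by (generalize (xi_mean_pos _ _ _ Vz); lra).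
      apply sqrt_le_1_alt. nra. }
    fold m in L. replace ((z * (kappa ^ 2 / (2 * m))) ^ 4 / 5120) with (kappa ^ 4 / 83886080 / m) in L.
    2:{ replace ((z * (kappa ^ 2 / (2 * m))) ^ 4) with ((z * z) * (z * z) * (kappa ^ 8) / (16 * m ^ 4)) by (field; lra).
        rewrite Hz. unfold y2. replace (m * r / (32 * kappa ^ 2) * (m * r / (32 * kappa ^ 2))) with (m * m * (r * r) / (1024 * kappa ^ 4)) by (field; unfold kappa; lra).
        rewrite ES. field. split; [unfold kappa|]; lra. }
    apply Rle_trans with (y * (kappa ^ 4 / 83886080 / m)); [|apply Rmult_le_compat_l; lra].
    assert (Hyb : 1 / 1000000 * m <= y).
    { apply Rsqr_incr_0_var; [|lra]. unfold Rsqr. rewrite Ey. unfold y2.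
      apply (Rle_div_r _ _ (32 * kappa ^ 2)); [unfold kappa; lra|]. unfold kappa. rewrite <- ES at 1 2. assert (r * r * r <= 9 * r) by nra. nra. }
    apply Rle_trans with (1 / 1000000 * m * (kappa ^ 4 / 83886080 / m)).
    - replace (1 / 1000000 * m * (kappa ^ 4 / 83886080 / m)) with (kappa ^ 4 / 83886080 / 1000000) by (field; lra). unfold kappa. lra.
    - apply Rmult_le_compat_r; [|easy]. apply Rmult_le_pos; [unfold kappa; lra|]. apply Rlt_le, Rinv_0_lt_compat; lra. }
  exists y. split; [easy|split; [easy|split; [easy|split]]].
  - unfold rho. now apply Hbig.
  - unfold rho. assert (K := Hbig (- y)). replace (- y * - y) with (y * y) in K by ring. specialize (K Ey). lra.
Qed.

(** The domain in the coordinates (a, x, s), where s is the signed distance to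
    the axis. *)
Definition Box (p : R3) : Prop := base (x1 p) (x2 p) /\ -2 < x3 p < 2.

Lemma rho_onto a x s : Box (a, x, s) -> exists y, strip (a, x, y) /\ rho a x y = s.
Proof.
  intros [Hb Hs]. unfold x1, x2, x3 in *; simpl in *.
  destruct (rho_reaches a x Hb) as [y [Hy [V [V' [L1 L2]]]]].
  destruct (IVT_derive (rho a x) (rho_dy a x) (- y) y s) as [z [Hz E]]; [|lra|lra|].
  - intros t Ht. apply rho_y. now apply (fibre_convex_strip a x t (- y) y).
  - exists z. split; [apply (fibre_convex_strip a x z (- y) y); try easy; lra|easy].
Qed.

(** The isothermal coordinate y as a function of the height and the signed
    distance. *)
Definition iso_y (a x s : R) : R := epsilon (inhabits 0) (fun y => strip (a, x, y) /\ rho a x y = s).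

Lemma iso_y_range a x s : fibre_range strip rho (a, x, s) -> strip (a, x, iso_y a x s) /\ rho a x (iso_y a x s) = s.
Proof.
  intros [y Hy]. unfold x1, x2, x3 in *; simpl in *.
  apply (epsilon_spec (inhabits 0) (fun y => strip (a, x, y) /\ rho a x y = s)). now exists y.
Qed.

Lemma Box_range p : Box p -> fibre_range strip rho p.
Proof. destruct p as [[a x] s]. intros H. destruct (rho_onto _ _ _ H) as [y Hy]. now exists y. Qed.

Lemma iso_y_spec a x s : Box (a, x, s) -> strip (a, x, iso_y a x s) /\ rho a x (iso_y a x s) = s.
Proof. intros H. apply iso_y_range. now apply Box_range. Qed.

Lemma smooth_iso_y : smooth3 Box iso_y.
Proof.
  intros n. apply (Ck_sub n (fibre_range strip rho)); [apply Box_range|].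
  apply (smooth3_inverse strip rho rho_dy); [apply open_strip|apply fibre_convex_strip|apply smooth_rho|apply rho_y|apply iso_y_range].
Qed.

Lemma open_Box : open Box.
Proof. unfold Box. apply open_and; [apply open_base|open_auto]. Qed.

(** The polar angle of the point of the slice in the rotated frame. The
    principal branch is right because [xi_mean] is positive; a negative s stands
    for the opposite ray. *)
Definition phi (a x s : R) : R := atan (eta_mean a x (iso_y a x s) / xi_mean a x (iso_y a x s)).

Lemma comp_iso_y f : smooth3 strip f -> smooth3 Box (fun a x s => f a x (iso_y a x s)).
Proof.
  intros Hf n. apply (Ck_comp n Box strip f (fun _ x _ => x) iso_y); [apply open_strip|apply Hf|apply Ck_x|apply smooth_iso_y|].
  intros. now apply iso_y_spec.
Qed.

Lemma smooth_phi : smooth3 Box phi.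
Proof.
  assert (O := open_Box). assert (S1 := comp_iso_y _ (smooth_sector_strip _ smooth_xi_mean)). assert (S2 := comp_iso_y _ (smooth_sector_strip _ smooth_eta_mean)).
  intros n. unfold phi. Ck_auto.
  intros a x s H. generalize (xi_mean_pos _ _ _ (proj1 (iso_y_spec _ _ _ H))). lra.
Qed.

Lemma phi_bound a x s : - PI / 2 < phi a x s < PI / 2.
Proof. apply atan_bound. Qed.

Lemma phi_polar a x s : Box (a, x, s) ->
  s * cos (phi a x s) = xi a x (iso_y a x s) /\ s * sin (phi a x s) = eta a x (iso_y a x s).
Proof.
  intros H. destruct (iso_y_spec _ _ _ H) as [V E]. set (y := iso_y a x s) in *.
  assert (P1 := xi_mean_pos _ _ _ V). assert (NP := rho_mean_pos _ _ _ V). assert (NQ := rho_mean_sq _ _ _ V).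
  assert (R : sqrt (1 + Rsqr (eta_mean a x y / xi_mean a x y)) = rho_mean a x y / xi_mean a x y).
  { apply sqrt_lem_1.
    - generalize (Rle_0_sqr (eta_mean a x y / xi_mean a x y)). lra.
    - apply Rlt_le, Rdiv_lt_0_compat; lra.
    - unfold Rsqr. replace (rho_mean a x y / xi_mean a x y * (rho_mean a x y / xi_mean a x y)) with (rho_mean a x y * rho_mean a x y / (xi_mean a x y * xi_mean a x y)) by (field; lra).
      rewrite NQ. field. lra. }
  unfold phi. fold y. rewrite cos_atan, sin_atan, R. unfold xi, eta, prim. fold xi_mean eta_mean.
  unfold rho in E. rewrite <- E. split; field; lra.
Qed.

(** The component of the position along the direction of the slice. It has the
    sign of y for the same reason as in [rho_y]. *)
Definition turn_den (a x y : R) : R := xi a x y * cos (h_re a x y) + eta a x y * sin (h_re a x y).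

Lemma turn_den_sign a x y : strip (a, x, y) -> exists c, 0 < c /\ turn_den a x y = y * c.
Proof.
  intros V. exists ((xi_mean a x y * vel_cos a x y + eta_mean a x y * vel_sin a x y) / cosh (h_im a x y)).
  assert (C := cosh_ge_1 (h_im a x y)). split.
  - apply Rdiv_lt_0_compat; [|lra]. generalize (xi_mean_pos _ _ _ V) (eta_mean_vel_sin _ _ _ V) (vel_cos_lower _ _ _ V). nra.
  - unfold turn_den, xi, eta, prim. fold xi_mean eta_mean. unfold vel_cos, vel_sin. field. lra.
Qed.

Lemma sinh_sign v : (0 < v -> 0 < sinh v) /\ (v < 0 -> sinh v < 0).
Proof.
  unfold sinh. split; intros H; [assert (exp (- v) < exp v) by (apply exp_increasing; lra)|assert (exp v < exp (- v)) by (apply exp_increasing; lra)]; lra.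
Qed.

Lemma h_im_slope : fibre_slope strip h_im dh_re.
Proof. intros a x y H. split; [now apply h_im_y, strip_sector|now apply dh_re_pos]. Qed.

Lemma h_im_sign a x y : strip (a, x, y) -> (0 < y -> 0 < h_im a x y) /\ (y < 0 -> h_im a x y < 0).
Proof.
  intros V. assert (D := h_im_slope). assert (V' : strip (a, x, 0)) by (replace 0 with (0 * y) by ring; apply star_strip; [easy|lra]).
  split; intros Hy; assert (K := fibre_increasing strip h_im dh_re a x); rewrite <- (h_im_0 a x); apply K; try easy; apply fibre_convex_strip.
Qed.

Lemma iso_y_sign a x s : Box (a, x, s) -> (0 < s -> 0 < iso_y a x s) /\ (s < 0 -> iso_y a x s < 0) /\ (s = 0 -> iso_y a x s = 0).
Proof.
  intros H. destruct (iso_y_spec _ _ _ H) as [V E]. assert (NP := rho_mean_pos _ _ _ V). unfold rho in E.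
  split; [|split]; intros Hs; nra.
Qed.

Lemma iso_y_derivs a x s : Box (a, x, s) -> exists Yx Ys,
  is_derive (fun t => iso_y a t s) x Yx /\ is_derive (fun t => iso_y a x t) s Ys /\ 0 < Ys.
Proof.
  intros H. destruct (smooth_iso_y 1%nat) as [_ [Yx [Ys [D _]]]]. destruct (D _ _ _ H) as [D1 D2].
  exists (Yx a x s), (Ys a x s). split; [easy|split; [easy|]].
  destruct (iso_y_spec _ _ _ H) as [V E]. destruct (rho_y _ _ _ V) as [D3 P].
  assert (K := is_derive_comp_R (fun t => rho a x t) (fun t => iso_y a x t) s _ _ D3 D2).
  assert (K' : is_derive (fun t => rho a x (iso_y a x t)) s 1).
  { apply is_derive_ext_loc with (fun t => t); [|apply @is_derive_id].
    generalize (open_slice_y _ _ _ _ open_Box H). apply filter_imp. intros t Ht. symmetry. now apply iso_y_spec. }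
  apply is_derive_unique in K. apply is_derive_unique in K'. rewrite K in K'.
  nra.
Qed.

(** Differentiating s (cos phi, sin phi) = (xi, eta) in x at fixed s and
    eliminating the derivative of y gives [turn_den] (phi_x + lam / m) = sinh
    (Im h). Both sides have the sign of s, so the total angle increases with the
    height. *)
Lemma phi_x a x s : Box (a, x, s) -> s <> 0 -> exists d, is_derive (fun t => phi a t s) x d /\ 0 < d + lam / msq a x.
Proof.
  intros H Hs. destruct (smooth_phi 1%nat) as [_ [px [ps [D _]]]]. destruct (D _ _ _ H) as [D1 _].
  exists (px a x s). split; [easy|]. set (d := px a x s) in *.
  destruct (iso_y_spec _ _ _ H) as [V E]. assert (Vz := strip_sector _ _ _ V).
  destruct (iso_y_derivs _ _ _ H) as [Yx [_ [DY _]]].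
  destruct (phi_polar _ _ _ H) as [Ec Es].
  set (y := iso_y a x s) in *. set (v := h_im a x y). set (w := h_re a x y).
  destruct (smooth_xi 1%nat) as [_ [sx [sy [Ds [Csx _]]]]].
  destruct (smooth_eta 1%nat) as [_ [tx [ty [Dt [Ctx _]]]]].
  assert (S1 := Ck_differentiable 0 sector xi sx sy a x y open_sector Vz Ds Csx).
  assert (S2 := Ck_differentiable 0 sector eta tx ty a x y open_sector Vz Dt Ctx).
  assert (Esx : sx a x y = - (sinh v * sin w) + lam / msq a x * eta a x y).
  { etransitivity; [symmetry; apply is_derive_unique, Ds, Vz|]. now apply is_derive_unique, xi_x. }
  assert (Esy : sy a x y = cosh v * cos w).
  { etransitivity; [symmetry; apply is_derive_unique, Ds, Vz|]. now apply is_derive_unique, xi_y. }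
  assert (Etx : tx a x y = sinh v * cos w - lam / msq a x * xi a x y).
  { etransitivity; [symmetry; apply is_derive_unique, Dt, Vz|]. now apply is_derive_unique, eta_x. }
  assert (Ety : ty a x y = cosh v * sin w).
  { etransitivity; [symmetry; apply is_derive_unique, Dt, Vz|]. now apply is_derive_unique, eta_y. }
  assert (R1 := chain2 (xi a) (fun t => t) (fun t => iso_y a t s) x _ _ _ _ S1 (is_derive_id x) DY).
  assert (R2 := chain2 (eta a) (fun t => t) (fun t => iso_y a t s) x _ _ _ _ S2 (is_derive_id x) DY).
  assert (L1 := is_derive_scal _ _ s _ (is_derive_comp_R cos (fun t => phi a t s) x _ _ (is_derive_cos _) D1)).
  assert (L2 := is_derive_scal _ _ s _ (is_derive_comp_R sin (fun t => phi a t s) x _ _ (is_derive_sin _) D1)).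
  assert (Q1 : s * (- sin (phi a x s) * d) = sx a x y * 1 + sy a x y * Yx).
  { rewrite <- (is_derive_unique _ _ _ L1). etransitivity; [|apply (is_derive_unique _ _ _ R1)].
    apply Derive_ext_loc. generalize (open_slice_x _ _ _ _ open_Box H). apply filter_imp. intros t Ht. now apply phi_polar. }
  assert (Q2 : s * (cos (phi a x s) * d) = tx a x y * 1 + ty a x y * Yx).
  { rewrite <- (is_derive_unique _ _ _ L2). etransitivity; [|apply (is_derive_unique _ _ _ R2)].
    apply Derive_ext_loc. generalize (open_slice_x _ _ _ _ open_Box H). apply filter_imp. intros t Ht. now apply phi_polar. }
  rewrite Esx, Esy in Q1. rewrite Etx, Ety in Q2.
  assert (T : sin w * sin w + cos w * cos w = 1) by (generalize (sin2_cos2 w); unfold Rsqr; lra).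
  assert (Key : turn_den a x y * (d + lam / msq a x) = sinh v).
  { unfold turn_den. fold w.
    replace (s * (- sin (phi a x s) * d)) with (- eta a x y * d) in Q1 by (rewrite <- Es; ring).
    replace (s * (cos (phi a x s) * d)) with (xi a x y * d) in Q2 by (rewrite <- Ec; ring).
    transitivity (sinh v * (sin w * sin w + cos w * cos w)); [|rewrite T; ring].
    assert (Z1 : - sin w * (- eta a x y * d) + cos w * (xi a x y * d) = - sin w * ((- (sinh v * sin w) + lam / msq a x * eta a x y) * 1 + cosh v * cos w * Yx) + cos w * ((sinh v * cos w - lam / msq a x * xi a x y) * 1 + cosh v * sin w * Yx)) by (rewrite Q1, Q2; ring).
    apply Rminus_diag_uniq. apply Rminus_diag_eq in Z1. rewrite <- Z1. ring. }
  destruct (turn_den_sign _ _ _ V) as [c [Pc Ecf]]. rewrite Ecf in Key.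
  destruct (iso_y_sign _ _ _ H) as [Y1 [Y2 _]]. destruct (h_im_sign _ _ _ V) as [v1 v2]. destruct (sinh_sign v) as [h1 h2].
  fold y in Y1, Y2. fold v in v1, v2.
  set (D' := d + lam / msq a x) in *.
  destruct (Rtotal_order s 0) as [K|[K|K]]; [|easy|].
  - assert (y < 0) by auto. assert (y * c < 0) by nra. assert (sinh v < 0) by auto. nra.
  - assert (0 < y) by auto. assert (0 < y * c) by nra. assert (0 < sinh v) by auto. nra.
Qed.

(** |Im h| increases away from the axis, so the speed along the slice, and with
    it each component of the mean velocity, is at most the speed at the end
    point. *)
Lemma rho_upper a x y : strip (a, x, y) -> rho a x y * rho a x y <= 2 * (y * y) * (cosh (h_im a x y) * cosh (h_im a x y)).
Proof.
  intros V. assert (D := h_im_slope). set (C := cosh (h_im a x y)).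
  assert (M : forall t, 0 < t < 1 -> Rabs (h_im a x (t * y)) <= Rabs (h_im a x y)).
  { intros t Ht. assert (Vt : strip (a, x, t * y)) by (apply star_strip; [easy|lra]).
    destruct (Rtotal_order y 0) as [K|[->|K]].
    - assert (A1 := proj2 (h_im_sign _ _ _ V) K).
      assert (A2 : h_im a x y < h_im a x (t * y)) by (apply (fibre_increasing strip h_im dh_re); try easy; [apply fibre_convex_strip|nra]).
      assert (A3 : h_im a x (t * y) < 0) by (apply h_im_sign; [easy|nra]).
      rewrite !Rabs_left; lra.
    - rewrite Rmult_0_r. lra.
    - assert (A1 := proj1 (h_im_sign _ _ _ V) K).
      assert (A2 : h_im a x (t * y) < h_im a x y) by (apply (fibre_increasing strip h_im dh_re); try easy; [apply fibre_convex_strip|nra]).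
      assert (A3 : 0 < h_im a x (t * y)) by (apply h_im_sign; [easy|nra]).
      rewrite !Rabs_right; lra. }
  assert (B : forall f, smooth3 sector f -> (forall t, 0 < t < 1 -> - C <= f a x (t * y) <= C) -> - C <= moment 0 f a x y <= C).
  { intros f Hf Hb. apply RInt_bounds; [|now apply ex_RInt_moment_strip]. intros t Ht. simpl. rewrite Rmult_1_l. now apply Hb. }
  assert (G : forall t z, 0 < t < 1 -> -1 <= z <= 1 -> - C <= cosh (h_im a x (t * y)) * z <= C).
  { intros t z Ht Hz. assert (K1 := cosh_abs_mono _ _ (M t Ht)). assert (K2 := cosh_ge_1 (h_im a x (t * y))). fold C in K1. nra. }
  assert (B1 : - C <= xi_mean a x y <= C) by (apply B; [apply smooth_vel_cos|]; intros; apply G; [easy|apply COS_bound]).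
  assert (B2 : - C <= eta_mean a x y <= C) by (apply B; [apply smooth_vel_sin|]; intros; apply G; [easy|apply SIN_bound]).
  unfold rho. replace (y * rho_mean a x y * (y * rho_mean a x y)) with (y * y * (rho_mean a x y * rho_mean a x y)) by ring. rewrite rho_mean_sq by easy.
  assert (0 <= y * y) by nra.
  replace (2 * (y * y) * (C * C)) with (y * y * (C * C + C * C)) by ring.
  apply Rmult_le_compat_l; [easy|]. nra.
Qed.

(** * Curvature of a reparametrized surface *)

Lemma partial_10 f x y l : is_derive (fun t => f t y) x l -> partial_derive 1 0 f x y = l.
Proof. intros H. apply (is_derive_unique _ _ _ H). Qed.
Lemma partial_01 f x y l : is_derive (fun t => f x t) y l -> partial_derive 0 1 f x y = l.
Proof. intros H. apply (is_derive_unique _ _ _ H). Qed.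

Definition slice (O : R3 -> Prop) (a : R) : R * R -> Prop := fun z => O (a, fst z, snd z).

Lemma open_slice O a : open O -> open (slice O a).
Proof. intros HO. apply (open_pre O (fun _ => a) fst snd HO); intros; cont_auto. Qed.

Lemma comp_derivs (V : R3 -> Prop) f fx fy (al be : R -> R -> R -> R) a p q alp alq bep beq :
  open V -> smooth3 V f ->
  partials V f fx fy ->
  V (a, al a p q, be a p q) ->
  is_derive (fun t => al a t q) p alp -> is_derive (fun t => al a p t) q alq ->
  is_derive (fun t => be a t q) p bep -> is_derive (fun t => be a p t) q beq ->
  is_derive (fun t => f a (al a t q) (be a t q)) p (fx a (al a p q) (be a p q) * alp + fy a (al a p q) (be a p q) * bep) /\
  is_derive (fun t => f a (al a p t) (be a p t)) q (fx a (al a p q) (be a p q) * alq + fy a (al a p q) (be a p q) * beq).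
Proof.
  intros HV Hf Hd Hp A1 A2 B1 B2.
  assert (Hfx : Ck 0 V fx) by (apply Ck_deriv_x with f; [easy|apply Hf|intros; now apply Hd]).
  assert (D := Ck_differentiable 0 V f fx fy _ _ _ HV Hp Hd Hfx).
  split.
  - now apply (chain2 (f a) (fun t => al a t q) (fun t => be a t q)).
  - now apply (chain2 (f a) (fun t => al a p t) (fun t => be a p t)).
Qed.

(** The second-order chain rule, needed because curvature has to be computed in
    charts other than the isothermal one. *)
Lemma comp_partials (V O : R3 -> Prop) f fx fy fxx fxy fyy (al be ap aq bp bq app apq aqq bpp bpq bqq : R -> R -> R -> R) (G : R -> R -> R) a p q :
  open V -> open O -> smooth3 V f ->
  partials V f fx fy ->
  partials V fx fxx fxy ->
  partials V fy fxy fyy ->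
  (forall a p q, O (a, p, q) -> V (a, al a p q, be a p q)) ->
  partials O al ap aq ->
  partials O be bp bq ->
  is_derive (fun t => ap a t q) p (app a p q) -> is_derive (fun t => aq a t q) p (apq a p q) -> is_derive (fun t => aq a p t) q (aqq a p q) ->
  is_derive (fun t => bp a t q) p (bpp a p q) -> is_derive (fun t => bq a t q) p (bpq a p q) -> is_derive (fun t => bq a p t) q (bqq a p q) ->
  (forall p q, slice O a (p, q) -> G p q = f a (al a p q) (be a p q)) -> O (a, p, q) ->
  let at_pt g := g a (al a p q) (be a p q) : R in let at0 g := g a p q : R in
  let snd_der (k l k' l' k2 l2 : R) := at_pt fxx * k * k' + at_pt fxy * (k * l' + k' * l) + at_pt fyy * l * l' + (at_pt fx * k2 + at_pt fy * l2) in
  partial_derive 1 0 G p q = at_pt fx * at0 ap + at_pt fy * at0 bp /\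
  partial_derive 0 1 G p q = at_pt fx * at0 aq + at_pt fy * at0 bq /\
  partial_derive 2 0 G p q = snd_der (at0 ap) (at0 bp) (at0 ap) (at0 bp) (at0 app) (at0 bpp) /\
  partial_derive 1 1 G p q = snd_der (at0 ap) (at0 bp) (at0 aq) (at0 bq) (at0 apq) (at0 bpq) /\
  partial_derive 0 2 G p q = snd_der (at0 aq) (at0 bq) (at0 aq) (at0 bq) (at0 aqq) (at0 bqq).
Proof.
  intros HV HO Hf Hd Hdx Hdy Hm Ha Hb Happ Hapq Haqq Hbpp Hbpq Hbqq HG Hp at_pt at0 snd_der.
  assert (Sx : smooth3 V fx) by (intros n; apply (Ck_deriv_x n V f fx HV (Hf _)); intros; now apply Hd).
  assert (Sy : smooth3 V fy) by (intros n; apply (Ck_deriv_y n V f fy HV (Hf _)); intros; now apply Hd).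
  assert (Os := open_slice O a HO).
  assert (D1 : forall p q, slice O a (p, q) ->
    is_derive (fun t => G t q) p (fx a (al a p q) (be a p q) * ap a p q + fy a (al a p q) (be a p q) * bp a p q) /\
    is_derive (fun t => G p t) q (fx a (al a p q) (be a p q) * aq a p q + fy a (al a p q) (be a p q) * bq a p q)).
  { intros p' q' H. destruct (Ha _ _ _ H), (Hb _ _ _ H).
    destruct (comp_derivs V f fx fy al be a p' q' _ _ _ _ HV Hf Hd (Hm _ _ _ H) H0 H1 H2 H3) as [K1 K2].
    split; (eapply is_derive_ext_loc; [|first [exact K1|exact K2]]).
    - generalize (open_slice_x O a p' q' HO H). apply filter_imp. intros t Ht. symmetry. now apply HG.
    - generalize (open_slice_y O a p' q' HO H). apply filter_imp. intros t Ht. symmetry. now apply HG. }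
  destruct (Ha _ _ _ Hp) as [A1 A2]. destruct (Hb _ _ _ Hp) as [B1 B2].
  destruct (comp_derivs V fx fxx fxy al be a p q _ _ _ _ HV Sx Hdx (Hm _ _ _ Hp) A1 A2 B1 B2) as [X1 X2].
  destruct (comp_derivs V fy fxy fyy al be a p q _ _ _ _ HV Sy Hdy (Hm _ _ _ Hp) A1 A2 B1 B2) as [Y1 Y2].
  assert (Nx : forall (g : R -> R -> R) l, (forall p q, slice O a (p, q) -> Derive (fun t => G t q) p = g p q) -> is_derive (fun t => g t q) p l -> partial_derive 2 0 G p q = l).
  { intros g l Hg Hl. etransitivity; [|apply (is_derive_unique _ _ _ Hl)]. apply Derive_ext_loc.
    generalize (open_slice_x O a p q HO Hp). apply filter_imp. intros t Ht. now apply Hg. }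
  assert (Ny : forall (g : R -> R -> R) l, (forall p q, slice O a (p, q) -> Derive (fun t => G p t) q = g p q) -> is_derive (fun t => g t q) p l -> partial_derive 1 1 G p q = l).
  { intros g l Hg Hl. etransitivity; [|apply (is_derive_unique _ _ _ Hl)]. apply Derive_ext_loc.
    generalize (open_slice_x O a p q HO Hp). apply filter_imp. intros t Ht. now apply Hg. }
  assert (Nz : forall (g : R -> R -> R) l, (forall p q, slice O a (p, q) -> Derive (fun t => G p t) q = g p q) -> is_derive (fun t => g p t) q l -> partial_derive 0 2 G p q = l).
  { intros g l Hg Hl. etransitivity; [|apply (is_derive_unique _ _ _ Hl)]. apply Derive_ext_loc.
    generalize (open_slice_y O a p q HO Hp). apply filter_imp. intros t Ht. now apply Hg. }
  split; [apply partial_10, (D1 _ _ Hp)|split; [apply partial_01, (D1 _ _ Hp)|split; [|split]]].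
  - eapply Nx; [intros p' q' H; apply is_derive_unique, (D1 _ _ H)|]. cbv beta. eapply is_derive_ext_val.
    + exact (is_derive_plus _ _ _ _ _ (is_derive_mult_R _ _ _ _ _ X1 Happ) (is_derive_mult_R _ _ _ _ _ Y1 Hbpp)).
    + to_R. unfold snd_der, at_pt, at0. ring.
  - eapply Ny; [intros p' q' H; apply is_derive_unique, (D1 _ _ H)|]. cbv beta. eapply is_derive_ext_val.
    + exact (is_derive_plus _ _ _ _ _ (is_derive_mult_R _ _ _ _ _ X1 Hapq) (is_derive_mult_R _ _ _ _ _ Y1 Hbpq)).
    + to_R. unfold snd_der, at_pt, at0. ring.
  - eapply Nz; [intros p' q' H; apply is_derive_unique, (D1 _ _ H)|]. cbv beta. eapply is_derive_ext_val.
    + exact (is_derive_plus _ _ _ _ _ (is_derive_mult_R _ _ _ _ _ X2 Haqq) (is_derive_mult_R _ _ _ _ _ Y2 Hbqq)).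
    + to_R. unfold snd_der, at_pt, at0. ring.
Qed.

(** The curvatures in an arbitrary chart (p, q), from the Jacobian and second
    derivatives of (x, y) in (p, q). Here c, s, C, S are cos, sin of Re h and
    cosh, sinh of Im h, and h' = P + i Q. In the coordinates (x, y) the first
    form is C^2 (dx^2 + dy^2) and the second form is the real quadratic form Q
    (dx^2 - dy^2) + 2 P dx dy, which is trace free and has entries of size |h'|.
    The terms with second derivatives of (x, y) are tangential and drop out. *)
Lemma curvature_algebra (F : R -> R -> R3) x y c s C S ap aq bp bq P Q app apq aqq bpp bpq bqq :
  s * s = 1 - c * c -> C * C = 1 + S * S -> 1 <= C ->
  ap * bq - aq * bp <> 0 ->
  let fst_der (k l : R) := (- (S * s) * k + C * c * l, S * c * k + C * s * l, 1 * k + 0 * l) in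
  let snd_der (k l k' l' k2 l2 : R) :=
    (- (C * Q * s + S * c * P) * k * k' + (S * Q * c - C * s * P) * (k * l' + k' * l) + (S * P * c + C * s * Q) * l * l' + (- (S * s) * k2 + C * c * l2),
     (C * Q * c - S * s * P) * k * k' + (S * Q * s + C * c * P) * (k * l' + k' * l) + (S * P * s - C * c * Q) * l * l' + (S * c * k2 + C * s * l2),
     0 * k * k' + 0 * (k * l' + k' * l) + 0 * l * l' + (1 * k2 + 0 * l2)) in
  pd 1 0 F x y = fst_der ap bp -> pd 0 1 F x y = fst_der aq bq ->
  pd 2 0 F x y = snd_der ap bp ap bp app bpp -> pd 1 1 F x y = snd_der ap bp aq bq apq bpq ->
  pd 0 2 F x y = snd_der aq bq aq bq aqq bqq ->
  normal_vec F x y <> (0, 0, 0) /\ mean_curvature F x y = 0 /\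
  normA2 F x y = 2 * (P * P + Q * Q) / C ^ 4.
Proof.
  intros Hs HC HC1 HJ fst_der snd_der E10 E01 E20 E11 E02. unfold fst_der, snd_der in *.
  set (J := ap * bq - aq * bp) in *.
  assert (EE : fffE F x y = C * C * (ap * ap + bp * bp)).
  { unfold fffE. rewrite E10. unfold dot, x1, x2, x3; simpl. ring [Hs HC]. }
  assert (EF : fffF F x y = C * C * (ap * aq + bp * bq)).
  { unfold fffF. rewrite E10, E01. unfold dot, x1, x2, x3; simpl. ring [Hs HC]. }
  assert (EG : fffG F x y = C * C * (aq * aq + bq * bq)).
  { unfold fffG. rewrite E01. unfold dot, x1, x2, x3; simpl. ring [Hs HC]. }
  assert (EN : normal_vec F x y = (- (J * C * s), J * C * c, - (J * (S * C)))).
  { unfold normal_vec. rewrite E10, E01. unfold cross, x1, x2, x3; simpl. unfold J.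
    f_equal; [f_equal|]; ring [Hs]. }
  set (e := enorm (normal_vec F x y)).
  assert (Ee2 : e * e = J * J * (C * C * C * C)).
  { unfold e, enorm. rewrite sqrt_sqrt.
    - rewrite EN. unfold dot, x1, x2, x3; simpl. ring [Hs HC].
    - unfold dot. assert (forall z, 0 <= z * z) by (intros; nra). repeat apply Rplus_le_le_0_compat; auto. }
  assert (Ee0 : 0 <= e) by apply sqrt_pos.
  assert (HJ2 : 0 < J * J) by nra.
  assert (HC4 : 0 < C * C * C * C) by (repeat apply Rmult_lt_0_compat; lra).
  assert (Ep : 0 < e) by nra.
  set (l := Q * (ap * ap - bp * bp) + 2 * P * (ap * bp)).
  set (mi := Q * (ap * aq - bp * bq) + P * (ap * bq + aq * bp)).
  set (r := Q * (aq * aq - bq * bq) + 2 * P * (aq * bq)).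
  set (k := J * (C * C) / e).
  assert (K2 : k * k = 1).
  { unfold k. replace (J * (C * C) / e * (J * (C * C) / e)) with (J * J * (C * C * C * C) / (e * e)) by (field; lra).
    rewrite Ee2. field. split; [lra|]. intros Z. rewrite Z in HJ2. lra. }
  assert (EL : sffL F x y = k * l).
  { unfold sffL. fold e. unfold k. unfold Rdiv. rewrite (Rmult_comm (J * (C * C))), Rmult_assoc, (Rmult_comm (/ e)). f_equal.
    rewrite E20, EN. unfold dot, x1, x2, x3, l;simpl. ring [Hs HC]. }
  assert (EM : sffM F x y = k * mi).
  { unfold sffM. fold e. unfold k. unfold Rdiv. rewrite (Rmult_comm (J * (C * C))), Rmult_assoc, (Rmult_comm (/ e)). f_equal.
    rewrite E11, EN. unfold dot, x1, x2, x3, mi;simpl. ring [Hs HC]. }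
  assert (ER : sffN F x y = k * r).
  { unfold sffN. fold e. unfold k. unfold Rdiv. rewrite (Rmult_comm (J * (C * C))), Rmult_assoc, (Rmult_comm (/ e)). f_equal.
    rewrite E02, EN. unfold dot, x1, x2, x3, r;simpl. ring [Hs HC]. }
  assert (ED : fffE F x y * fffG F x y - fffF F x y ^ 2 = C * C * C * C * (J * J)).
  { rewrite EE, EF, EG. unfold J. ring. }
  split; [|split].
  - intros Z. assert (e = 0); [|lra]. unfold e, enorm. rewrite Z. unfold dot, x1, x2, x3; simpl.
    replace (0 * 0 + 0 * 0 + 0 * 0) with 0 by ring. apply sqrt_0.
  - unfold mean_curvature, shape11, shape22. rewrite ED, EE, EF, EG, EL, EM, ER.
    replace (C * C * (aq * aq + bq * bq) * (k * l) - C * C * (ap * aq + bp * bq) * (k * mi))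
      with (- (C * C * (ap * ap + bp * bp) * (k * r) - C * C * (ap * aq + bp * bq) * (k * mi))) by (unfold l, mi, r; ring).
    field. split; [intros ->; lra|lra].
  - unfold normA2, shape11, shape12, shape21, shape22. rewrite ED, EE, EF, EG, EL, EM, ER.
    assert (HJ' : J <> 0) by (intros Z; rewrite Z in HJ2; lra).
    set (s11 := ((aq * aq + bq * bq) * l - (ap * aq + bp * bq) * mi)).
    set (s12 := ((aq * aq + bq * bq) * mi - (ap * aq + bp * bq) * r)).
    set (s21 := ((ap * ap + bp * bp) * mi - (ap * aq + bp * bq) * l)).
    set (s22 := ((ap * ap + bp * bp) * r - (ap * aq + bp * bq) * mi)).
    transitivity ((k * k) * (s11 * s11 + 2 * (s12 * s21) + s22 * s22) / ((C * C * (J * J)) * (C * C * (J * J)))).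
    { unfold s11, s12, s21, s22. field. split; [easy|lra]. }
    rewrite K2.
    replace (s11 * s11 + 2 * (s12 * s21) + s22 * s22) with (2 * (P * P + Q * Q) * (J * J * (J * J))).
    + field. split; lra.
    + unfold s11, s12, s21, s22, l, mi, r, J. ring.
Qed.

(** * A choice U of Re h on the axis, which the equation determines only up to a constant for each a.  Minimality and embeddedness hold for every such U, so the disks and their limits can be treated together although their normalizations differ. *)

(** A choice U of Re h on the axis, which the equation determines only up to a
    constant for each a. Minimality and embeddedness hold for every such U, so
    the disks and their limits can be treated together although their
    normalizations differ. *)
Definition axis_angle (DU : R -> R -> Prop) (U : R -> R -> R) : Prop :=
  open (fun p : R3 => DU (x1 p) (x2 p)) /\
  (forall a x, DU a x -> base a x) /\
  smooth3 (fun p : R3 => DU (x1 p) (x2 p)) (fun a x _ => U a x) /\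
  (forall a x, DU a x -> is_derive (fun t => U a t) x (lam / msq a x)).

Definition Dom (DU : R -> R -> Prop) (p : R3) : Prop := DU (x1 p) (x2 p) /\ -2 < x3 p < 2.

Definition theta (U : R -> R -> R) (a x s : R) : R := U a x + phi a x s.

Definition surface_pt (U : R -> R -> R) (a x s : R) : R3 :=
  (s * cos (theta U a x s), s * sin (theta U a x s), x).

Lemma Dom_Box DU U p : axis_angle DU U -> Dom DU p -> Box p.
Proof. intros [_ [H _]] [H1 H2]. split; [now apply H|easy]. Qed.

Lemma open_Dom DU U : axis_angle DU U -> open (Dom DU).
Proof. intros [H _]. unfold Dom. apply open_and; [exact H|open_auto]. Qed.

Lemma smooth_theta DU U : axis_angle DU U -> smooth3 (Dom DU) (theta U).
Proof.
  intros HU n. apply (Ck_plus n (Dom DU) (fun a x _ => U a x)).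
  - destruct HU as [_ [_ [H _]]]. apply (Ck_sub n (fun p : R3 => DU (x1 p) (x2 p))); [intros p Hp; apply Hp|apply H].
  - apply (Ck_sub n Box); [intros p; now apply Dom_Box with U|apply smooth_phi].
Qed.

(** U contributes lam / [msq] to the derivative, which is what [phi_x] needs. *)
Lemma theta_x DU U a x s : axis_angle DU U -> Dom DU (a, x, s) -> s <> 0 ->
  exists d, is_derive (fun t => theta U a t s) x d /\ 0 < d.
Proof.
  intros HU H Hs. destruct (phi_x a x s) as [d [Hd P]]; [now apply (Dom_Box DU U)|easy|].
  exists (lam / msq a x + d). split; [|lra].
  apply (is_derive_plus (fun t => U a t) (fun t => phi a t s)); [|easy]. apply HU. apply H.
Qed.

(** The point of the slice back in the fixed frame, in isothermal coordinates. *)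
Definition iso1 (U : R -> R -> R) (a x y : R) : R := xi a x y * cos (U a x) - eta a x y * sin (U a x).
Definition iso2 (U : R -> R -> R) (a x y : R) : R := xi a x y * sin (U a x) + eta a x y * cos (U a x).

Lemma surface_pt_iso U a x s : Box (a, x, s) -> surface_pt U a x s = (iso1 U a x (iso_y a x s), iso2 U a x (iso_y a x s), x).
Proof.
  intros H. destruct (phi_polar _ _ _ H) as [E1 E2]. unfold surface_pt, iso1, iso2, theta.
  rewrite <- E1, <- E2, cos_plus, sin_plus. f_equal. f_equal; ring.
Qed.

Definition strip_dom (DU : R -> R -> Prop) (p : R3) : Prop := strip p /\ DU (x1 p) (x2 p).

Lemma open_strip_dom DU U : axis_angle DU U -> open (strip_dom DU).
Proof. intros H. apply open_and; [apply open_strip|apply H]. Qed.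

Lemma smooth_strip_dom DU U f : axis_angle DU U -> smooth3 sector f -> smooth3 (strip_dom DU) f.
Proof. intros HU H n. apply (Ck_sub n sector); [intros p [Hp _]; now apply strip_sector'|apply H]. Qed.

Lemma smooth_U_strip_dom DU U : axis_angle DU U -> smooth3 (strip_dom DU) (fun a x _ => U a x).
Proof. intros [_ [_ [H _]]] n. apply (Ck_sub n (fun p : R3 => DU (x1 p) (x2 p))); [intros p Hp; apply Hp|apply H]. Qed.

Lemma smooth_iso DU U : axis_angle DU U -> smooth3 (strip_dom DU) (iso1 U) /\ smooth3 (strip_dom DU) (iso2 U).
Proof.
  intros HU. assert (O := open_strip_dom _ _ HU). assert (S := smooth_U_strip_dom _ _ HU).
  assert (S1 := smooth_strip_dom _ _ _ HU smooth_xi). assert (S2 := smooth_strip_dom _ _ _ HU smooth_eta).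
  split; intros n; [unfold iso1|unfold iso2]; Ck_auto.
Qed.

(** The rotation of the frame cancels the extra terms of [xi_x] and [eta_x],
    leaving the derivatives of the conformal immersion with data (h, dz). *)
Lemma iso_derivs DU U a x y : axis_angle DU U -> strip_dom DU (a, x, y) ->
  let u := U a x + h_re a x y in let v := h_im a x y in
  is_derive (fun t => iso1 U a t y) x (- (sinh v * sin u)) /\
  is_derive (fun t => iso1 U a x t) y (cosh v * cos u) /\
  is_derive (fun t => iso2 U a t y) x (sinh v * cos u) /\
  is_derive (fun t => iso2 U a x t) y (cosh v * sin u).
Proof.
  intros HU [V HD] u v. assert (V' := strip_sector _ _ _ V).
  assert (DUx := proj2 (proj2 (proj2 HU)) a x HD).
  assert (Dc := is_derive_comp_R cos (fun t => U a t) x _ _ (is_derive_cos _) DUx).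
  assert (Ds := is_derive_comp_R sin (fun t => U a t) x _ _ (is_derive_sin _) DUx).
  assert (Sx := xi_x _ _ _ V'). assert (Sy := xi_y _ _ _ V'). assert (Tx := eta_x _ _ _ V'). assert (Ty := eta_y _ _ _ V').
  unfold u. rewrite cos_plus, sin_plus. unfold v. split; [|split; [|split]].
  - eapply is_derive_ext_val.
    + exact (is_derive_minus _ _ _ _ _ (is_derive_mult_R _ _ _ _ _ Sx Dc) (is_derive_mult_R _ _ _ _ _ Tx Ds)).
    + unfold minus. to_R. ring.
  - eapply is_derive_ext_val.
    + exact (is_derive_minus _ _ _ _ _ (is_derive_mult_R _ _ _ _ _ Sy (is_derive_const (cos (U a x)) y)) (is_derive_mult_R _ _ _ _ _ Ty (is_derive_const (sin (U a x)) y))).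
    + unfold minus. to_R. ring.
  - eapply is_derive_ext_val.
    + exact (is_derive_plus _ _ _ _ _ (is_derive_mult_R _ _ _ _ _ Sx Ds) (is_derive_mult_R _ _ _ _ _ Tx Dc)).
    + to_R. ring.
  - eapply is_derive_ext_val.
    + exact (is_derive_plus _ _ _ _ _ (is_derive_mult_R _ _ _ _ _ Sy (is_derive_const (sin (U a x)) y)) (is_derive_mult_R _ _ _ _ _ Ty (is_derive_const (cos (U a x)) y))).
    + to_R. ring.
Qed.

Lemma u_derivs DU U a x y : axis_angle DU U -> strip_dom DU (a, x, y) ->
  is_derive (fun t => U a t + h_re a t y) x (dh_re a x y) /\ is_derive (fun t => U a x + h_re a x t) y (- dh_im a x y).
Proof.
  intros HU [V H]. assert (V' := strip_sector _ _ _ V). split; eapply is_derive_ext_val.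
  - exact (is_derive_plus _ _ _ _ _ (proj2 (proj2 (proj2 HU)) a x H) (h_re_x _ _ _ V')).
  - to_R. ring.
  - exact (is_derive_plus _ _ _ _ _ (is_derive_const (U a x) y) (h_re_y _ _ _ V')).
  - to_R. ring.
Qed.

Lemma iso_derivs2 DU U a x y : axis_angle DU U -> strip_dom DU (a, x, y) ->
  let u a x y := U a x + h_re a x y in
  let s := sin (u a x y) in let c := cos (u a x y) in let S := sinh (h_im a x y) in let C := cosh (h_im a x y) in
  let P := dh_re a x y in let Q := dh_im a x y in
  (is_derive (fun t => - (sinh (h_im a t y) * sin (u a t y))) x (- (C * Q * s + S * c * P)) /\
   is_derive (fun t => - (sinh (h_im a x t) * sin (u a x t))) y (S * Q * c - C * s * P)) /\
  (is_derive (fun t => cosh (h_im a t y) * cos (u a t y)) x (S * Q * c - C * s * P) /\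
   is_derive (fun t => cosh (h_im a x t) * cos (u a x t)) y (S * P * c + C * s * Q)) /\
  (is_derive (fun t => sinh (h_im a t y) * cos (u a t y)) x (C * Q * c - S * s * P) /\
   is_derive (fun t => sinh (h_im a x t) * cos (u a x t)) y (S * Q * s + C * c * P)) /\
  (is_derive (fun t => cosh (h_im a t y) * sin (u a t y)) x (S * Q * s + C * c * P) /\
   is_derive (fun t => cosh (h_im a x t) * sin (u a x t)) y (S * P * s - C * c * Q)).
Proof.
  intros HU H u. assert (V' := strip_sector _ _ _ (proj1 H)). destruct (u_derivs _ _ _ _ _ HU H) as [Ux Uy].
  assert (Vx := h_im_x _ _ _ V'). assert (Vy := h_im_y _ _ _ V').
  assert (L : forall (f df g dg uu w : R -> R) t u' w', (forall z, is_derive f z (df z)) -> (forall z, is_derive g z (dg z)) ->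
    is_derive uu t u' -> is_derive w t w' -> is_derive (fun t => f (w t) * g (uu t)) t (df (w t) * w' * g (uu t) + f (w t) * (dg (uu t) * u'))).
  { intros f df g dg uu w t u' w' Hf Hg Hu Hw.
    apply (is_derive_mult_R (fun t => f (w t)) (fun t => g (uu t))); now apply is_derive_comp_R. }
  assert (L' := fun f df g dg uu w t u' w' H1 H2 H3 H4 => is_derive_opp _ _ _ (L f df g dg uu w t u' w' H1 H2 H3 H4)).
  split; [|split; [|split]]; split; eapply is_derive_ext_val.
  1: exact (L' sinh cosh sin cos _ _ _ _ _ is_derive_sinh is_derive_sin Ux Vx). 2: exact (L' sinh cosh sin cos _ _ _ _ _ is_derive_sinh is_derive_sin Uy Vy).
  3: exact (L cosh sinh cos (fun z => - sin z) _ _ _ _ _ is_derive_cosh is_derive_cos Ux Vx). 4: exact (L cosh sinh cos (fun z => - sin z) _ _ _ _ _ is_derive_cosh is_derive_cos Uy Vy).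
  5: exact (L sinh cosh cos (fun z => - sin z) _ _ _ _ _ is_derive_sinh is_derive_cos Ux Vx). 6: exact (L sinh cosh cos (fun z => - sin z) _ _ _ _ _ is_derive_sinh is_derive_cos Uy Vy).
  7: exact (L cosh sinh sin cos _ _ _ _ _ is_derive_cosh is_derive_sin Ux Vx). 8: exact (L cosh sinh sin cos _ _ _ _ _ is_derive_cosh is_derive_sin Uy Vy).
  all: to_R; unfold u; ring.
Qed.

Lemma cosh_sq v : cosh v * cosh v = 1 + sinh v * sinh v.
Proof.
  unfold cosh, sinh. assert (E : exp v * exp (- v) = 1) by (rewrite <- exp_plus; replace (v + - v) with 0 by ring; apply exp_0).
  transitivity ((exp v - exp (- v)) / 2 * ((exp v - exp (- v)) / 2) + exp v * exp (- v)); [field|rewrite E; ring].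
Qed.

(** The surface in a chart (p, q) of the (x, s) plane. The disks need only the
    identity; the limits use charts from a disk onto a half disk. *)
Definition chart (U : R -> R -> R) (al ga : R -> R -> R -> R) (a p q : R) : R3 := surface_pt U a (al a p q) (ga a p q).

Lemma chart_smooth DU U O al ga : axis_angle DU U -> open O -> smooth3 O al -> smooth3 O ga ->
  (forall a p q, O (a, p, q) -> Dom DU (a, al a p q, ga a p q)) ->
  smooth3 O (fun a p q => x1 (chart U al ga a p q)) /\ smooth3 O (fun a p q => x2 (chart U al ga a p q)) /\
  smooth3 O (fun a p q => x3 (chart U al ga a p q)).
Proof.
  intros HU HO Hal Hga HD.
  assert (T : smooth3 O (fun a p q => theta U a (al a p q) (ga a p q))).
  { intros n. apply (Ck_comp n O (Dom DU) (theta U) al ga); auto; [now apply open_Dom with U|now apply smooth_theta with (1 := HU)]. }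
  unfold chart, surface_pt, x1, x2, x3; simpl. split; [|split]; intros n; Ck_auto.
Qed.

(** [curvature_algebra] for the surfaces at hand; the Jacobian of (x, y) in (p,
    q) is that of (x, s) times the positive derivative of y in s. *)
Lemma chart_curvature (DU : R -> R -> Prop) (U : R -> R -> R) (O : R3 -> Prop) (al ga : R -> R -> R -> R) (a p q alp alq gap gaq : R) :
  axis_angle DU U -> open O -> smooth3 O al -> smooth3 O ga ->
  (forall a p q, O (a, p, q) -> Dom DU (a, al a p q, ga a p q)) ->
  O (a, p, q) ->
  is_derive (fun t => al a t q) p alp -> is_derive (fun t => al a p t) q alq ->
  is_derive (fun t => ga a t q) p gap -> is_derive (fun t => ga a p t) q gaq ->
  alp * gaq - alq * gap <> 0 ->
  let F := chart U al ga a in let x := al a p q in let y := iso_y a x (ga a p q) in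
  normal_vec F p q <> (0, 0, 0) /\ mean_curvature F p q = 0 /\
  normA2 F p q = 2 * (dh_re a x y * dh_re a x y + dh_im a x y * dh_im a x y) / cosh (h_im a x y) ^ 4.
Proof.
  intros HU HO Sal Sga HD Hp Dap Daq Dgp Dgq HJ F x y.
  set (be := fun a p q => iso_y a (al a p q) (ga a p q)).
  assert (HB : forall a p q, O (a, p, q) -> Box (a, al a p q, ga a p q)) by (intros; now apply (Dom_Box DU U), HD).
  assert (HV : forall a p q, O (a, p, q) -> strip_dom DU (a, al a p q, be a p q)).
  { intros a' p' q' H. split; [apply iso_y_spec; now apply HB|]. apply (HD _ _ _ H). }
  assert (Sbe : smooth3 O be).
  { intros n. apply (Ck_comp n O Box iso_y al ga); auto; [apply open_Box|apply smooth_iso_y]. }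
  destruct (Sal 2%nat) as [_ [ap [aq [Da [[_ [app [apq [Dap2 _]]]] [_ [aqp [aqq [Daq2 _]]]]]]]]].
  destruct (Sbe 2%nat) as [_ [bp [bq [Db [[_ [bpp [bpq [Dbp2 _]]]] [_ [bqp [bqq [Dbq2 _]]]]]]]]].
  destruct (iso_y_derivs _ _ _ (HB _ _ _ Hp)) as [Yx [Ys [DYx [DYs PYs]]]].
  assert (EJ : ap a p q * bq a p q - aq a p q * bp a p q = Ys * (alp * gaq - alq * gap)).
  { destruct (smooth_iso_y 1%nat) as [_ [yx [ys [Dy _]]]].
    destruct (comp_derivs Box iso_y yx ys al ga a p q alp alq gap gaq open_Box smooth_iso_y Dy (HB _ _ _ Hp) Dap Daq Dgp Dgq) as [K1 K2].
    assert (ap a p q = alp) as -> by (rewrite <- (is_derive_unique _ _ _ Dap); symmetry; apply is_derive_unique, Da, Hp).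
    assert (aq a p q = alq) as -> by (rewrite <- (is_derive_unique _ _ _ Daq); symmetry; apply is_derive_unique, Da, Hp).
    assert (E1 : bp a p q = yx a (al a p q) (ga a p q) * alp + ys a (al a p q) (ga a p q) * gap).
    { rewrite <- (is_derive_unique _ _ _ K1). symmetry. apply is_derive_unique, Db, Hp. }
    assert (E2 : bq a p q = yx a (al a p q) (ga a p q) * alq + ys a (al a p q) (ga a p q) * gaq).
    { rewrite <- (is_derive_unique _ _ _ K2). symmetry. apply is_derive_unique, Db, Hp. }
    assert (E3 : ys a (al a p q) (ga a p q) = Ys).
    { rewrite <- (is_derive_unique _ _ _ DYs). symmetry. apply is_derive_unique, Dy, HB, Hp. }
    rewrite E1, E2, E3. ring. }
  set (b := be a p q). set (u := U a x + h_re a x b). set (v := h_im a x b).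
  assert (VO := open_strip_dom _ _ HU). destruct (smooth_iso _ _ HU) as [SX1 SX2].
  destruct (comp_partials (strip_dom DU) O (iso1 U) (fun a x y => - (sinh (h_im a x y) * sin (U a x + h_re a x y))) (fun a x y => cosh (h_im a x y) * cos (U a x + h_re a x y))
    _ _ _ al be ap aq bp bq app aqp aqq bpp bqp bqq (coord1 F) a p q VO HO SX1
    (fun a x y H => conj (proj1 (iso_derivs _ _ a x y HU H)) (proj1 (proj2 (iso_derivs _ _ a x y HU H))))
    (fun a x y H => proj1 (iso_derivs2 _ _ a x y HU H)) (fun a x y H => proj1 (proj2 (iso_derivs2 _ _ a x y HU H)))
    HV Da Db (proj1 (Dap2 _ _ _ Hp)) (proj1 (Daq2 _ _ _ Hp)) (proj2 (Daq2 _ _ _ Hp)) (proj1 (Dbp2 _ _ _ Hp)) (proj1 (Dbq2 _ _ _ Hp)) (proj2 (Dbq2 _ _ _ Hp)))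
    as [X10 [X01 [X20 [X11 X02]]]]; [|exact Hp|].
  { intros p' q' H. unfold coord1, F, chart. now rewrite surface_pt_iso by now apply HB. }
  destruct (comp_partials (strip_dom DU) O (iso2 U) (fun a x y => sinh (h_im a x y) * cos (U a x + h_re a x y)) (fun a x y => cosh (h_im a x y) * sin (U a x + h_re a x y))
    _ _ _ al be ap aq bp bq app aqp aqq bpp bqp bqq (coord2 F) a p q VO HO SX2
    (fun a x y H => proj2 (proj2 (iso_derivs _ _ a x y HU H)))
    (fun a x y H => proj1 (proj2 (proj2 (iso_derivs2 _ _ a x y HU H)))) (fun a x y H => proj2 (proj2 (proj2 (iso_derivs2 _ _ a x y HU H))))
    HV Da Db (proj1 (Dap2 _ _ _ Hp)) (proj1 (Daq2 _ _ _ Hp)) (proj2 (Daq2 _ _ _ Hp)) (proj1 (Dbp2 _ _ _ Hp)) (proj1 (Dbq2 _ _ _ Hp)) (proj2 (Dbq2 _ _ _ Hp)))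
    as [Y10 [Y01 [Y20 [Y11 Y02]]]]; [|exact Hp|].
  { intros p' q' H. unfold coord2, F, chart. now rewrite surface_pt_iso by now apply HB. }
  destruct (comp_partials (strip_dom DU) O (fun _ x _ => x) (fun _ _ _ => 1) (fun _ _ _ => 0)
    (fun _ _ _ => 0) (fun _ _ _ => 0) (fun _ _ _ => 0) al be ap aq bp bq app aqp aqq bpp bqp bqq (coord3 F) a p q VO HO (fun n => Ck_x n _)
    (fun a x y H => conj (is_derive_id x) (is_derive_const x y))
    (fun a x y H => conj (is_derive_const 1 x) (is_derive_const 1 y)) (fun a x y H => conj (is_derive_const 0 x) (is_derive_const 0 y))
    HV Da Db (proj1 (Dap2 _ _ _ Hp)) (proj1 (Daq2 _ _ _ Hp)) (proj2 (Daq2 _ _ _ Hp)) (proj1 (Dbp2 _ _ _ Hp)) (proj1 (Dbq2 _ _ _ Hp)) (proj2 (Dbq2 _ _ _ Hp)))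
    as [Z10 [Z01 [Z20 [Z11 Z02]]]]; [easy|exact Hp|].
  apply (curvature_algebra F p q (cos u) (sin u) (cosh v) (sinh v) (ap a p q) (aq a p q) (bp a p q) (bq a p q) (dh_re a x b) (dh_im a x b)
    (app a p q) (aqp a p q) (aqq a p q) (bpp a p q) (bqp a p q) (bqq a p q)).
  - generalize (sin2_cos2 u). unfold Rsqr. lra.
  - apply cosh_sq.
  - apply cosh_ge_1.
  - rewrite EJ. intros Z. apply Rmult_integral in Z. lra.
  - unfold pd. now rewrite X10, Y10, Z10.
  - unfold pd. now rewrite X01, Y01, Z01.
  - unfold pd. now rewrite X20, Y20, Z20.
  - unfold pd. now rewrite X11, Y11, Z11.
  - unfold pd. now rewrite X02, Y02, Z02.
Qed.

(** * Two normalizations of the angle *)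

Definition Dmain (a x : R) : Prop := base a x /\ 0 < a.
(** Normalized by U(0) = 0 on the axis; it is singular as a -> 0, on both sides
    of x = 0. *)
Definition Umain (a x : R) : R := lam / a * atan (x / a).

Lemma axis_angle_main : axis_angle Dmain Umain.
Proof.
  assert (O : open (fun p : R3 => Dmain (x1 p) (x2 p))) by (unfold Dmain; apply open_and; [apply open_base|open_auto]).
  split; [exact O|split; [|split]].
  - intros a x [H _]. exact H.
  - intros n. assert (NZ : forall a x y : R, Dmain (x1 (a, x, y)) (x2 (a, x, y)) -> a <> 0).
    { intros a x y [_ H]. unfold x1 in H; simpl in H. lra. }
    unfold Umain. Ck_auto; exact NZ.
  - intros a x [_ Ha]. unfold Umain.
    eapply is_derive_ext_val.
    + apply (is_derive_scal (fun t => atan (t / a))). apply (is_derive_comp_R atan (fun t => t / a)).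
      * apply is_derive_Reals, derivable_pt_lim_atan.
      * auto_derive; [easy|reflexivity].
    + assert (0 < a * a) by nra. assert (0 <= x * x) by nra. to_R. unfold msq. field. repeat split; lra.
Qed.

Definition recip_re (_ x y : R) : R := x / (x * x + y * y).
(** The integral equals - (lam / a) atan (a / x), and it extends smoothly
    through a = 0. The roles of variable and parameter are exchanged: [moment]
    integrates here over the segment from 0 to a, so that the factor 1 / a
    disappears. *)
Definition Ulim (a x : R) : R := - lam * moment 0 recip_re 0 x a.
Definition off_zero (p : R3) : Prop := x2 p * x2 p > 0.

Lemma open_off_zero : open off_zero.
Proof. unfold off_zero, Rgt. open_auto. Qed.
Lemma star_off_zero : star off_zero.
Proof. intros a x y t H _. exact H. Qed.
Lemma smooth_recip_re : smooth3 off_zero recip_re.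
Proof.
  assert (O := open_off_zero). intros n. unfold recip_re. Ck_auto. intros a x y H. unfold off_zero, x2 in H; simpl in H. nra.
Qed.

(** The side e x > 0 of the plane, with e = 1 or e = -1. A single sign e treats
    both limit disks at once. *)
Definition Dlim (e a x : R) : Prop := base a x /\ 0 < e * x.

Lemma Ulim_x0 x a : x <> 0 -> is_derive (fun t => moment 0 recip_re 0 t a) x (- / (x * x + a * a)).
Proof.
  intros Hx. assert (Hp : off_zero (0, x, a)) by (unfold off_zero, x2; simpl; nra).
  set (hx := fun (_ x y : R) => (y * y - x * x) / ((x * x + y * y) * (x * x + y * y))).
  assert (Dx : forall a x y, off_zero (a, x, y) -> is_derive (fun t => recip_re a t y) x (hx a x y)).
  { intros a' x' y' H. unfold off_zero, x2 in H; simpl in H. assert (x' * x' + y' * y' <> 0) by nra. unfold recip_re, hx. auto_derive; [easy|]. field. easy. }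
  assert (Shx : smooth3 off_zero hx) by (intros n; apply (Ck_deriv_x n off_zero recip_re hx open_off_zero (smooth_recip_re _) Dx)).
  assert (P : is_derive (fun t => moment 0 recip_re 0 t a) x (moment 0 hx 0 x a)).
  { destruct (smooth_recip_re 1%nat) as [Hc [gx [fy [Hd' [_ Hy]]]]].
    refine (proj1 (moment_deriv 0 off_zero recip_re hx fy open_off_zero star_off_zero Hc _ _ _ 0 x a Hp)).
    - intros; now apply (cont_of_smooth off_zero).
    - intros; now apply (Ck_cont 0 off_zero).
    - intros; split; [now apply Dx|now apply Hd']. }
  eapply is_derive_ext_val; [exact P|].
  destruct (Req_dec a 0) as [->|Ha].
  - unfold moment. replace (- / (x * x + 0 * 0)) with (RInt (fun _ => - / (x * x + 0 * 0)) 0 1) by (rewrite RInt_const; to_R; ring).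
    apply RInt_ext. intros t _. unfold hx. to_R. field. easy.
  - assert (K : prim hx 0 x a = - a / (x * x + a * a) - - 0 / (x * x + 0 * 0)).
    { apply (prim_primitive off_zero (fun _ x y => - y / (x * x + y * y)) hx 0 x a star_off_zero Hp).
      - intros; now apply (cont_of_smooth off_zero).
      - intros a' x' y' H. unfold off_zero, x2 in H; simpl in H. assert (x' * x' + y' * y' <> 0) by nra. unfold hx. auto_derive; [easy|]. field. easy. }
    unfold prim in K. apply Rmult_eq_reg_l with a; [|easy]. rewrite K. assert (0 < x * x) by nra. assert (0 < a * a) by nra. field. repeat split; first [easy|nra].
Qed.

Lemma axis_angle_limit e : axis_angle (Dlim e) Ulim.
Proof.
  assert (NZ : forall a x, Dlim e a x -> x <> 0) by (intros a x [_ H] ->; lra).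
  split; [|split; [|split]].
  - unfold Dlim. apply open_and; [apply open_base|open_auto].
  - intros a x [H _]. exact H.
  - intros n. apply (Ck_mult n _ (fun _ _ _ => - lam) (fun a x _ => moment 0 recip_re 0 x a)); [apply Ck_const|].
    assert (G : Ck n off_zero (moment 0 recip_re)) by (apply Ck_moment; [apply open_off_zero|apply star_off_zero|apply smooth_recip_re]).
    apply (Ck_comp n _ off_zero (fun b x y => moment 0 recip_re b x y) (fun _ x _ => x) (fun a _ _ => a) open_off_zero G); [apply Ck_x|apply Ck_a|].
    intros a x y H. apply NZ in H. unfold off_zero, x2 in *; simpl in *. nra.
  - intros a x H. unfold Ulim. eapply is_derive_ext_val.
    + apply (is_derive_scal (fun t => moment 0 recip_re 0 t a)). apply Ulim_x0. now apply NZ with a.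
    + assert (0 < msq a x) by apply (proj1 H). to_R. unfold msq in *. field. lra.
Qed.

Lemma Ulim_0 x : x <> 0 -> Ulim 0 x = - lam / x.
Proof.
  intros Hx. unfold Ulim, moment. replace (RInt (fun t => t ^ 0 * recip_re 0 x (t * 0)) 0 1) with (/ x); [field; easy|].
  replace (/ x) with (RInt (fun _ => / x) 0 1) by (rewrite RInt_const; to_R; ring).
  apply RInt_ext. intros t _. unfold recip_re. to_R. field. easy.
Qed.

(** From atan t + atan (1 / t) = pi / 2 for t > 0, and its opposite for t < 0. *)
Lemma Umain_Ulim a x : 0 < a -> x <> 0 -> Umain a x = (if Rlt_dec 0 x then 1 else -1) * (lam / a * (PI / 2)) + Ulim a x.
Proof.
  intros Ha Hx.
  assert (K : prim recip_re 0 x a = atan (a / x) - atan (0 / x)).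
  { apply (prim_primitive off_zero (fun _ x y => atan (y / x)) recip_re 0 x a star_off_zero).
    - unfold off_zero, x2; simpl; nra.
    - intros; apply (cont_of_smooth off_zero); [apply smooth_recip_re|easy].
    - intros a' x' y' H. unfold off_zero, x2 in H; simpl in H. assert (x' <> 0) by nra.
      eapply is_derive_ext_val.
      + apply (is_derive_comp_R atan (fun t => t / x')); [apply is_derive_Reals, derivable_pt_lim_atan|auto_derive; [easy|reflexivity]].
      + assert (0 <= y' * y') by nra. unfold recip_re. to_R. field. repeat split; first [easy|nra]. }
  replace (0 / x) with 0 in K by (field; easy). rewrite atan_0 in K. unfold prim in K.
  assert (E : moment 0 recip_re 0 x a = atan (a / x) / a) by (apply Rmult_eq_reg_l with a; [rewrite K; field|]; lra).
  unfold Umain, Ulim. rewrite E.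
  destruct (Rlt_dec 0 x) as [P|P].
  - replace (x / a) with (/ (a / x)) by (field; lra). rewrite atan_inv; [field; lra|]. now apply Rdiv_lt_0_compat.
  - replace (x / a) with (- / (a / - x)) by (field; lra). rewrite atan_opp, atan_inv; [|apply Rdiv_lt_0_compat; lra].
    replace (a / - x) with (- (a / x)) by (field; lra). rewrite atan_opp. field. lra.
Qed.

Lemma Umain_Ulim_cos a x (k : nat) : 0 < a -> x <> 0 -> lam / a * (PI / 2) = 2 * INR k * PI ->
  forall f, cos (Umain a x + f) = cos (Ulim a x + f) /\ sin (Umain a x + f) = sin (Ulim a x + f).
Proof.
  intros Ha Hx Hk f. rewrite (Umain_Ulim a x Ha Hx), Hk. destruct (Rlt_dec 0 x).
  - replace (1 * (2 * INR k * PI) + Ulim a x + f) with ((Ulim a x + f) + 2 * INR k * PI) by ring.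
    split; [apply cos_period|apply sin_period].
  - rewrite <- (cos_period (-1 * (2 * INR k * PI) + Ulim a x + f) k), <- (sin_period (-1 * (2 * INR k * PI) + Ulim a x + f) k).
    replace (-1 * (2 * INR k * PI) + Ulim a x + f + 2 * INR k * PI) with (Ulim a x + f) by ring. easy.
Qed.

(** * Injectivity and embeddings *)

(** A function on R^3 that tells the sign of s on the surface: the pairing with
    the direction in which the slice leaves the axis. *)
Definition side (U : R -> R -> R) (a : R) (p : R3) : R := x1 p * cos (U a (x3 p)) + x2 p * sin (U a (x3 p)).
Definition rad (p : R3) : R := sqrt (x1 p * x1 p + x2 p * x2 p).

Lemma cos_phi_pos a x s : 0 < cos (phi a x s).
Proof. destruct (phi_bound a x s). apply cos_gt_0; lra. Qed.

Lemma side_surface_pt U a x s : side U a (surface_pt U a x s) = s * cos (phi a x s).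
Proof.
  unfold side, surface_pt, theta, x1, x2, x3; simpl. rewrite cos_plus, sin_plus.
  assert (T := sin2_cos2 (U a x)). unfold Rsqr in T.
  transitivity (s * cos (phi a x s) * (sin (U a x) * sin (U a x) + cos (U a x) * cos (U a x))); [ring|rewrite T; ring].
Qed.

Lemma rad_surface_pt U a x s : rad (surface_pt U a x s) = Rabs s.
Proof.
  unfold rad, surface_pt, x1, x2, x3; simpl.
  replace (_ + _) with (Rsqr s * (Rsqr (sin (theta U a x s)) + Rsqr (cos (theta U a x s)))) by (unfold Rsqr; ring).
  rewrite sin2_cos2, Rmult_1_r. apply sqrt_Rsqr_abs.
Qed.

(** The height gives x, the distance to the axis gives |s|, and [side] gives the
    sign of s. *)
Lemma surface_pt_inj U a x s x' s' : surface_pt U a x s = surface_pt U a x' s' -> x = x' /\ s = s'.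
Proof.
  intros E. assert (Ex : x = x') by (apply (f_equal x3) in E; exact E). subst x'. split; [easy|].
  assert (K1 := f_equal (side U a) E). rewrite !side_surface_pt in K1.
  assert (K2 := f_equal rad E). rewrite !rad_surface_pt in K2.
  assert (P1 := cos_phi_pos a x s). assert (P2 := cos_phi_pos a x s').
  unfold Rabs in K2. destruct (Rcase_abs s), (Rcase_abs s'); nra.
Qed.

Lemma cont_rad p : continuous (rad : R3 -> R) p.
Proof. unfold rad. cont_auto. Qed.

Lemma cont_side U a p : continuous (fun t => U a t) (x3 p) -> continuous (side U a : R3 -> R) p.
Proof.
  intros H. assert (HU := continuous_comp (x3 : R3 -> R) (fun t => U a t) p (cont_x3 p) H). unfold side. cont_auto.
Qed.

(** Continuity of the inverse with the same three functions: near a point with s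
    <> 0 the function [side] keeps its sign, so |s| controls s; at s = 0 there
    is nothing to distinguish. *)
Lemma surface_pt_inv_cont U a x s (eps : R) : continuous (fun t => U a t) x -> 0 < eps ->
  locally (surface_pt U a x s : R3) (fun p => forall x' s', p = surface_pt U a x' s' -> Rabs (x' - x) < eps /\ Rabs (s' - s) < eps).
Proof.
  intros HU He. set (p0 := surface_pt U a x s).
  assert (L1 := cont_eps _ p0 eps He (cont_x3 p0)).
  assert (L2 := cont_eps _ p0 eps He (cont_rad p0)).
  assert (Cph := cos_phi_pos a x s).
  destruct (Req_dec s 0) as [Hs|Hs].
  - generalize (filter_and (F := locally p0) _ _ L1 L2). apply filter_imp. intros p [K1 K2] x' s' ->.
    split; [exact K1|]. unfold p0 in K2. rewrite !rad_surface_pt in K2. subst s. rewrite Rabs_R0, Rminus_0_r, Rabs_Rabsolu in K2.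
    now rewrite Rminus_0_r.
  - assert (Hsd : 0 < Rabs (side U a p0)).
    { apply Rabs_pos_lt. unfold p0. rewrite side_surface_pt. apply Rmult_integral_contrapositive_currified; lra. }
    assert (L3 := cont_eps _ p0 _ Hsd (cont_side U a p0 HU)).
    generalize (filter_and (F := locally p0) _ _ L1 (filter_and (F := locally p0) _ _ L2 L3)). apply filter_imp. intros p [K1 [K2 K3]] x' s' ->.
    split; [exact K1|]. unfold p0 in K2, K3. rewrite !rad_surface_pt in K2. rewrite !side_surface_pt in K3.
    assert (Cph' := cos_phi_pos a x' s').
    generalize dependent (cos (phi a x s)). generalize dependent (cos (phi a x' s')). intros c' Hc' c Hc H3'.
    destruct (Rtotal_order s 0) as [N|[N|N]]; [|easy|].
    + rewrite (Rabs_left (s * c)) in H3' by nra. apply Rabs_def2 in H3'. assert (s' < 0) by nra.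
      rewrite (Rabs_left s), (Rabs_left s') in K2 by lra. rewrite Rabs_minus_sym. replace (s - s') with (- s' - - s) by ring. exact K2.
    + rewrite (Rabs_right (s * c)) in H3' by nra. apply Rabs_def2 in H3'. assert (0 < s') by nra.
      rewrite (Rabs_right s), (Rabs_right s') in K2 by lra. exact K2.
Qed.

Lemma axis_angle_cont DU U a x : axis_angle DU U -> DU a x -> continuous (fun t => U a t) x.
Proof. intros H HD. apply (ex_derive_continuous (fun t => U a t)). exists (lam / msq a x). now apply H. Qed.

Lemma smooth3_smooth_on (O : R3 -> Prop) f a (D : R * R -> Prop) : open O -> smooth3 O f ->
  (forall z, D z -> slice O a z) -> smooth_on D (f a).
Proof.
  intros HO Hf HD. exists (slice O a). split; [now apply open_slice|split; [exact HD|]].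
  intros n x y H. apply Ck_ex_diff_n with O; [easy|apply Hf|exact H].
Qed.

(** Reduces the embedding property in R^3 to properties of the plane change of
    coordinates (al, ga). *)
Lemma chart_embedding DU U (O : R3 -> Prop) (al ga : R -> R -> R -> R) a (D : R * R -> Prop) :
  axis_angle DU U -> open O -> smooth3 O al -> smooth3 O ga ->
  (forall a p q, O (a, p, q) -> Dom DU (a, al a p q, ga a p q)) ->
  (forall z, D z -> slice O a z) ->
  (forall p q, slice O a (p, q) -> exists alp alq gap gaq : R,
     is_derive (fun t => al a t q) p alp /\ is_derive (fun t => al a p t) q alq /\
     is_derive (fun t => ga a t q) p gap /\ is_derive (fun t => ga a p t) q gaq /\ alp * gaq - alq * gap <> 0) ->
  (forall p q p' q', D (p, q) -> D (p', q') -> al a p q = al a p' q' -> ga a p q = ga a p' q' -> p = p' /\ q = q') ->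
  (forall p q, D (p, q) -> forall eps : posreal, exists d, 0 < d /\ forall p' q', D (p', q') ->
     Rabs (al a p' q' - al a p q) < d -> Rabs (ga a p' q' - ga a p q) < d -> ball (p, q) eps (p', q')) ->
  embedding D (chart U al ga a) /\ forall p q, D (p, q) -> mean_curvature (chart U al ga a) p q = 0.
Proof.
  intros HU HO Sal Sga HDom HD HJ Hinj Hcont.
  destruct (chart_smooth DU U O al ga HU HO Sal Sga HDom) as [S1 [S2 S3]].
  split; [split; [|split; [|split]]|].
  - split; [|split]; [exact (smooth3_smooth_on O _ a D HO S1 HD)|exact (smooth3_smooth_on O _ a D HO S2 HD)|exact (smooth3_smooth_on O _ a D HO S3 HD)].
  - intros p q H. destruct (HJ p q (HD _ H)) as [alp [alq [gap [gaq [D1 [D2 [D3 [D4 HJac]]]]]]]].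
    apply (chart_curvature DU U O al ga a p q alp alq gap gaq); try easy. now apply (HD (p, q)).
  - intros p q p' q' H H' E. apply surface_pt_inj in E. now apply Hinj.
  - intros p q H eps. destruct (Hcont p q H eps) as [d [Hd K]].
    destruct (surface_pt_inv_cont U a (al a p q) (ga a p q) d) as [d' Hd']; [|easy|].
    + apply (axis_angle_cont DU); [easy|]. apply (HDom a p q). apply (HD _ H).
    + exists d'. intros p' q' H' B. destruct (Hd' (chart U al ga a p' q') B _ _ eq_refl) as [B1 B2]. now apply K.
  - intros p q H. destruct (HJ p q (HD _ H)) as [alp [alq [gap [gaq [D1 [D2 [D3 [D4 HJac]]]]]]]].
    apply (chart_curvature DU U O al ga a p q alp alq gap gaq); try easy. now apply (HD (p, q)).
Qed.

(** * Multi-valued graphs *)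

Definition convex2 (W : R * R -> Prop) : Prop :=
  forall z z' t, W z -> W z' -> 0 <= t <= 1 ->
    W (fst z + t * (fst z' - fst z), snd z + t * (snd z' - snd z)).

(** Connectedness of convex sets: along the segment joining a point of U to one
    of V, the indicator of the complement of U would be a continuous function
    taking only the values 0 and 1. *)
Lemma convex_meets (W U V : R * R -> Prop) :
  convex2 W -> open U -> open V -> (forall z, W z -> U z \/ V z) ->
  (exists z, W z /\ U z) -> (exists z, W z /\ V z) -> exists z, W z /\ U z /\ V z.
Proof.
  intros HW HU HV Hc [z [Wz Uz]] [z' [Wz' Vz']]. apply NNPP. intros HN.
  (* clamping the segment makes the indicator continuous on the whole line *)
  set (cl := fun t => Rmax 0 (Rmin 1 t)).
  set (c := fun t => (fst z + cl t * (fst z' - fst z), snd z + cl t * (snd z' - snd z))).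
  assert (Hcl : forall t, 0 <= cl t <= 1).
  { intros t. unfold cl. split; [apply Rmax_l|]. apply Rmax_lub; [lra|apply Rmin_l]. }
  assert (Wc : forall t, W (c t)) by (intros t; now apply HW).
  assert (Ccl : forall t, continuous cl t).
  { intros t P [e He]. exists e. intros y Hy. apply He.
    change (Rabs (y - t) < e) in Hy. change (Rabs (cl y - cl t) < e).
    apply Rle_lt_trans with (2 := Hy). unfold cl, Rmax, Rmin.
    repeat destruct Rle_dec; unfold Rabs; repeat destruct Rcase_abs; lra. }
  assert (Cc : forall t, continuous c t) by (intros t; specialize (Ccl t); unfold c; cont_auto).
  set (f := fun t => if excluded_middle_informative (U (c t)) then 0 else 1).
  assert (Cf : continuity f).
  { intros t. apply continuity_pt_filterlim.
    destruct (Hc _ (Wc t)) as [H|H].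
    - apply (continuous_ext_loc _ (fun _ => 0)); [|apply continuous_const].
      generalize (Cc t _ (HU _ H)). unfold filtermap. apply filter_imp. intros s Hs. unfold f.
      destruct (excluded_middle_informative (U (c s))); easy.
    - apply (continuous_ext_loc _ (fun _ => 1)); [|apply continuous_const].
      generalize (Cc t _ (HV _ H)). unfold filtermap. apply filter_imp. intros s Hs. unfold f.
      destruct (excluded_middle_informative (U (c s))); [|easy]. elim HN. exists (c s). split; [apply Wc|easy]. }
  assert (f0 : f 0 = 0).
  { unfold f. destruct (excluded_middle_informative (U (c 0))) as [|n]; [easy|]. elim n. unfold c, cl.
    rewrite Rmin_right, Rmax_left by lra. rewrite !Rmult_0_l, !Rplus_0_r. now destruct z. }
  assert (f1 : f 1 = 1).
  { unfold f. destruct (excluded_middle_informative (U (c 1))) as [Y|]; [|easy]. elim HN. exists (c 1). split; [apply Wc|split; [easy|]].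
    unfold c, cl. rewrite Rmin_left, Rmax_right by lra. rewrite !Rmult_1_l.
    replace (fst z + (fst z' - fst z)) with (fst z') by ring. replace (snd z + (snd z' - snd z)) with (snd z') by ring. now destruct z'. }
  destruct (IVT_gen f 0 1 (1 / 2) Cf) as [t [_ Ht]].
  - rewrite f0, f1, Rmin_left, Rmax_right; lra.
  - unfold f in Ht. destruct (excluded_middle_informative (U (c t))); lra.
Qed.

(** The height as a function of distance and angle, that is, the function whose
    graph the surface is. *)
Definition height_at (VV : R3 -> Prop) (T : R -> R -> R -> R) (a r t : R) : R :=
  epsilon (inhabits 0) (fun x => VV (a, r, x) /\ T a r x = t).

Lemma height_at_spec VV T a r t : fibre_range VV T (a, r, t) -> VV (a, r, height_at VV T a r t) /\ T a r (height_at VV T a r t) = t.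
Proof.
  intros [y Hy]. unfold x1, x2, x3 in *; simpl in *.
  apply (epsilon_spec (inhabits 0) (fun x => VV (a, r, x) /\ T a r x = t)). now exists y.
Qed.

Definition graph_set (H : R * R -> Prop) (T : R -> R -> R -> R) (a : R) (p : R3) : Prop :=
  exists r x, H (r, x) /\ (r * cos (T a r x), r * sin (T a r x), x) = p.

(** In the coordinates (a, r, x), where r > 0 is the distance to the axis and x
    the height, T is an angle that strictly increases with the height. *)
Definition turning (VV : R3 -> Prop) (T : R -> R -> R -> R) : Prop :=
  open VV /\ fibre_convex VV /\ smooth3 VV T /\
  (exists Tx, forall a r x, VV (a, r, x) -> is_derive (fun t => T a r t) x (Tx a r x) /\ 0 < Tx a r x) /\
  (forall a r x, VV (a, r, x) -> 0 < r).

Lemma turning_inj VV T a r x x' : turning VV T -> VV (a, r, x) -> VV (a, r, x') -> T a r x = T a r x' -> x = x'.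
Proof. intros [_ [HF [_ [[Tx HT] _]]]]. now apply fibre_injective with Tx. Qed.

Lemma turning_inv VV T a r x : turning VV T -> VV (a, r, x) -> height_at VV T a r (T a r x) = x.
Proof.
  intros HT H. destruct (height_at_spec VV T a r (T a r x)) as [H1 H2]; [now exists x|]. now apply turning_inj with VV T a r.
Qed.

Lemma turning_smooth VV T : turning VV T -> open (fibre_range VV T) /\ smooth3 (fibre_range VV T) (height_at VV T).
Proof.
  intros [HO [HF [HS [[Tx HT] _]]]]. split.
  - apply open_fibre_range with Tx; try easy. intros; now apply (cont_of_smooth VV).
  - apply smooth3_inverse with Tx; try easy. apply height_at_spec.
Qed.

(** A turning surface over H is the graph of the height over the image of H
    under (r, x) -> (r, T). The image of the convex open set Ho is open and
    connected because the map is an open continuous one, and H contributes only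
    limit points. *)
Lemma turning_graph VV T a (H Ho : R * R -> Prop) :
  turning VV T -> open Ho -> convex2 Ho -> (exists z, Ho z) ->
  (forall z, Ho z -> H z) -> (forall z, H z -> closure Ho z) -> (forall z, H z -> slice VV a z) ->
  multivalued_graph (graph_set H T a).
Proof.
  intros HT HoO HoC HoN HoH HHo HV.
  destruct (turning_smooth _ _ HT) as [RO RS].
  assert (HT' := HT). destruct HT' as [VO [VF [TS [[Tx HTx] Vpos]]]].
  set (m := fun z : R * R => (fst z, T a (fst z) (snd z))).
  assert (Cm : forall z, H z -> continuous m z).
  { intros [r x] Hz. apply continuous_pair; [cont_auto|].
    apply cont3_slice. apply (cont_of_smooth VV); [easy|]. apply (HV _ Hz). }
  exists (fun z => exists x, H (fst z, x) /\ T a (fst z) x = snd z), (height_at VV T a).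
  split; [split|split].
  - intros [r t] [x [Hx _]]. apply (Vpos a r x). apply (HV _ Hx).
  - exists (fun z => exists x, Ho (fst z, x) /\ T a (fst z) x = snd z). split; [split; [|split]|split].
    (* T also has an open range when its fibres are cut down to those of Ho, by
       convexity *)
    + set (VV' := fun p : R3 => VV p /\ Ho (x2 p, x3 p)).
      assert (O' : open (fibre_range VV' T)).
      { apply open_fibre_range with Tx.
        - apply open_and; [easy|]. apply (open_comp (fun p : R3 => (x2 p, x3 p)) Ho); [|easy].
          intros p _. cont_auto.
        - intros a' r y y1 y2 [K1 K2] [K3 K4] Hy. split; [now apply VF with y1 y2|].
          unfold x2, x3 in *; simpl in *. destruct (Req_dec y1 y2) as [->|N]; [now replace y with y2 by lra|].
          assert (K := HoC _ _ ((y - y1) / (y2 - y1)) K2 K4). simpl in K.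
          replace (r + (y - y1) / (y2 - y1) * (r - r)) with r in K by ring.
          replace (y1 + (y - y1) / (y2 - y1) * (y2 - y1)) with y in K by (field; lra). apply K. split.
          + apply Rdiv_le_0_compat; lra.
          + apply Rle_div_l; lra.
        - intros a' r x [K _]. now apply (cont_of_smooth VV).
        - intros a' r x [K _]. now apply HTx. }
      apply open_ext with (2 := open_slice _ a O'). intros [r t]. unfold slice, fibre_range, VV', x1, x2, x3; simpl. split.
      * intros [y [[K1 K2] K3]]. now exists y.
      * intros [y [K1 K2]]. exists y. split; [split|]; try easy. apply (HV _ (HoH _ K1)).
    + destruct HoN as [[r x] Hz]. exists (r, T a r x). now exists x.
    + intros U V HU HV' Hc [[r1 t1] [[y1 [H1 E1]] U1]] [[r2 t2] [[y2 [H2 E2]] U2]]. simpl in *.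
      (* restrict the preimages to open sets where the parametrization is continuous *)
      destruct (convex_meets Ho (fun z => Ho z /\ U (m z)) (fun z => Ho z /\ V (m z))) as [[r x] [K1 [[_ K2] [_ K3]]]]; [easy| | | | | |].
      * intros z [K1 K2]. apply filter_and; [now apply HoO|]. exact (Cm z (HoH _ K1) _ (HU _ K2)).
      * intros z [K1 K2]. apply filter_and; [now apply HoO|]. exact (Cm z (HoH _ K1) _ (HV' _ K2)).
      * intros [r x] Hz. destruct (Hc (m (r, x))) as [K|K]; [now exists x|now left|now right].
      * exists (r1, y1). split; [easy|split; [easy|]]. unfold m; simpl. now rewrite E1.
      * exists (r2, y2). split; [easy|split; [easy|]]. unfold m; simpl. now rewrite E2.
      * exists (m (r, x)). split; [now exists x|easy].
    + intros [r t] [x [K1 K2]]. exists x. split; [now apply HoH|easy].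
    + intros [r t] [x [K1 K2]]. simpl in *. subst t. intros eps.
      assert (C := Cm (r, x) K1 _ (locally_ball _ eps)). destruct C as [d Hd].
      destruct (HHo _ K1 d) as [[r' x'] [Q1 Q2]]. exists (m (r', x')). split; [now exists x'|]. exact (Hd _ Q2).
  - apply (smooth3_smooth_on (fibre_range VV T) (height_at VV T) a); [easy|easy|].
    intros [r t] [x [K1 K2]]. exists x. unfold x1, x2, x3; simpl. split; [apply (HV _ K1)|easy].
  - intros p. split.
    + intros [r [x [Hz E]]]. exists r, (T a r x). split; [now exists x|].
      unfold graph_pt. rewrite turning_inv; [easy|easy|apply (HV _ Hz)].
    + intros [r [t [[x [Hz E]] Ep]]]. simpl in *. exists r, x. split; [easy|]. rewrite <- Ep. subst t.
      unfold graph_pt. rewrite turning_inv; [easy|easy|apply (HV _ Hz)].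
Qed.

Lemma graph_normal (u : R -> R -> R) r t ur ut : r <> 0 ->
  is_derive (fun s => u s t) r ur -> is_derive (fun s => u r s) t ut -> normal_vec (graph_pt u) r t <> (0, 0, 0).
Proof.
  intros Hr D1 D2 Z.
  assert (E : x3 (normal_vec (graph_pt u) r t) = r).
  { unfold normal_vec, cross, pd, x3, x1, x2; simpl.
    rewrite (partial_10 (coord1 (graph_pt u)) r t (cos t)), (partial_10 (coord2 (graph_pt u)) r t (sin t)),
      (partial_01 (coord1 (graph_pt u)) r t (r * - sin t)), (partial_01 (coord2 (graph_pt u)) r t (r * cos t)).
    - assert (T := sin2_cos2 t). unfold Rsqr in T.
      transitivity (r * (sin t * sin t + cos t * cos t)); [ring|rewrite T; ring].
    - unfold coord2, graph_pt, x2; simpl. auto_derive; [easy|ring].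
    - unfold coord1, graph_pt, x1; simpl. auto_derive; [easy|ring].
    - unfold coord2, graph_pt, x2; simpl. auto_derive; [easy|ring].
    - unfold coord1, graph_pt, x1; simpl. auto_derive; [easy|ring]. }
  rewrite Z in E. unfold x3 in E; simpl in E. lra.
Qed.

Lemma rad_graph_pt u r t : 0 < r -> rad (graph_pt u r t) = r.
Proof.
  intros Hr. unfold rad, graph_pt, x1, x2; simpl.
  replace (r * cos t * (r * cos t) + r * sin t * (r * sin t)) with (r * r * (Rsqr (sin t) + Rsqr (cos t))) by (unfold Rsqr; ring).
  rewrite sin2_cos2, Rmult_1_r. apply sqrt_square. lra.
Qed.

(** A turning surface contains an N-valued graph over an annulus as soon as all
    the angles of that annulus are attained. The graph is embedded although
    angles that differ by 2 pi lie over the same point: the height determines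
    the angle. *)
Lemma turning_N_graph VV T a (S : R3 -> Prop) N r s t0 :
  turning VV T -> 0 < r < s ->
  (forall rho t, r < rho <= s -> Rabs (t - t0) <= INR N * PI ->
     exists x, VV (a, rho, x) /\ T a rho x = t /\ S (rho * cos t, rho * sin t, x)) ->
  contains_embedded_N_graph N S.
Proof.
  intros HT Hrs HE. destruct (turning_smooth _ _ HT) as [RO RS]. assert (HT' := HT). destruct HT' as [VO [VF [TS [_ Vpos]]]].
  set (An := polar_annulus r s N t0). set (u := height_at VV T a).
  assert (HA : forall z, An z -> slice (fibre_range VV T) a z).
  { intros [rho t] [H1 H2]. simpl in *. destruct (HE rho t H1 H2) as [x [K1 [K2 _]]]. exists x. now unfold x1, x2, x3. }
  assert (Hu : forall rho t, An (rho, t) -> VV (a, rho, u rho t) /\ T a rho (u rho t) = t).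
  { intros rho t H. apply height_at_spec. apply (HA _ H). }
  exists r, s, t0, u. split; [easy|split; [|split]].
  - now apply (smooth3_smooth_on (fibre_range VV T) (height_at VV T) a).
  - split; [|split; [|split]].
    + split; [|split].
      * apply (smooth3_smooth_on (fibre_range VV T) (fun _ rho t => rho * cos t) a An); [easy| |easy]. intros n. Ck_auto.
      * apply (smooth3_smooth_on (fibre_range VV T) (fun _ rho t => rho * sin t) a An); [easy| |easy]. intros n. Ck_auto.
      * now apply (smooth3_smooth_on (fibre_range VV T) (height_at VV T) a An).
    + intros rho t H. destruct (RS 1%nat) as [_ [ux [uy [D _]]]]. destruct (D _ _ _ (HA _ H)) as [D1 D2].
      apply (graph_normal u rho t _ _) with (2 := D1) (3 := D2). destruct H as [H _]. simpl in H. lra.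
    + intros rho t rho' t' H H' E.
      assert (Er : rho = rho').
      { assert (K := f_equal rad E). destruct H as [H _], H' as [H' _]. simpl in H, H'. rewrite !rad_graph_pt in K by lra. exact K. }
      subst rho'. split; [easy|]. assert (Eu : u rho t = u rho t') by (apply (f_equal x3) in E; exact E).
      rewrite <- (proj2 (Hu _ _ H)), <- (proj2 (Hu _ _ H')). now rewrite Eu.
    + intros rho t H eps. destruct (Hu _ _ H) as [V E].
      assert (CT := cont_of_smooth VV T a rho (u rho t) TS V).
      assert (P : 0 < eps) by apply cond_pos.
      destruct (cont3_eps _ _ _ _ CT eps) as [d Hd].
      set (d' := Rmin d eps). assert (Hd' : 0 < d') by (apply Rmin_pos; apply cond_pos).
      assert (L1 := cont_eps _ (graph_pt u rho t : R3) d' Hd' (cont_x3 _)).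
      assert (L2 := cont_eps _ (graph_pt u rho t : R3) d' Hd' (cont_rad _)).
      destruct (filter_and (F := locally (graph_pt u rho t : R3)) _ _ L1 L2) as [e He].
      exists e. intros rho' t' H' B. destruct (He _ B) as [K1 K2]. clear He.
      assert (0 < rho) by (destruct H as [H _]; simpl in H; lra).
      assert (0 < rho') by (destruct H' as [H' _]; simpl in H'; lra).
      rewrite !rad_graph_pt in K2 by easy. unfold x3, graph_pt in K1; simpl in K1.
      destruct (Hu _ _ H') as [V' E'].
      split.
      * change (Rabs (rho' - rho) < eps). apply Rlt_le_trans with (1 := K2). apply Rmin_r.
      * change (Rabs (t' - t) < eps). rewrite <- E, <- E' at 1. apply Hd.
        -- rewrite Rminus_diag, Rabs_R0. apply cond_pos.
        -- apply Rlt_le_trans with (1 := K2). apply Rmin_l.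
        -- apply Rlt_le_trans with (1 := K1). apply Rmin_l.
  - intros p [rho [t [H <-]]]. destruct H as [H1 H2]. simpl in H1, H2.
    destruct (HE rho t H1 H2) as [x [K1 [K2 K3]]]. unfold graph_pt, u. rewrite <- K2 at 3.
    rewrite (turning_inv VV T a rho x HT K1). exact K3.
Qed.

(** * The two halves of a surface *)

Definition turn_dom (DU : R -> R -> Prop) (p : R3) : Prop := DU (x1 p) (x3 p) /\ 0 < x2 p < 2.
(** The angle of the half s = sg r, with r > 0; c = pi accounts for the sign
    when sg = -1. *)
Definition turn_angle (U : R -> R -> R) (sg c a r x : R) : R := theta U a x (sg * r) + c.

Definition sheet (sg c : R) : Prop := (sg = 1 /\ c = 0) \/ (sg = -1 /\ c = PI).

Lemma turn_angle_surface_pt U sg c a r x : sheet sg c ->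
  (r * cos (turn_angle U sg c a r x), r * sin (turn_angle U sg c a r x), x) = surface_pt U a x (sg * r).
Proof.
  intros [[-> ->]|[-> ->]]; unfold turn_angle, surface_pt.
  - rewrite Rplus_0_r, Rmult_1_l. reflexivity.
  - rewrite neg_cos, neg_sin. f_equal. f_equal; ring.
Qed.

Definition convex_fibres (DU : R -> R -> Prop) : Prop :=
  forall a x x' x'', DU a x' -> DU a x'' -> x' <= x <= x'' -> DU a x.

Lemma open_turn_dom DU U : axis_angle DU U -> open (turn_dom DU).
Proof.
  intros HU. unfold turn_dom. apply open_and; [|open_auto].
  apply (open_comp (fun p : R3 => (x1 p, x3 p, 0) : R3) (fun p : R3 => DU (x1 p) (x2 p))); [|apply HU].
  intros p _. cont_auto.
Qed.

Lemma turning_surface DU U sg c : axis_angle DU U -> convex_fibres DU -> sheet sg c ->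
  turning (turn_dom DU) (turn_angle U sg c).
Proof.
  intros HU HC Hsg. assert (O := open_turn_dom _ _ HU).
  assert (HD : forall a r x, turn_dom DU (a, r, x) -> Dom DU (a, x, sg * r)).
  { intros a r x [H1 H2]. unfold x1, x2, x3 in *; simpl in *. split; [exact H1|]. unfold x3; simpl.
    destruct Hsg as [[-> _]|[-> _]]; lra. }
  split; [easy|split; [|split; [|split]]].
  - intros a r y y1 y2 [K1 K2] [K3 K4] Hy. unfold x1, x2, x3 in *; simpl in *. split; unfold x1, x2, x3; simpl; [|easy].
    now apply HC with y1 y2.
  - intros n. apply (Ck_plus n _ (fun a r x => theta U a x (sg * r)) (fun _ _ _ => c)); [|apply Ck_const].
    apply (Ck_comp n (turn_dom DU) (Dom DU) (theta U) (fun _ _ y => y) (fun _ x _ => sg * x));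
      [now apply open_Dom with U|now apply smooth_theta|Ck_auto|Ck_auto|exact HD].
  - exists (fun a r x => Derive (fun t => turn_angle U sg c a r t) x). intros a r x H.
    destruct (theta_x DU U a x (sg * r) HU (HD _ _ _ H)) as [d [D P]].
    { destruct H as [_ H]. unfold x2 in H; simpl in H. destruct Hsg as [[-> _]|[-> _]]; lra. }
    assert (D' : is_derive (fun t => turn_angle U sg c a r t) x d).
    { eapply is_derive_ext_val; [exact (is_derive_plus _ _ _ _ _ D (is_derive_const c x))|]. to_R. ring. }
    assert (E : Derive (fun t => turn_angle U sg c a r t) x = d) by exact (is_derive_unique _ _ _ D').
    cbv beta. rewrite E. now split.
  - intros a r x [_ H]. apply H.
Qed.

(** With e = 0 there is no condition, which describes the whole disk; e = 1 and
    e = -1 describe its two open halves. *)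
Definition side_ok (e x : R) : Prop := e = 0 \/ 0 < e * x.
(** The half disk in the coordinates (r, x), and below it its interior; the arc
    of the unit circle belongs to [Half] only. *)
Definition Half (e : R) (z : R * R) : Prop :=
  0 < fst z /\ side_ok e (snd z) /\ fst z * fst z + snd z * snd z <= 1.
Definition Halfo (e : R) (z : R * R) : Prop :=
  0 < fst z /\ side_ok e (snd z) /\ fst z * fst z + snd z * snd z < 1.

Definition surface_set (U : R -> R -> R) (e a : R) (p : R3) : Prop :=
  exists x s, side_ok e x /\ x * x + s * s <= 1 /\ surface_pt U a x s = p.

Lemma open_Halfo e : open (Halfo e).
Proof.
  destruct (Req_dec e 0) as [He|He].
  - apply open_ext with (fun z : R * R => 0 < fst z /\ fst z * fst z + snd z * snd z < 1); [|open_auto].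
    intros z. unfold Halfo, side_ok. tauto.
  - apply open_ext with (fun z : R * R => 0 < fst z /\ 0 < e * snd z /\ fst z * fst z + snd z * snd z < 1); [|open_auto].
    intros z. unfold Halfo, side_ok. tauto.
Qed.

Lemma disk_convex_step A B x y t : A * A + B * B < 1 -> x * x + y * y < 1 -> 0 <= t <= 1 ->
  (A + t * (x - A)) * (A + t * (x - A)) + (B + t * (y - B)) * (B + t * (y - B)) < 1.
Proof.
  intros H1 H2 Ht.
  replace ((A + t * (x - A)) * (A + t * (x - A)) + (B + t * (y - B)) * (B + t * (y - B)))
    with ((1 - t) * (A * A + B * B) + t * (x * x + y * y) - t * (1 - t) * ((x - A) * (x - A) + (y - B) * (y - B))) by ring.
  assert (Q1 := Rle_0_sqr (x - A)). assert (Q2 := Rle_0_sqr (y - B)). unfold Rsqr in Q1, Q2.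
  assert (0 <= t * (1 - t)) by nra.
  assert (0 <= t * (1 - t) * ((x - A) * (x - A) + (y - B) * (y - B))) by (apply Rmult_le_pos; lra).
  generalize dependent (A * A + B * B). generalize dependent (x * x + y * y).
  generalize dependent (t * (1 - t) * ((x - A) * (x - A) + (y - B) * (y - B))). intros w Hw m Hm n Hn.
  destruct (Req_dec t 0) as [->|]; nra.
Qed.

Lemma convex_Halfo e : convex2 (Halfo e).
Proof.
  intros [r x] [r' x'] t [H1 [H2 H3]] [H1' [H2' H3']] Ht. simpl in *. split; simpl; [|split].
  - destruct (Req_dec t 0) as [->|]; [lra|]. destruct (Req_dec t 1) as [->|]; [lra|]. nra.
  - destruct H2 as [->|H2]; [now left|]. destruct H2' as [E|H2']; [now left|]. right.
    replace (e * (x + t * (x' - x))) with ((1 - t) * (e * x) + t * (e * x')) by ring.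
    destruct (Req_dec t 0) as [->|]; nra.
  - now apply disk_convex_step.
Qed.

Lemma Half_closure e z : Half e z -> closure (Halfo e) z.
Proof.
  destruct z as [r x]. intros [H1 [H2 H3]] eps. simpl in *. assert (P := cond_pos eps).
  set (d := Rmin (1 / 2) (eps / 2)). assert (0 < d) by (apply Rmin_pos; lra).
  assert (d <= 1 / 2) by apply Rmin_l. assert (d <= eps / 2) by apply Rmin_r.
  exists ((1 - d) * r, (1 - d) * x). split.
  - split; simpl; [nra|split].
    + destruct H2 as [->|H2]; [now left|right]. replace (e * ((1 - d) * x)) with ((1 - d) * (e * x)) by ring. nra.
    + replace ((1 - d) * r * ((1 - d) * r) + (1 - d) * x * ((1 - d) * x)) with ((1 - d) * (1 - d) * (r * r + x * x)) by ring.
      assert (0 < r * r + x * x) by nra. nra.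
  - assert (-1 <= r <= 1) by nra. assert (-1 <= x <= 1) by nra. split.
    + change (Rabs ((1 - d) * r - r) < eps). replace ((1 - d) * r - r) with (- (d * r)) by ring. apply Rabs_def1; nra.
    + change (Rabs ((1 - d) * x - x) < eps). replace ((1 - d) * x - x) with (- (d * x)) by ring. apply Rabs_def1; nra.
Qed.

(** The points off the axis are those with s <> 0, and s > 0, s < 0 give the two
    graphs. *)
Lemma two_graphs DU U e a : e = 0 \/ e = 1 \/ e = -1 -> axis_angle DU U -> convex_fibres DU ->
  (forall x, side_ok e x -> -1 <= x <= 1 -> DU a x) ->
  multivalued_graph (graph_set (Half e) (turn_angle U 1 0) a) /\
  multivalued_graph (graph_set (Half e) (turn_angle U (-1) PI) a) /\
  forall p, surface_set U e a p /\ ~ on_axis p <->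
    graph_set (Half e) (turn_angle U 1 0) a p \/ graph_set (Half e) (turn_angle U (-1) PI) a p.
Proof.
  intros He HU HC HDU.
  assert (G : forall sg c, sheet sg c -> multivalued_graph (graph_set (Half e) (turn_angle U sg c) a)).
  { intros sg c Hs. apply (turning_graph (turn_dom DU) (turn_angle U sg c) a (Half e) (Halfo e)).
    - now apply turning_surface.
    - apply open_Halfo.
    - apply convex_Halfo.
    (* a point of the half disk that serves for e = 0, 1 and -1 *)
    - exists (1 / 2, e / 2). split; simpl; [lra|]. destruct He as [->|[->| ->]]; (split; [unfold side_ok|]); try lra.
    - intros z [K1 [K2 K3]]. split; [easy|split; [easy|lra]].
    - apply Half_closure.
    - intros [r x] [K1 [K2 K3]]. simpl in *. split; unfold x1, x2, x3; simpl; [apply HDU; [easy|nra]|nra]. }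
  assert (S1 : sheet 1 0) by now left. assert (S2 : sheet (-1) PI) by now right.
  split; [now apply G|split; [now apply G|]].
  intros p. split.
  - intros [[x [s [K1 [K2 <-]]]] Hax].
    assert (Hs : s <> 0). { intros ->. apply Hax. split; unfold surface_pt, x1, x2; simpl; ring. }
    destruct (Rle_lt_dec 0 s).
    + left. exists s, x. split; [split; simpl; [lra|split; [easy|lra]]|]. rewrite turn_angle_surface_pt by easy. now rewrite Rmult_1_l.
    + right. exists (- s), x. split; [split; simpl; [lra|split; [easy|lra]]|]. rewrite turn_angle_surface_pt by easy.
      now replace (-1 * - s) with s by ring.
  - assert (Q : forall sg c, sheet sg c -> graph_set (Half e) (turn_angle U sg c) a p -> surface_set U e a p /\ ~ on_axis p).
    { intros sg c Hs [r [x [[K1 [K2 K3]] E]]]. simpl in *. rewrite turn_angle_surface_pt in E by easy. split.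
      - exists x, (sg * r). split; [easy|split; [|easy]]. destruct Hs as [[-> _]|[-> _]]; lra.
      - intros [A1 A2]. rewrite <- E in A1, A2. assert (K : rad (surface_pt U a x (sg * r)) = 0).
        { unfold rad. rewrite A1, A2. replace (0 * 0 + 0 * 0) with 0 by ring. apply sqrt_0. }
        rewrite rad_surface_pt in K. destruct Hs as [[-> _]|[-> _]].
        + rewrite Rmult_1_l, Rabs_right in K; lra.
        + replace (-1 * r) with (- r) in K by ring. rewrite Rabs_Ropp, Rabs_right in K; lra. }
    intros [H|H]; [now apply (Q 1 0)|now apply (Q (-1) PI)].
Qed.

Lemma convex_Dmain : convex_fibres Dmain.
Proof.
  intros a x x' x'' [[H1 [H2 H3]] H4] [[K1 _] _] Hx. split; [split; [lra|split; [easy|]]|easy]. unfold msq in *.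
  assert (0 < a * a) by nra. assert (0 <= x * x) by apply Rle_0_sqr. lra.
Qed.

Lemma convex_Dlim e : convex_fibres (Dlim e).
Proof.
  intros a x x' x'' [[H1 [H2 H3]] H4] [[K1 _] K4] Hx.
  assert (0 < e * x) by (destruct (Rle_lt_dec 0 e); nra).
  split; [split; [lra|split; [easy|]]|easy]. unfold msq in *. assert (x <> 0) by (intros ->; lra).
  assert (0 < x * x) by nra. assert (0 <= a * a) by apply Rle_0_sqr. lra.
Qed.

Lemma Dlim_0 e x : e = 1 \/ e = -1 -> 0 < e * x -> -2 < x < 2 -> Dlim e 0 x.
Proof.
  intros He Hx Hb. split; [split; [easy|split; [lra|]]|easy]. unfold msq. assert (x <> 0) by (intros ->; lra). nra.
Qed.

(** U contributes - lam / x, and phi and c are bounded. *)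
Lemma turn_angle_limit e sg c r z : e = 1 \/ e = -1 -> sheet sg c -> 0 < z ->
  - lam / z - 3 * PI / 2 <= e * turn_angle Ulim sg c 0 r (e * z) <= - lam / z + 3 * PI / 2.
Proof.
  intros He Hs Hz. unfold turn_angle, theta.
  assert (P := PI_RGT_0). destruct (phi_bound 0 (e * z) (sg * r)) as [B1 B2].
  rewrite Ulim_0 by (destruct He as [-> | ->]; lra).
  assert (0 <= c <= PI) by (destruct Hs as [[_ ->]|[_ ->]]; lra).
  destruct He as [-> | ->].
  - rewrite !Rmult_1_l in *. lra.
  - replace (- lam / (-1 * z)) with (lam / z) by (field; lra). lra.
Qed.

(** By [turn_angle_limit], e times the angle is below e t near the plane and
    above it at height x0; the intermediate value theorem gives a height in
    between. *)
Lemma limit_angle_attained e sg c x0 t r : e = 1 \/ e = -1 -> sheet sg c -> 0 < x0 < 2 -> 0 < r < 2 ->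
  e * t <= - lam / x0 - 2 * PI ->
  exists x, 0 < e * x < x0 /\ turn_dom (Dlim e) (0, r, x) /\ turn_angle Ulim sg c 0 r x = t.
Proof.
  intros He Hs Hx0 Hr Ht. assert (P := PI_RGT_0). assert (Lp := lam_pos).
  assert (TS := turning_surface (Dlim e) Ulim sg c (axis_angle_limit e) (convex_Dlim e) Hs).
  assert (Hee : e * e = 1) by (destruct He as [-> | ->]; ring).
  set (L := - (e * t) + 2 * PI). assert (Hdiv : 0 < lam / x0) by (apply Rdiv_lt_0_compat; lra).
  replace (- lam / x0) with (- (lam / x0)) in Ht by (field; lra).
  assert (HL : 0 < L) by (unfold L; lra).
  set (xa := lam / L). assert (Hxa : 0 < xa) by (now apply Rdiv_lt_0_compat).
  assert (Exa : - lam / xa = - L) by (unfold xa; field; lra).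
  assert (Hlt : xa < x0).
  { unfold xa. apply Rlt_div_l; [easy|].
    replace lam with (x0 * (lam / x0)) at 1 by (field; lra). apply Rmult_lt_compat_l; [lra|]. unfold L. lra. }
  assert (HV : forall z, 0 < z < 2 -> turn_dom (Dlim e) (0, r, e * z)).
  { intros z Hz. split; unfold x1, x2, x3; simpl; [|easy]. apply Dlim_0; [easy| |].
    - rewrite <- Rmult_assoc, Hee. lra.
    - destruct He as [-> | ->]; lra. }
  destruct TS as [_ [_ [_ [[Tx HT] _]]]].
  destruct (IVT_derive (fun z => e * turn_angle Ulim sg c 0 r (e * z)) (fun z => e * (Tx 0 r (e * z) * e)) xa x0 (e * t)) as [z [Hz E]]; [|easy| |].
  - intros z Hz. destruct (HT _ _ _ (HV z ltac:(lra))) as [D _].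
    apply (is_derive_scal (fun z => turn_angle Ulim sg c 0 r (e * z))).
    apply (is_derive_comp_R (fun x => turn_angle Ulim sg c 0 r x) (fun z => e * z)); [exact D|]. auto_derive; [easy|ring].
  - generalize (turn_angle_limit e sg c r xa He Hs Hxa). rewrite Exa.
    generalize (turn_angle_limit e sg c r x0 He Hs (proj1 Hx0)). replace (- lam / x0) with (- (lam / x0)) by (field; lra). unfold L. lra.
  - exists (e * z). split; [rewrite <- Rmult_assoc, Hee; lra|]. split; [apply HV; lra|].
    cbv beta in E.
    assert (K : e * (e * turn_angle Ulim sg c 0 r (e * z) - e * t) = 0) by (rewrite E; ring).
    replace (e * (e * turn_angle Ulim sg c 0 r (e * z) - e * t)) with ((e * e) * (turn_angle Ulim sg c 0 r (e * z) - t)) in K by ring.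
    rewrite Hee in K. lra.
Qed.

(** Every angle beyond a threshold depending on eps is attained below height eps
    at each distance from 1/4 to 1/2, so an interval of N turns beyond the
    threshold gives the N-valued graph. *)
Lemma limit_spirals e sg c : e = 1 \/ e = -1 -> sheet sg c ->
  spirals_into_plane (graph_set (Half e) (turn_angle Ulim sg c) 0).
Proof.
  intros He Hs eps N Heps _. assert (P := PI_RGT_0).
  assert (Hee : e * e = 1) by (destruct He as [-> | ->]; ring).
  set (x0 := Rmin (eps / 2) (1 / 2)).
  assert (H0 : 0 < x0) by (apply Rmin_pos; lra).
  assert (H1 : x0 <= eps / 2) by apply Rmin_l. assert (H2 : x0 <= 1 / 2) by apply Rmin_r.
  apply (turning_N_graph (turn_dom (Dlim e)) (turn_angle Ulim sg c) 0 _ N (1 / 4) (1 / 2) (- (e * (lam / x0 + 2 * PI + INR N * PI)))).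
  - apply turning_surface; [apply axis_angle_limit|apply convex_Dlim|easy].
  - lra.
  - intros rho t Hr Ht.
    destruct (limit_angle_attained e sg c x0 t rho He Hs) as [x [K1 [K2 K3]]]; [lra|lra| |].
    + apply Rabs_le_between in Ht. replace (- lam / x0) with (- (lam / x0)) by (field; lra).
      destruct He as [-> | ->]; lra.
    + exists x. split; [easy|split; [easy|]].
      assert (Hx : x * x <= 1 / 4).
      { replace (x * x) with ((e * x) * (e * x)) by (replace (x * x) with ((e * e) * (x * x)) by (rewrite Hee; ring); ring). nra. }
      split.
      * exists rho, x. split; [|now rewrite K3]. split; simpl; [lra|split; [right; lra|nra]].
      * unfold x3; simpl. replace (Rabs x) with (e * x); [lra|].
        destruct He as [-> | ->]; [rewrite Rabs_right; lra|rewrite Rabs_left; lra].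
Qed.

(** * The sequence of disks *)

(** Makes all parameters a_i less than 1. *)
Definition shift : nat := proj1_sig (constructive_indefinite_description _ (INR_unbounded lam)).
(** The parameter a_i, such that (lam / a_i) (pi / 2) = 2 pi n with n = i +
    [shift]. *)
Definition scale (i : nat) : R := lam / (4 * INR (i + shift)).

Lemma shift_lam : lam < INR shift.
Proof. exact (proj2_sig (constructive_indefinite_description _ (INR_unbounded lam))). Qed.

Lemma scale_shift_lam i : lam < INR (i + shift).
Proof. rewrite plus_INR. generalize (pos_INR i) shift_lam. lra. Qed.

Lemma scale_bounds i : 0 < scale i < 1.
Proof.
  assert (L := lam_pos). assert (H := scale_shift_lam i). unfold scale. split.
  - apply Rdiv_lt_0_compat; lra.
  - apply Rlt_div_l; lra.
Qed.

Lemma scale_period i : lam / scale i * (PI / 2) = 2 * INR (i + shift) * PI.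
Proof. assert (L := lam_pos). assert (H := scale_shift_lam i). unfold scale. field. lra. Qed.

Lemma scale_small (d : R) : 0 < d -> exists i1 : nat, forall i, (i1 <= i)%nat -> Rabs (scale i) < d.
Proof.
  intros Hd. assert (L := lam_pos). destruct (INR_unbounded (lam / d)) as [n Hn]. exists n. intros i Hi.
  assert (H := scale_shift_lam i). rewrite Rabs_right by (generalize (scale_bounds i); lra).
  unfold scale. apply Rlt_div_l; [lra|].
  assert (INR n <= INR (i + shift)) by (apply le_INR; apply Nat.le_trans with (1 := Hi), Nat.le_add_r).
  apply Rlt_div_l in Hn; [|easy]. nra.
Qed.

Definition Fmain (i : nat) (p q : R) : R3 := surface_pt Umain (scale i) p q.
Definition proj_x (_ p _ : R) : R := p.
Definition proj_s (_ _ q : R) : R := q.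

Lemma disk_Dom i p q : p * p + q * q <= 1 -> Dom Dmain (scale i, p, q).
Proof.
  intros H. destruct (scale_bounds i). split; [split; [split; [|split]|]|]; unfold x1, x2, x3; simpl; try easy; try nra.
  unfold msq. assert (0 <= p * p) by nra. assert (0 < scale i * scale i) by nra. lra.
Qed.

Lemma closed_disk_sq p q : closed_disk (p, q) -> p * p + q * q <= 1.
Proof. unfold closed_disk; simpl. lra. Qed.

Lemma Fmain_embedded i : embedded_minimal_disk closed_disk (Fmain i).
Proof.
  split; [|].
  - split; [intros z Hz; unfold closed_disk; lra|]. exists (fun _ => True). split; [apply open_true|]. tauto.
  - apply (chart_embedding Dmain Umain (Dom Dmain) proj_x proj_s (scale i) closed_disk).
    + apply axis_angle_main.
    + apply open_Dom with Umain, axis_angle_main.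
    + intros n; apply Ck_x.
    + intros n; apply Ck_y.
    + easy.
    + intros [p q] H. now apply disk_Dom, closed_disk_sq.
    + intros p q _. exists 1, 0, 0, 1. unfold proj_x, proj_s.
      split; [exact (is_derive_id p)|split; [exact (is_derive_const p q)|split; [exact (is_derive_const q p)|split; [exact (is_derive_id q)|lra]]]].
    + easy.
    + intros p q _ eps. exists eps. split; [apply cond_pos|]. intros p' q' _ H1 H2. now split.
Qed.

Lemma dot_surface_pt U a x s : dot (surface_pt U a x s) (surface_pt U a x s) = x * x + s * s.
Proof.
  unfold dot, surface_pt, x1, x2, x3; simpl. assert (T := sin2_cos2 (theta U a x s)). unfold Rsqr in T.
  transitivity (s * s * (sin (theta U a x s) * sin (theta U a x s) + cos (theta U a x s) * cos (theta U a x s)) + x * x); [ring|rewrite T; ring].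
Qed.

Lemma surface_pt_axis U a t : surface_pt U a t 0 = (0, 0, t).
Proof. unfold surface_pt. now rewrite !Rmult_0_l. Qed.

Lemma enorm_le_1 p : dot p p <= 1 -> enorm p <= 1.
Proof. intros H. unfold enorm. rewrite <- sqrt_1. now apply sqrt_le_1_alt. Qed.

Lemma enorm_1_dot p : enorm p <= 1 -> dot p p <= 1.
Proof.
  intros H. unfold enorm in H. assert (P : 0 <= dot p p) by (unfold dot; generalize (Rle_0_sqr (x1 p)) (Rle_0_sqr (x2 p)) (Rle_0_sqr (x3 p)); unfold Rsqr; lra).
  rewrite <- (sqrt_sqrt _ P). assert (S := sqrt_pos (dot p p)). assert (sqrt (dot p p) * sqrt (dot p p) <= 1 * 1) by (apply Rmult_le_compat; lra). lra.
Qed.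

Lemma Fmain_normA2 i p q : p * p + q * q <= 1 ->
  let y := iso_y (scale i) p q in
  normA2 (Fmain i) p q = 2 * (dh_re (scale i) p y * dh_re (scale i) p y + dh_im (scale i) p y * dh_im (scale i) p y) / cosh (h_im (scale i) p y) ^ 4.
Proof.
  intros H y.
  destruct (chart_curvature Dmain Umain (Dom Dmain) proj_x proj_s (scale i) p q 1 0 0 1) as [_ [_ K]]; try easy.
  - apply axis_angle_main.
  - apply open_Dom with Umain, axis_angle_main.
  - intros n; apply Ck_x.
  - intros n; apply Ck_y.
  - now apply disk_Dom.
  - exact (is_derive_id p).
  - exact (is_derive_const p q).
  - exact (is_derive_const q p).
  - exact (is_derive_id q).
  - lra.
Qed.

Lemma Fmain_blowup : is_lim_seq (fun i => normA2 (Fmain i) 0 0) p_infty.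
Proof.
  assert (L := lam_pos).
  apply (is_lim_seq_le_p_loc (fun i => 512 / (lam * lam) * INR i)).
  - exists 0%nat. intros i _. rewrite Fmain_normA2 by lra.
    assert (B : Box (scale i, 0, 0)) by (apply (Dom_Box Dmain Umain), disk_Dom; [apply axis_angle_main|lra]).
    rewrite (proj2 (proj2 (iso_y_sign _ _ _ B)) eq_refl).
    destruct (scale_bounds i) as [A1 A2].
    rewrite h_im_0, cosh_0, dh_im_0, dh_re_0 by (unfold msq; nra).
    assert (H := scale_shift_lam i). set (n := INR (i + shift)) in *.
    replace (lam / msq (scale i) 0) with (16 * (n * n) / lam) by (unfold msq, scale; fold n; field; lra).
    assert (Hn : INR i <= n) by (unfold n; apply le_INR, Nat.le_add_r).
    assert (1 <= n) by (unfold lam, kappa in *; lra).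
    replace (2 * (16 * (n * n) / lam * (16 * (n * n) / lam) + 0 * 0) / 1 ^ 4) with (512 / (lam * lam) * (n * n * (n * n))) by (field; lra).
    apply Rmult_le_compat_l; [apply Rlt_le, Rdiv_lt_0_compat; nra|].
    assert (1 <= n * n) by nra. nra.
  - apply (is_lim_seq_ext (fun i => INR i * (512 / (lam * lam)))); [intros; ring|].
    replace p_infty with (Rbar_mult p_infty (512 / (lam * lam))).
    + apply is_lim_seq_scal_r. apply is_lim_seq_INR.
    + simpl. assert (0 < 512 / (lam * lam)) by (apply Rdiv_lt_0_compat; nra).
      destruct (Rle_dec 0 (512 / (lam * lam))) as [h|h]; [|lra]. destruct (Rle_lt_or_eq_dec _ _ h); [easy|lra].
Qed.

(** With m = x^2 + a^2 and C = cosh (Im h), |A|^2 is at most 4 lam^2 / (m^2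
    C^4). If x^2 >= d^2 / 2, then m >= d^2 / 2. Otherwise rho^2 >= d^2 / 2, and
    [rho_upper] together with y^2 < m^(3/2) / (16 kappa^2) gives d^4 kappa^4 <=
    m^3 C^4 up to a constant, so that m^2 C^4 is bounded below, m being bounded
    above. *)
Lemma curvature_bound a x y d : strip (a, x, y) -> 0 < d -> d * d < x * x + rho a x y * rho a x y ->
  2 * (dh_re a x y * dh_re a x y + dh_im a x y * dh_im a x y) / cosh (h_im a x y) ^ 4 <= 16 * lam * lam / (d ^ 4) + 5 / (d ^ 4).
Proof.
  intros V Hd H. assert (L := lam_pos).
  assert (QP := zden_pos _ _ _ (strip_sector _ _ _ V)). destruct (zden_bounds _ _ _ V) as [Q1 _].
  destruct (base_sqrt _ _ (strip_base _ _ _ V)) as [M5 [Pr Er]]. assert (Hm := proj2 (proj2 (strip_base _ _ _ V))).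
  assert (C1 := cosh_ge_1 (h_im a x y)). assert (SU := rho_upper _ _ _ V).
  assert (E : dh_re a x y * dh_re a x y + dh_im a x y * dh_im a x y = lam * lam / zden a x y).
  { unfold dh_re, dh_im. transitivity (lam * lam * zden a x y / (zden a x y * zden a x y)); [|field; lra].
    unfold zden at 5. field. lra. }
  rewrite E. set (C := cosh (h_im a x y)) in *. set (m := msq a x) in *.
  assert (HC4 : 1 <= C ^ 4) by (apply pow_R1_Rle; lra).
  assert (HdP : 0 < d ^ 4) by (apply pow_lt; lra).
  assert (B0 : 2 * (lam * lam / zden a x y) / C ^ 4 <= 4 * (lam * lam) / (m * m * C ^ 4)).
  { assert (I : / zden a x y <= 2 / (m * m)).
    { apply Rmult_le_reg_l with (zden a x y * (m * m)); [apply Rmult_lt_0_compat; nra|].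
      field_simplify; [|lra|lra]. nra. }
    unfold Rdiv. replace (4 * (lam * lam) * / (m * m * C ^ 4)) with (2 * (lam * lam * (2 / (m * m))) * / C ^ 4) by (field; split; lra).
    apply Rmult_le_compat_r; [apply Rlt_le, Rinv_0_lt_compat; lra|]. apply Rmult_le_compat_l; [lra|].
    apply Rmult_le_compat_l; [nra|exact I]. }
  assert (P1 : 0 <= 16 * lam * lam / d ^ 4) by (apply Rlt_le, Rdiv_lt_0_compat; nra).
  assert (P2 : 0 <= 5 / d ^ 4) by (apply Rlt_le, Rdiv_lt_0_compat; lra).
  apply Rle_trans with (1 := B0).
  destruct (Rle_lt_dec (d * d / 2) (x * x)) as [K|K].
  - assert (Hmd : d * d / 2 <= m) by (unfold m, msq; nra).
    assert (d ^ 4 <= 4 * (m * m * C ^ 4)).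
    { assert (d * d / 2 * (d * d / 2) <= m * m) by (apply Rmult_le_compat; nra).
      assert (m * m * 1 <= m * m * C ^ 4) by (apply Rmult_le_compat_l; nra). simpl (d ^ 4). nra. }
    assert (4 * (lam * lam) / (m * m * C ^ 4) <= 16 * lam * lam / d ^ 4); [|lra].
    apply Rmult_le_reg_r with (m * m * C ^ 4 * d ^ 4); [apply Rmult_lt_0_compat; [apply Rmult_lt_0_compat; nra|lra]|].
    replace (4 * (lam * lam) / (m * m * C ^ 4) * (m * m * C ^ 4 * d ^ 4)) with (4 * (lam * lam) * d ^ 4) by (field; split; lra).
    replace (16 * lam * lam / d ^ 4 * (m * m * C ^ 4 * d ^ 4)) with (4 * (lam * lam) * (4 * (m * m * C ^ 4))) by (field; lra).
    apply Rmult_le_compat_l; nra.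
  - assert (Hs : d * d / 2 < rho a x y * rho a x y) by lra.
    set (t := y * y) in *.
    assert (Ht : 16 * kappa ^ 2 * t < m * sqrt m) by (destruct V as [_ V]; exact V).
    assert (T0 : 0 <= t) by (unfold t; nra).
    assert (N1 : d * d / 2 <= 2 * t * (C * C)) by lra.
    assert (CC : 1 <= C * C) by nra.
    assert (N2 : d * d * (4 * kappa ^ 2) <= m * sqrt m * (C * C)).
    { assert (16 * kappa ^ 2 * t * (C * C) <= m * sqrt m * (C * C)) by (apply Rmult_le_compat_r; lra).
      assert (0 < kappa ^ 2) by (unfold kappa; lra).
      assert (d * d / 2 * (8 * kappa ^ 2) <= 2 * t * (C * C) * (8 * kappa ^ 2)) by (apply Rmult_le_compat_r; lra). lra. }
    assert (N3 : d ^ 4 * (16 * kappa ^ 4) <= m * m * m * C ^ 4).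
    { assert (0 <= d * d * (4 * kappa ^ 2)) by (unfold kappa; nra).
      assert (d * d * (4 * kappa ^ 2) * (d * d * (4 * kappa ^ 2)) <= m * sqrt m * (C * C) * (m * sqrt m * (C * C))) by (apply Rmult_le_compat; lra).
      replace (m * sqrt m * (C * C) * (m * sqrt m * (C * C))) with (m * m * (sqrt m * sqrt m) * C ^ 4) in H1 by ring.
      rewrite Er in H1. lra. }
    assert (4 * (lam * lam) / (m * m * C ^ 4) <= 5 / d ^ 4); [|lra].
    apply Rmult_le_reg_r with (m * m * C ^ 4 * d ^ 4); [apply Rmult_lt_0_compat; [apply Rmult_lt_0_compat; nra|lra]|].
    replace (4 * (lam * lam) / (m * m * C ^ 4) * (m * m * C ^ 4 * d ^ 4)) with (d ^ 4 * (16 * kappa ^ 4)) by (unfold lam; field; split; lra).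
    replace (5 / d ^ 4 * (m * m * C ^ 4 * d ^ 4)) with (m * m * 5 * C ^ 4) by (field; lra).
    apply Rle_trans with (1 := N3). apply Rmult_le_compat_r; [lra|]. apply Rmult_le_compat_l; nra.
Qed.

Lemma Fmain_bounded d : 0 < d -> exists M, forall i x s, closed_disk (x, s) -> ~ in_ball d (Fmain i x s) -> normA2 (Fmain i) x s <= M.
Proof.
  intros Hd. exists (16 * lam * lam / (d ^ 4) + 5 / (d ^ 4)). intros i x s Hc Hb. apply closed_disk_sq in Hc.
  rewrite Fmain_normA2 by easy.
  assert (B : Box (scale i, x, s)) by (apply (Dom_Box Dmain Umain), disk_Dom; [apply axis_angle_main|easy]).
  destruct (iso_y_spec _ _ _ B) as [V E]. apply curvature_bound; [easy|easy|]. rewrite E.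
  apply Rnot_le_lt. intros K. apply Hb. unfold in_ball, enorm, Fmain. rewrite dot_surface_pt.
  rewrite <- (sqrt_square d) by lra. now apply sqrt_le_1_alt.
Qed.

(** * The limit disks *)

(** On each chord q = const of the unit disk, the affine map from the chord onto
    its half where e x > 0. It turns the half disk, which lacks its flat side,
    into a disk domain in the sense required. *)
Definition half_x (e _ p q : R) : R := e * ((p + sqrt (1 - q * q)) / 2).
Definition half_nbhd (p : R3) : Prop :=
  -1 < x1 p < 1 /\ -1 < x3 p < 1 /\ 0 < x2 p + sqrt (1 - x3 p * x3 p) /\ x2 p < 2.
(** The open unit disk together with the right half of the unit circle, without
    the poles: the image of the left half would be the flat side. *)
Definition half_dom (z : R * R) : Prop :=
  -1 < snd z < 1 /\ 0 < fst z + sqrt (1 - snd z * snd z) /\ closed_disk z.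
Definition Flim (e : R) : R -> R -> R3 := chart Ulim (half_x e) proj_s 0.

Lemma open_half_nbhd : open half_nbhd.
Proof. unfold half_nbhd. open_auto. Qed.

Lemma smooth_half_x e : smooth3 half_nbhd (half_x e).
Proof.
  assert (O := open_half_nbhd). intros n. unfold half_x. Ck_auto; [|intros; lra].
  intros a p q [_ [H _]]. unfold x3 in H; simpl in H. nra.
Qed.

Lemma sqrt_1_le q : sqrt (1 - q * q) <= 1.
Proof. rewrite <- sqrt_1 at 2. apply sqrt_le_1_alt. nra. Qed.

Lemma half_nbhd_Dom e a p q : e = 1 \/ e = -1 -> half_nbhd (a, p, q) -> Dom (Dlim e) (a, half_x e a p q, proj_s a p q).
Proof.
  intros He [H1 [H2 [H3 H4]]]. unfold Dom, Dlim, base, x1, x2, x3, half_x, proj_s in *; simpl in *.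
  assert (S := sqrt_1_le q). set (w := sqrt (1 - q * q)) in *.
  assert (P : 0 < e * (e * ((p + w) / 2))) by (destruct He as [-> | ->]; lra).
  split; [split; [split; [|split]|]|]; try easy; try lra.
  - destruct He as [-> | ->]; lra.
  - unfold msq. assert (0 < e * ((p + w) / 2) * (e * ((p + w) / 2))) by (destruct He as [-> | ->]; nra).
    assert (0 <= a * a) by apply Rle_0_sqr. lra.
Qed.

Lemma half_dom_half_nbhd z a : -1 < a < 1 -> half_dom z -> slice half_nbhd a z.
Proof.
  destruct z as [p q]. intros Ha [H1 [H2 H3]]. unfold closed_disk in H3. unfold slice, half_nbhd, x1, x2, x3; simpl in *.
  repeat split; try easy; try lra. nra.
Qed.

Lemma disk_domain_half_dom : disk_domain half_dom.
Proof.
  split.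
  - intros [p q] H. unfold half_dom, closed_disk; simpl in *. split; [nra|split; [|lra]].
    assert (p * p < 1 - q * q) by lra. assert (S := sqrt_pos (1 - q * q)). assert (E := sqrt_sqrt (1 - q * q)).
    assert (0 <= 1 - q * q) by nra. specialize (E H1). nra.
  - exists (fun z => -1 < snd z < 1 /\ 0 < fst z + sqrt (1 - snd z * snd z)). split.
    + open_auto.
    + intros z. unfold half_dom. tauto.
Qed.

Lemma Flim_embedded e : e = 1 \/ e = -1 -> embedded_minimal_disk half_dom (Flim e).
Proof.
  intros He. split; [apply disk_domain_half_dom|].
  assert (Hee : e * e = 1) by (destruct He as [-> | ->]; ring).
  apply (chart_embedding (Dlim e) Ulim half_nbhd (half_x e) proj_s 0 half_dom).
  - apply axis_angle_limit.
  - apply open_half_nbhd.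
  - apply smooth_half_x.
  - intros n; apply Ck_y.
  - intros a p q. now apply half_nbhd_Dom.
  - intros z. apply half_dom_half_nbhd. lra.
  - intros p q H. destruct (smooth_half_x e 1%nat) as [_ [hx [hy [D _]]]]. destruct (D _ _ _ H) as [D1 D2].
    exists (e / 2), (hy 0 p q), 0, 1. split; [|split; [exact D2|split; [exact (is_derive_const q p)|split; [exact (is_derive_id q)|destruct He as [-> | ->]; lra]]]].
    unfold half_x. auto_derive; [easy|]. field.
  - intros p q p' q' _ _ E1 E2. unfold proj_s in E2. subst q'. split; [|easy]. unfold half_x in E1.
    apply Rmult_eq_reg_l in E1; [lra|]. intros ->. lra.
  - intros p q H eps. unfold proj_s.
    assert (P := cond_pos eps). assert (P4 : 0 < eps / 4) by lra.
    assert (C : continuous (fun q => sqrt (1 - q * q)) q) by cont_auto.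
    destruct (cont_eps _ _ _ P4 C) as [d Hd].
    exists (Rmin d (eps / 4)). split; [apply Rmin_pos; [apply cond_pos|easy]|].
    intros p' q' _ H1 H2.
    assert (L1 : Rabs (half_x e 0 p' q' - half_x e 0 p q) < eps / 4) by (apply Rlt_le_trans with (1 := H1); apply Rmin_r).
    assert (L2 : Rabs (q' - q) < d) by (apply Rlt_le_trans with (1 := H2); apply Rmin_l).
    assert (L2' : Rabs (q' - q) < eps / 4) by (apply Rlt_le_trans with (1 := H2); apply Rmin_r).
    specialize (Hd _ L2). cbv beta in Hd. unfold half_x in L1.
    split; simpl.
    + change (Rabs (p' - p) < eps).
      apply Rabs_def2 in L1. apply Rabs_def2 in Hd. apply Rabs_def1; destruct He as [-> | ->]; lra.
    + change (Rabs (q' - q) < eps). lra.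
Qed.

Lemma half_x_inverse e x s : e = 1 \/ e = -1 -> 0 < e * x -> x * x + s * s <= 1 ->
  let p := 2 * (e * x) - sqrt (1 - s * s) in half_dom (p, s) /\ forall a, half_x e a p s = x.
Proof.
  intros He Hx H p.
  assert (Hee : e * e = 1) by (destruct He as [-> | ->]; ring).
  assert (X2 : x * x = (e * x) * (e * x)) by (transitivity (e * e * (x * x)); [rewrite Hee; ring|ring]).
  assert (S0 : 0 <= 1 - s * s) by nra. assert (E := sqrt_sqrt _ S0). assert (Sp := sqrt_pos (1 - s * s)).
  set (w := sqrt (1 - s * s)) in *. set (z := e * x) in *.
  split.
  - unfold half_dom, closed_disk; simpl. fold w. unfold p. split; [nra|split; [lra|]].
    assert (z <= w) by nra. assert (z * (w - z) >= 0) by nra. nra.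
  - intros a. unfold half_x. fold w. unfold p. replace (e * ((2 * z - w + w) / 2)) with (e * e * x) by (unfold z; field). rewrite Hee. ring.
Qed.

Lemma half_x_range e p q : e = 1 \/ e = -1 -> half_dom (p, q) -> forall a,
  0 < e * half_x e a p q /\ half_x e a p q * half_x e a p q + q * q <= 1.
Proof.
  intros He [H1 [H2 H3]] a. unfold closed_disk in H3. simpl in *. unfold half_x.
  assert (S0 : 0 <= 1 - q * q) by nra. assert (E := sqrt_sqrt _ S0). assert (Sp := sqrt_pos (1 - q * q)).
  set (w := sqrt (1 - q * q)) in *. assert (p <= w) by nra. split.
  - destruct He as [-> | ->]; lra.
  - replace (e * ((p + w) / 2) * (e * ((p + w) / 2))) with ((p + w) / 2 * ((p + w) / 2)) by (destruct He as [-> | ->]; ring). nra.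
Qed.

Lemma Flim_image e p : e = 1 \/ e = -1 -> image half_dom (Flim e) p <-> surface_set Ulim e 0 p.
Proof.
  intros He. split.
  - intros [x [y [H <-]]]. destruct (half_x_range e x y He H 0) as [K1 K2].
    exists (half_x e 0 x y), y. split; [now right|split; [exact K2|reflexivity]].
  - intros [x [s [K1 [K2 <-]]]]. assert (K : 0 < e * x) by (destruct K1 as [->|K1]; [destruct He; lra|easy]).
    destruct (half_x_inverse e x s He K K2) as [D E].
    exists (2 * (e * x) - sqrt (1 - s * s)), s. split; [exact D|]. unfold Flim, chart. now rewrite E.
Qed.

Lemma bounded_choice (Q : nat -> nat -> Prop) :
  (forall m, exists i1 : nat, forall i, (i1 <= i)%nat -> Q m i) ->
  forall n, exists i1 : nat, forall i, (i1 <= i)%nat -> forall m, (m <= n)%nat -> Q m i.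
Proof.
  intros H n. induction n as [|n [i1 IH]].
  - destruct (H 0%nat) as [i1 H1]. exists i1. intros i Hi m Hm. apply Nat.le_0_r in Hm. subst m. now apply H1.
  - destruct (H (S n)) as [i2 H2]. exists (Nat.max i1 i2). intros i Hi m Hm.
    apply Nat.le_succ_r in Hm. destruct Hm as [Hm| ->].
    + apply IH; [|easy]. apply Nat.le_trans with (2 := Hi), Nat.le_max_l.
    + apply H2. apply Nat.le_trans with (2 := Hi), Nat.le_max_r.
Qed.

(** The two normalizations differ by a multiple of 2 pi on each side of x = 0,
    by the choice of [scale]. *)
Lemma surface_pt_Umain_Ulim i x s : x <> 0 -> surface_pt Umain (scale i) x s = surface_pt Ulim (scale i) x s.
Proof.
  intros Hx. unfold surface_pt, theta.
  destruct (Umain_Ulim_cos (scale i) x (i + shift) (proj1 (scale_bounds i)) Hx (scale_period i) (phi (scale i) x s)) as [-> ->]. easy.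
Qed.

Lemma compact_height e (K : R3 -> Prop) : compact_set K -> (forall p, K p -> 0 < e * x3 p) ->
  exists d, 0 < d /\ forall p, K p -> d <= e * x3 p.
Proof.
  intros HK Hp.
  destruct (HK (fun V => open V /\ exists d, 0 < d /\ forall p, V p -> d <= e * x3 p)) as [l [Hl Hc]].
  - tauto.
  - intros p Kp. exists (fun q => e * x3 p / 2 < e * x3 q). specialize (Hp p Kp). split; [split|lra].
    + open_auto.
    + exists (e * x3 p / 2). split; [lra|]. intros q Hq. lra.
  - assert (exists d, 0 < d /\ forall V, In V l -> forall p, V p -> d <= e * x3 p) as [d [Hd1 Hd2]].
    { clear Hc. induction l as [|V l IH].
      - exists 1. split; [lra|easy].
      - destruct IH as [d [Hd1 Hd2]]; [intros; apply Hl; now right|].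
        destruct (Hl V (or_introl eq_refl)) as [_ [d' [Hd1' Hd2']]].
        exists (Rmin d d'). split; [now apply Rmin_pos|]. intros W [<-|HW] p Hp'.
        + apply Rle_trans with d'; [apply Rmin_r|now apply Hd2'].
        + apply Rle_trans with d; [apply Rmin_l|now apply (Hd2 W)]. }
    exists d. split; [easy|]. intros p Kp. destruct (Hc p Kp) as [V [HV Vp]]. now apply (Hd2 V).
Qed.

(** The approximating surfaces are parametrized by the same chart, with a = a_i
    in place of a = 0, over the compact set C where the height is at least that
    of K. The normalization [Ulim] makes the parametrization continuous at a = 0
    with all its derivatives. *)
Lemma limit_convergence e (W : R3 -> Prop) : e = 1 \/ e = -1 -> (forall p, W p -> 0 < e * x3 p) ->
  C2_converges W (fun i p => image closed_disk (Fmain i) p /\ x3 p <> 0) half_dom (Flim e).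
Proof.
  intros He HW K HK HKW.
  destruct (compact_height e K HK) as [d [Hd HKd]]; [intros p Hp; now apply HW, HKW|].
  (* the height in the chart is half of p + sqrt (1 - q^2) *)
  set (C := fun z : R * R => closed_disk z /\ 2 * d <= fst z + sqrt (1 - snd z * snd z)).
  assert (CD : forall z, C z -> half_dom z).
  { intros [p q] [H1 H2]. unfold half_dom. split; [|split; [lra|easy]]. unfold closed_disk in H1. simpl in *.
    destruct (Rlt_le_dec (q * q) 1); [nra|]. rewrite sqrt_neg_0 in H2 by lra. assert (q * q = 1) by nra. nra. }
  assert (HC : compact_set C).
  { apply compact_closed_bounded with 1.
    - intros [p q] [H _]. unfold closed_disk in H. simpl in *. split; nra.
    - apply open_ext with (fun z : R * R => 1 < fst z * fst z + snd z * snd z \/ fst z + sqrt (1 - snd z * snd z) < 2 * d).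
      + intros [p q]. unfold C, closed_disk; simpl. split.
        * intros [H|H] [H1 H2]; lra.
        * intros H. destruct (Rlt_le_dec 1 (p * p + q * q)); [now left|]. right.
          apply Rnot_le_lt. intros H'. apply H. split; lra.
      + open_auto. }
  assert (Hlift : forall U a x s, 0 < e * x -> x * x + s * s <= 1 -> K (surface_pt U a x s) -> forall U' a', image C (chart U' (half_x e) proj_s a') (surface_pt U' a' x s)).
  { intros U a x s H1 H2 H3 U' a'. destruct (half_x_inverse e x s He H1 H2) as [D E].
    exists (2 * (e * x) - sqrt (1 - s * s)), s. split.
    - split; [apply D|]. simpl. specialize (HKd _ H3). unfold surface_pt, x3 in HKd; simpl in HKd. lra.
    - unfold chart. now rewrite E. }
  exists C, (fun i => chart Ulim (half_x e) proj_s (scale i)), 0%nat. split; [exact HC|split; [exact CD|split; [|split]]].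
  - intros p Kp HI. apply Flim_image in HI; [|easy]. destruct HI as [x [s [K1 [K2 <-]]]].
    apply (Hlift Ulim 0 x s); [|easy|easy]. destruct K1 as [->|K1]; [destruct He; lra|easy].
  - intros i _. destruct (scale_bounds i) as [A1 A2].
    destruct (chart_smooth (Dlim e) Ulim half_nbhd (half_x e) proj_s (axis_angle_limit e) open_half_nbhd (smooth_half_x e) (fun n => Ck_y n half_nbhd) (fun a p q => half_nbhd_Dom e a p q He)) as [S1 [S2 S3]].
    assert (HO : forall z, C z -> slice half_nbhd (scale i) z) by (intros z Hz; apply half_dom_half_nbhd; [lra|now apply CD]).
    assert (Q : forall f, smooth3 half_nbhd f -> Cn_on 2 C (f (scale i))).
    { intros f Hf. exists (slice half_nbhd (scale i)). split; [apply open_slice, open_half_nbhd|split; [exact HO|]].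
      intros x y H. apply Ck_ex_diff_n with half_nbhd; [apply open_half_nbhd|apply Hf|exact H]. }
    split; [split; [exact (Q _ S1)|split; [exact (Q _ S2)|exact (Q _ S3)]]|split].
    + intros p [x [y [H <-]]]. destruct (half_x_range e x y He (CD _ H) (scale i)) as [K1 K2].
      assert (N : half_x e (scale i) x y <> 0) by (intros Z; rewrite Z in K1; lra).
      split; [|exact N]. exists (half_x e (scale i) x y), y. split; [unfold closed_disk; simpl; lra|].
      unfold Fmain. now apply surface_pt_Umain_Ulim.
    + intros p Kp [[x [s [H <-]]] N]. apply closed_disk_sq in H. unfold Fmain in *.
      assert (P : 0 < e * x) by exact (HW _ (HKW _ Kp)).
      assert (N' : x <> 0) by exact N.
      rewrite surface_pt_Umain_Ulim in Kp |- * by exact N'. now apply (Hlift Ulim (scale i)).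
  - intros eps.
    destruct (chart_smooth (Dlim e) Ulim half_nbhd (half_x e) proj_s (axis_angle_limit e) open_half_nbhd (smooth_half_x e) (fun n => Ck_y n half_nbhd) (fun a p q => half_nbhd_Dom e a p q He)) as [S1 [S2 S3]].
    set (Q := fun m k i => forall x y, C (x, y) -> ball (pd m k (Flim e) x y) eps (pd m k (chart Ulim (half_x e) proj_s (scale i)) x y)).
    assert (HQ : forall m k, exists i1 : nat, forall i, (i1 <= i)%nat -> Q m k i).
    { intros m k.
      assert (U : forall f, smooth3 half_nbhd f -> exists i1 : nat, forall i, (i1 <= i)%nat -> forall x y, C (x, y) ->
         ball (partial_derive m k (f 0) x y) eps (partial_derive m k (f (scale i)) x y)).
      { intros f Hf. assert (Sp := smooth3_partial half_nbhd f m k open_half_nbhd Hf).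
        destruct (uniform_limit_on_compact half_nbhd (fun a x y => partial_derive m k (f a) x y) C HC) with (eps := eps) as [del Hdel].
        - intros; now apply (cont_of_smooth half_nbhd).
        - intros x y H. apply (half_dom_half_nbhd (x, y) 0); [lra|now apply CD].
        - destruct (scale_small del (cond_pos del)) as [i1 Hi1]. exists i1. intros i Hi x y H. now apply Hdel; [apply Hi1|]. }
      destruct (U _ S1) as [i1 H1]. destruct (U _ S2) as [i2 H2]. destruct (U _ S3) as [i3 H3].
      exists (Nat.max i1 (Nat.max i2 i3)). intros i Hi x y H. split; [split|].
      - apply H1; [|easy]. lia.
      - apply H2; [|easy]. lia.
      - apply H3; [|easy]. lia. }
    destruct (bounded_choice (fun m i => forall k, (k <= 2)%nat -> Q m k i)) with (n := 2%nat) as [i1 H1].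
    { intros m. apply (bounded_choice (fun k i => Q m k i)). apply HQ. }
    exists i1. intros i Hi m k Hmk x y H. apply H1; [easy|lia|lia|easy].
Qed.

(** * Closure of the limit disks *)

Lemma cont_theta_at DU U a (sg : R) (p : R3) : axis_angle DU U -> Dom DU (a, x3 p, sg * rad p) ->
  continuous (fun q : R3 => theta U a (x3 q) (sg * rad q)) p.
Proof.
  intros HU H.
  apply (continuous_comp (fun q : R3 => (a, x3 q, sg * rad q) : R3) (fun q : R3 => theta U (x1 q) (x2 q) (x3 q))).
  - assert (C := cont_rad p). cont_auto.
  - apply (cont_of_smooth (Dom DU)); [now apply smooth_theta|exact H].
Qed.

(** Vanishes exactly when q is the point of the surface with the height of q and
    signed distance sg [rad] q. Being continuous off the plane, it detects
    limits of points of the surface. *)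
Definition defect (U : R -> R -> R) (a sg : R) (q : R3) : R :=
  (x1 q - sg * rad q * cos (theta U a (x3 q) (sg * rad q))) * (x1 q - sg * rad q * cos (theta U a (x3 q) (sg * rad q))) +
  (x2 q - sg * rad q * sin (theta U a (x3 q) (sg * rad q))) * (x2 q - sg * rad q * sin (theta U a (x3 q) (sg * rad q))).

Lemma defect_surface_pt U a x s : defect U a (if Rle_dec 0 s then 1 else -1) (surface_pt U a x s) = 0.
Proof.
  unfold defect. rewrite rad_surface_pt. unfold x3, surface_pt at 1 3 5 7; simpl.
  replace ((if Rle_dec 0 s then 1 else -1) * Rabs s) with s.
  - unfold x1, x2, surface_pt; simpl. ring.
  - destruct (Rle_dec 0 s); [rewrite Rabs_pos_eq|rewrite Rabs_left]; lra.
Qed.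

Lemma defect_zero U a sg q : defect U a sg q = 0 -> surface_pt U a (x3 q) (sg * rad q) = q.
Proof.
  unfold defect. intros H. apply Rplus_sqr_eq_0 in H. destruct H as [H1 H2].
  unfold surface_pt. destruct q as [[q1 q2] q3]. unfold x1, x2, x3 in *; simpl in *. f_equal. f_equal; lra.
Qed.

Lemma cont_defect DU U a sg (p : R3) : axis_angle DU U -> Dom DU (a, x3 p, sg * rad p) ->
  continuous (defect U a sg : R3 -> R) p.
Proof.
  intros HU H. assert (C := cont_theta_at DU U a sg p HU H). assert (C2 := cont_rad p). unfold defect. cont_auto.
Qed.

Lemma rad_sq p : rad p * rad p = x1 p * x1 p + x2 p * x2 p.
Proof. apply sqrt_sqrt. generalize (Rle_0_sqr (x1 p)) (Rle_0_sqr (x2 p)). unfold Rsqr. lra. Qed.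

(** The sign of s is not a continuous function on the closure, so both signs are
    tried: if neither defect vanished at p, both would be nonzero near p. *)
Lemma closure_off_plane e (p : R3) : e = 1 \/ e = -1 -> in_ball 1 p -> closure (T := R3U) (surface_set Ulim e 0) p ->
  x3 p = 0 \/ surface_set Ulim e 0 p.
Proof.
  intros He Hb Hcl. apply enorm_1_dot in Hb.
  assert (Hr : x3 p * x3 p + rad p * rad p <= 1) by (rewrite rad_sq; unfold dot in Hb; lra).
  assert (Rp : 0 <= rad p) by apply sqrt_pos.
  destruct (Rtotal_order (e * x3 p) 0) as [H|[H|H]].
  (* beyond the plane, p is at a positive distance from the surface *)
  - exfalso. assert (P : 0 < - (e * x3 p)) by lra. destruct (Hcl (mkposreal _ P)) as [q [[x [s [K1 [K2 <-]]]] [_ B]]].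
    assert (K : 0 < e * x) by (destruct K1 as [->|K1]; [destruct He; lra|easy]).
    change (Rabs (x - x3 p) < - (e * x3 p)) in B. apply Rabs_def2 in B. destruct He as [-> | ->]; lra.
  - left. destruct He as [-> | ->]; lra.
  - right.
    assert (HD : forall sg, sg = 1 \/ sg = -1 -> Dom (Dlim e) (0, x3 p, sg * rad p)).
    { intros sg Hsg. split; unfold x1, x2; simpl.
      - apply Dlim_0; [easy|easy|nra].
      - change (-2 < sg * rad p < 2). assert (rad p <= 1) by nra. destruct Hsg as [-> | ->]; lra. }
    assert (HP : exists sg, (sg = 1 \/ sg = -1) /\ defect Ulim 0 sg p = 0).
    { apply NNPP. intros HN.
      assert (N1 : 0 < Rabs (defect Ulim 0 1 p)) by (apply Rabs_pos_lt; intros Z; apply HN; exists 1; tauto).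
      assert (N2 : 0 < Rabs (defect Ulim 0 (-1) p)) by (apply Rabs_pos_lt; intros Z; apply HN; exists (-1); tauto).
      assert (L1 := cont_eps _ p _ N1 (cont_defect (Dlim e) Ulim 0 1 p (axis_angle_limit e) (HD 1 (or_introl eq_refl)))).
      assert (L2 := cont_eps _ p _ N2 (cont_defect (Dlim e) Ulim 0 (-1) p (axis_angle_limit e) (HD (-1) (or_intror eq_refl)))).
      destruct (filter_and (F := locally p) _ _ L1 L2) as [d Hd].
      destruct (Hcl d) as [q [[x [s [K1 [K2 <-]]]] B]]. destruct (Hd _ B) as [J1 J2].
      assert (Z := defect_surface_pt Ulim 0 x s). destruct (Rle_dec 0 s).
      - rewrite Z, Rminus_0_l, Rabs_Ropp in J1. lra.
      - rewrite Z, Rminus_0_l, Rabs_Ropp in J2. lra. }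
    destruct HP as [sg [Hsg Z]]. apply defect_zero in Z.
    exists (x3 p), (sg * rad p). split; [now right|split; [|exact Z]].
    destruct Hsg as [-> | ->]; lra.
Qed.

Lemma polar_angle b c : exists t, b = sqrt (b * b + c * c) * cos t /\ c = sqrt (b * b + c * c) * sin t.
Proof.
  assert (Hpos : forall b c, 0 < b -> exists t, b = sqrt (b * b + c * c) * cos t /\ c = sqrt (b * b + c * c) * sin t).
  { clear. intros b c Hb. exists (atan (c / b)). rewrite cos_atan, sin_atan.
    assert (P : 0 < b * b + c * c) by nra. assert (P2 := sqrt_lt_R0 _ P).
    replace (sqrt (1 + Rsqr (c / b))) with (sqrt (b * b + c * c) / b).
    - split; field; lra.
    - symmetry. apply sqrt_lem_1.
      + generalize (Rle_0_sqr (c / b)). lra.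
      + apply Rlt_le, Rdiv_lt_0_compat; lra.
      + replace (sqrt (b * b + c * c) / b * (sqrt (b * b + c * c) / b)) with (sqrt (b * b + c * c) * sqrt (b * b + c * c) / (b * b)) by (field; lra).
        rewrite sqrt_sqrt by lra. unfold Rsqr. field. lra. }
  destruct (Rtotal_order b 0) as [H|[->|H]].
  - destruct (Hpos (- b) (- c)) as [t [E1 E2]]; [lra|]. exists (t + PI). rewrite neg_cos, neg_sin.
    replace (- b * - b + - c * - c) with (b * b + c * c) in * by ring. split; lra.
  - replace (0 * 0 + c * c) with (Rsqr c) by (unfold Rsqr; ring). rewrite sqrt_Rsqr_abs.
    destruct (Rle_lt_dec 0 c).
    + exists (PI / 2). rewrite cos_PI2, sin_PI2, Rabs_pos_eq by easy. lra.
    + exists (- (PI / 2)). rewrite cos_neg, sin_neg, cos_PI2, sin_PI2, Rabs_left by easy. lra.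
  - now apply Hpos.
Qed.

(** A point of the flat disk, slightly contracted to stay inside the ball, has a
    polar angle t; the angles t - 2 pi k e with k large are attained at
    arbitrarily small heights. *)
Lemma closure_plane e (p : R3) : e = 1 \/ e = -1 -> in_ball 1 p -> x3 p = 0 ->
  closure (T := R3U) (surface_set Ulim e 0) p.
Proof.
  intros He Hb H3 eps. apply enorm_1_dot in Hb. unfold dot in Hb. rewrite H3 in Hb.
  assert (Hee : e * e = 1) by (destruct He as [-> | ->]; ring).
  assert (PP := PI_RGT_0). assert (Pe := cond_pos eps). assert (Lp := lam_pos).
  set (d := Rmin (1 / 2) (eps / 2)).
  assert (Hd : 0 < d) by (apply Rmin_pos; lra). assert (Hd1 : d <= 1 / 2) by apply Rmin_l. assert (Hd2 : d <= eps / 2) by apply Rmin_r.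
  destruct (polar_angle (x1 p) (x2 p)) as [t [E1 E2]]. fold (rad p) in E1, E2.
  assert (Rq := rad_sq p). assert (Rp : 0 <= rad p) by apply sqrt_pos.
  assert (R1 : rad p <= 1) by nra.
  (* a representative of the angle far enough along the spiral *)
  destruct (INR_unbounded ((e * t + lam / d + 2 * PI) / (2 * PI))) as [k Hk].
  apply Rlt_div_l in Hk; [|lra].
  set (r := (1 - d) * rad p).
  set (t' := t - e * (2 * INR k * PI)).
  assert (Ec : cos t' = cos t /\ sin t' = sin t).
  { unfold t'. destruct He as [-> | ->].
    - rewrite <- (cos_period (t - 1 * (2 * INR k * PI)) k), <- (sin_period (t - 1 * (2 * INR k * PI)) k).
      replace (t - 1 * (2 * INR k * PI) + 2 * INR k * PI) with t by ring. easy.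
    - replace (t - -1 * (2 * INR k * PI)) with (t + 2 * INR k * PI) by ring. split; [apply cos_period|apply sin_period]. }
  assert (HX : exists x, 0 < e * x < d /\ surface_pt Ulim 0 x r = (r * cos t, r * sin t, x)).
  { destruct (Req_dec (rad p) 0) as [Z|Z].
    - exists (e * (d / 2)). split; [rewrite <- Rmult_assoc, Hee; lra|]. unfold r. rewrite Z, Rmult_0_r, surface_pt_axis. f_equal. f_equal; ring.
    - destruct (limit_angle_attained e 1 0 d t' r He (or_introl (conj eq_refl eq_refl))) as [x [K1 [K2 K3]]]; [lra| | |].
      + unfold r. nra.
      + unfold t'. replace (e * (t - e * (2 * INR k * PI))) with (e * t - e * e * (2 * INR k * PI)) by ring. rewrite Hee.
        replace (- lam / d) with (- (lam / d)) by (field; lra). lra.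
      + exists x. split; [easy|]. rewrite <- (proj1 Ec), <- (proj2 Ec), <- K3.
        rewrite (turn_angle_surface_pt Ulim 1 0 0 r x) by (now left). now rewrite Rmult_1_l. }
  destruct HX as [x [Hx EF]].
  assert (X2 : x * x = (e * x) * (e * x)) by (transitivity (e * e * (x * x)); [rewrite Hee; ring|ring]).
  exists (surface_pt Ulim 0 x r). split.
  - exists x, r. split; [now right|split; [|easy]]. unfold r.
    assert (rad p * rad p <= 1) by nra. assert ((1 - d) * (1 - d) * (rad p * rad p) <= (1 - d) * (1 - d) * 1) by (apply Rmult_le_compat_l; nra).
    assert (x * x <= d * d) by nra. nra.
  - rewrite EF. assert (CB := COS_bound t). assert (SB := SIN_bound t).
    assert (dr : 0 <= d * rad p <= d) by nra.
    split; [split|]; simpl.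
    + change (Rabs (r * cos t - x1 p) < eps). rewrite E1. unfold r.
      replace ((1 - d) * rad p * cos t - rad p * cos t) with (- (d * rad p * cos t)) by ring. rewrite Rabs_Ropp. apply Rabs_def1; nra.
    + change (Rabs (r * sin t - x2 p) < eps). rewrite E2. unfold r.
      replace ((1 - d) * rad p * sin t - rad p * sin t) with (- (d * rad p * sin t)) by ring. rewrite Rabs_Ropp. apply Rabs_def1; nra.
    + change (Rabs (x - x3 p) < eps). rewrite H3, Rminus_0_r. apply Rabs_def1; destruct He as [-> | ->]; lra.
Qed.

(** * The theorem *)

Lemma Fmain_surface_set i p : image closed_disk (Fmain i) p <-> surface_set Umain 0 (scale i) p.
Proof.
  split.
  - intros [x [s [H <-]]]. exists x, s. split; [now left|split; [now apply closed_disk_sq|easy]].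
  - intros [x [s [_ [H <-]]]]. exists x, s. split; [unfold closed_disk; simpl; lra|easy].
Qed.

Lemma Dmain_main i x : -1 <= x <= 1 -> Dmain (scale i) x.
Proof. intros H. apply (disk_Dom i x 0). nra. Qed.

Lemma closure_ext {T : UniformSpace} (P Q : T -> Prop) p : (forall q, P q <-> Q q) -> closure P p -> closure Q p.
Proof. intros H HP eps. destruct (HP eps) as [q [K1 K2]]. exists q. split; [now apply H|easy]. Qed.

Lemma limit_disk e : e = 1 \/ e = -1 ->
  let Sg := image half_dom (Flim e) in
  embedded_minimal_disk half_dom (Flim e) /\
  (forall p : R3, Sg p -> in_ball 1 p /\ 0 < e * x3 p) /\
  (forall p : R3, in_ball 1 p /\ closure Sg p /\ ~ Sg p <-> in_ball 1 p /\ x3 p = 0) /\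
  (exists S1 S2 : R3 -> Prop,
     multivalued_graph S1 /\ multivalued_graph S2 /\
     (forall p : R3, Sg p /\ ~ on_axis p <-> S1 p \/ S2 p) /\
     spirals_into_plane S1 /\ spirals_into_plane S2).
Proof.
  intros He Sg. split; [now apply Flim_embedded|].
  assert (HS : forall p : R3, Sg p -> in_ball 1 p /\ 0 < e * x3 p).
  { intros p Hp. apply Flim_image in Hp; [|easy]. destruct Hp as [x [s [K1 [K2 <-]]]]. split.
    - apply enorm_le_1. now rewrite dot_surface_pt.
    - destruct K1 as [->|K1]; [destruct He; lra|easy]. }
  split; [exact HS|split].
  - intros p. split.
    + intros [H1 [H2 H3]]. split; [easy|].
      destruct (closure_off_plane e p He H1) as [K|K]; [|easy|].
      * apply (closure_ext Sg); [intros q; now apply Flim_image|exact H2].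
      * elim H3. now apply Flim_image.
    + intros [H1 H2]. split; [easy|split].
      * apply (closure_ext (T := R3U) (surface_set Ulim e 0)); [intros q; symmetry; now apply Flim_image|now apply closure_plane].
      * intros H. apply HS in H. rewrite H2 in H. lra.
  - destruct (two_graphs (Dlim e) Ulim e 0) as [G1 [G2 G3]]; [tauto|apply axis_angle_limit|apply convex_Dlim| |].
    { intros x [->|K] Hx; [destruct He; lra|]. apply Dlim_0; [easy|easy|lra]. }
    exists (graph_set (Half e) (turn_angle Ulim 1 0) 0), (graph_set (Half e) (turn_angle Ulim (-1) PI) 0).
    split; [exact G1|split; [exact G2|split; [|split]]].
    + intros p. rewrite <- G3. split; intros [H1 H2]; (split; [|exact H2]); now apply Flim_image.
    + apply limit_spirals; [easy|now left].
    + apply limit_spirals; [easy|now right].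
Qed.

Theorem theorem1 :
  exists F : nat -> R -> R -> R3,
    let Sigma := fun i : nat => image closed_disk (F i) in
    (forall i : nat,
       embedded_minimal_disk closed_disk (F i) /\
       Sigma i (0, 0, 0) /\
       (forall p : R3, Sigma i p -> in_ball 1 p) /\
       (forall p : R3, image unit_circle (F i) p -> enorm p = 1) /\
       (forall t : R, Rabs t < 1 -> Sigma i (0, 0, t))) /\
    (* (1) *)
    (exists a b : nat -> R,
       (forall i : nat, closed_disk (a i, b i) /\ F i (a i) (b i) = (0, 0, 0)) /\
       is_lim_seq (fun i : nat => normA2 (F i) (a i) (b i)) p_infty) /\
    (* (2) *)
    (forall delta : R, 0 < delta ->
       exists M : R, forall (i : nat) (x y : R),
         closed_disk (x, y) -> ~ in_ball delta (F i x y) ->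
         normA2 (F i) x y <= M) /\
    (* (3) *)
    (forall i : nat, exists S1 S2 : R3 -> Prop,
       multivalued_graph S1 /\ multivalued_graph S2 /\
       forall p : R3, Sigma i p /\ ~ on_axis p <-> S1 p \/ S2 p) /\
    (* (4) *)
    (exists (Dp Dm : R * R -> Prop) (Fp Fm : R -> R -> R3),
       let Sp := image Dp Fp in
       let Sm := image Dm Fm in
       embedded_minimal_disk Dp Fp /\ embedded_minimal_disk Dm Fm /\
       (forall p : R3, Sp p -> in_ball 1 p /\ 0 < x3 p) /\
       (forall p : R3, Sm p -> in_ball 1 p /\ x3 p < 0) /\
       C2_converges (fun p : R3 => 0 < x3 p)
         (fun (i : nat) (p : R3) => Sigma i p /\ x3 p <> 0) Dp Fp /\
       C2_converges (fun p : R3 => x3 p < 0)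
         (fun (i : nat) (p : R3) => Sigma i p /\ x3 p <> 0) Dm Fm /\
       (forall p : R3,
          in_ball 1 p /\ closure Sp p /\ ~ Sp p <-> in_ball 1 p /\ x3 p = 0) /\
       (forall p : R3,
          in_ball 1 p /\ closure Sm p /\ ~ Sm p <-> in_ball 1 p /\ x3 p = 0) /\
       (exists S1 S2 : R3 -> Prop,
          multivalued_graph S1 /\ multivalued_graph S2 /\
          (forall p : R3, Sp p /\ ~ on_axis p <-> S1 p \/ S2 p) /\
          spirals_into_plane S1 /\ spirals_into_plane S2) /\
       (exists S1 S2 : R3 -> Prop,
          multivalued_graph S1 /\ multivalued_graph S2 /\
          (forall p : R3, Sm p /\ ~ on_axis p <-> S1 p \/ S2 p) /\
          spirals_into_plane S1 /\ spirals_into_plane S2)).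

Proof.
  exists Fmain. intros Sigma. split; [|split; [|split; [|split]]].
  - intros i. split; [apply Fmain_embedded|split; [|split; [|split]]].
    + exists 0, 0. split; [unfold closed_disk; simpl; lra|exact (surface_pt_axis Umain (scale i) 0)].
    + intros p [x [s [H <-]]]. apply enorm_le_1. unfold Fmain. rewrite dot_surface_pt. now apply closed_disk_sq.
    + intros p [x [s [H <-]]]. unfold enorm, Fmain. rewrite dot_surface_pt. unfold unit_circle in H; simpl in H.
      replace (x * x + s * s) with 1 by lra. apply sqrt_1.
    + intros t Ht. exists t, 0. split; [|exact (surface_pt_axis Umain (scale i) t)]. apply Rabs_def2 in Ht. unfold closed_disk; simpl. nra.
  - exists (fun _ => 0), (fun _ => 0). split; [|apply Fmain_blowup].
    intros i. split; [unfold closed_disk; simpl; lra|exact (surface_pt_axis Umain (scale i) 0)].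
  - intros delta Hd. destruct (Fmain_bounded delta Hd) as [M HM]. now exists M.
  - intros i. destruct (two_graphs Dmain Umain 0 (scale i)) as [G1 [G2 G3]]; [tauto|apply axis_angle_main|apply convex_Dmain| |].
    { intros x _. apply Dmain_main. }
    exists (graph_set (Half 0) (turn_angle Umain 1 0) (scale i)), (graph_set (Half 0) (turn_angle Umain (-1) PI) (scale i)).
    split; [exact G1|split; [exact G2|]]. intros p. rewrite <- G3.
    split; intros [H1 H2]; (split; [|exact H2]); now apply Fmain_surface_set.
  - assert (Hp : 1 = 1 \/ 1 = -1) by now left. assert (Hm : -1 = 1 \/ -1 = -1) by now right.
    destruct (limit_disk 1 Hp) as [P1 [P2 [P3 P4]]]. destruct (limit_disk (-1) Hm) as [M1 [M2 [M3 M4]]].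
    exists half_dom, half_dom, (Flim 1), (Flim (-1)). intros Sp Sm.
    split; [exact P1|split; [exact M1|split; [|split; [|split; [|split; [|split; [exact P3|split; [exact M3|split; [exact P4|exact M4]]]]]]]]].
    + intros p H. destruct (P2 p H) as [K1 K2]. split; [exact K1|lra].
    + intros p H. destruct (M2 p H) as [K1 K2]. split; [exact K1|lra].
    + apply (limit_convergence 1); [exact Hp|intros; lra].
    + apply (limit_convergence (-1)); [exact Hm|intros; lra].
Qed.
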